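(* Let $\alpha,\beta\in(0,1)$ with $\alpha+\beta<1$. (a) If $f\in\{n^{1-(\alpha+\beta)}\}^{\#}BV$, then $\sigma_{n,m}^{-\alpha,-\beta}(x,y;f)$ converges to $f(x,y)$ as $n,m\to\infty$ (independently) at every point $(x,y)\in I^2$ at which $f$ is continuous. (b) Let $\Lambda=\{n^{1-(\alpha+\beta)}\xi_n\}_{n=1}^\infty$, where $\xi_n>0$ and $\xi_n\uparrow\infty$ as $n\to\infty$. Then there exists a function $f\in C(I^2)\cap C\Lambda^{\#}V$ for which the $(C;-\alpha,-\beta)$-means of the double Walsh–Fourier series diverge unboundedly at $(0,0)$, i.e. $\limsup_{n,m\to\infty}|\sigma_{n,m}^{-\alpha,-\beta}(0,0;f)|=+\infty$.
   Context: Let $I=[0,1)$ and let $f$ be a real measurable function on $I^2=[0,1)^2$; $C(I^2)$ denotes the functions continuous on $I^2$ in the usual sense. For an interval $\Delta=(a,b)$ with endpoints in $I$ and $x,y\in I$ put $f(\Delta,y)=f(b,y)-f(a,y)$ and $f(x,\Delta)=f(x,b)-f(x,a)$. Let $\Omega$ be the set of all (finite or countable) collections of nonoverlapping intervals in $I$, each ordered (indexed) in an arbitrary way. For a sequence of positive numbers $\Lambda=\{\lambda_n\}_{n=1}^\infty$ define $$\Lambda^{\#}V_1(f)=\sup_{\{y_i\}\subset I}\ \sup_{\{I_i\}\in\Omega}\sum_i\frac{|f(I_i,y_i)|}{\lambda_i},\qquad \Lambda^{\#}V_2(f)=\sup_{\{x_j\}\subset I}\ \sup_{\{J_j\}\in\Omega}\sum_j\frac{|f(x_j,J_j)|}{\lambda_j},$$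 and $\Lambda^{\#}V(f)=\Lambda^{\#}V_1(f)+\Lambda^{\#}V_2(f)$. The class $\Lambda^{\#}BV$ consists of all $f$ with $\Lambda^{\#}V(f)<\infty$. The class $C\Lambda^{\#}V$ consists of all $f$ with $\lim_{n\to\infty}\Lambda_n^{\#}V(f)=0$, where $\Lambda_n=\{\lambda_k\}_{k=n}^\infty$ is the tail sequence (re-indexed from its first term). Walsh system: $r_0$ is the 1-periodic function equal to $1$ on $[0,1/2)$ and $-1$ on $[1/2,1)$; $r_n(x)=r_0(2^nx)$. Put $w_0=1$ and, for $k=2^{n_1}+\cdots+2^{n_s}$ with $n_1>\cdots>n_s\ge 0$, $w_k(x)=r_{n_1}(x)\cdots r_{n_s}(x)$. For $f\in L^1(I^2)$, $\hat f(n,m)=\int_{I^2}f(x,y)w_n(x)w_m(y)\,dx\,dy$ and $$S_{M,N}(x,y;f)=\sum_{m=0}^{M-1}\sum_{n=0}^{N-1}\hat f(m,n)w_m(x)w_n(y).$$ For real $a,b\neq-1,-2,\ldots$, the Cesàro $(C;a,b)$-means are $$\sigma_{n,m}^{a,b}(x,y;f)=\frac1{A_{n-1}^{a}A_{m-1}^{b}}\sum_{i=1}^n\sum_{j=1}^mA_{n-i}^{a-1}A_{m-j}^{b-1}S_{i,j}(x,y;f),\qquad A_0^{a}=1,\quad A_n^{a}=\frac{(a+1)\cdots(a+n)}{n!}.$$ Dyadic addition: every $x\in I$ is written $x=\sum_{k\ge0}x_k2^{-(k+1)}$, $x_k\in\{0,1\}$, choosing for dyadic rationals the expansion with $x_k\to0$;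 then $x\dotplus y=\sum_{k\ge0}|x_k-y_k|2^{-(k+1)}$. The function $f$ is said to be continuous at the point $(x,y)$ if $\lim_{h,\delta\to0}f(x\dotplus h,y\dotplus\delta)=f(x,y)$ (with $h,\delta\in I$ such that the point $(x\dotplus h,y\dotplus\delta)$ lies in $I^2$). *)

(* Defs.v *)
From HB Require Import structures.
From mathcomp Require Import all_boot all_order all_algebra.
From mathcomp Require Import all_classical all_reals all_analysis.

Set Implicit Arguments.
Unset Strict Implicit.
Unset Printing Implicit Defensive.

Import Order.TTheory GRing.Theory Num.Theory.
Import numFieldNormedType.Exports.

Local Open Scope classical_set_scope.
Local Open Scope ring_scope.

(* A function on [0,1)^2 is represented by a total function R * R -> R; none
   of the notions below depends on its values outside [0,1)^2.
   A sequence (lambda_n)_{n >= 1} is represented by lam : nat -> R with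
   lam k = lambda_{k+1}. *)

Definition unitI {R : realType} : set R := `[0, 1[%classic.

Definition unitI2 {R : realType} : set (R * R) := unitI `*` unitI.

(* The intervals (lft i, rgt i) for i in idx. *)
Record collection (R : realType) := Collection {
  idx : set nat;
  lft : nat -> R;
  rgt : nat -> R }.

(* Finite collections are indexed by {0, ..., n-1}, countably infinite ones by
   the whole of nat; since lft and rgt need not be monotone in the index, the
   ordering is arbitrary. *)
Definition Omega (R : realType) : set (collection R) :=
  [set c | [/\ idx c = [set: nat] \/ (exists n, idx c = `I_n),
               (forall i, idx c i ->
                  [/\ unitI (lft c i), unitI (rgt c i) & lft c i < rgt c i])
             & trivIset (idx c) (fun i => `]lft c i, rgt c i[%classic)]].

Definition sharpV1 (R : realType) (lam : nat -> R) (f : R * R -> R) : \bar R :=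
  ereal_sup [set
    ereal_sup [set
      (\esum_(i in idx c)
         (`|f (rgt c i, y i) - f (lft c i, y i)| / lam i)%:E)%E
      | c in @Omega R]
    | y in [set y : nat -> R | range y `<=` unitI]].

Definition sharpV2 (R : realType) (lam : nat -> R) (f : R * R -> R) : \bar R :=
  ereal_sup [set
    ereal_sup [set
      (\esum_(j in idx c)
         (`|f (x j, rgt c j) - f (x j, lft c j)| / lam j)%:E)%E
      | c in @Omega R]
    | x in [set x : nat -> R | range x `<=` unitI]].

Definition sharpV (R : realType) (lam : nat -> R) (f : R * R -> R) : \bar R :=
  (sharpV1 lam f + sharpV2 lam f)%E.

Definition sharpBV (R : realType) (lam : nat -> R) (f : R * R -> R) : Prop :=
  measurable_fun unitI2 f /\ (sharpV lam f < +oo)%E.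

(* tail n lam represents (lambda_k)_{k >= n+1}. *)
Definition tail (R : realType) (n : nat) (lam : nat -> R) : nat -> R :=
  fun k => lam (n + k)%N.

Definition CsharpV (R : realType) (lam : nat -> R) (f : R * R -> R) : Prop :=
  measurable_fun unitI2 f /\ sharpV (tail n lam) f @[n --> \oo] --> 0%E.

Definition rademacher0 (R : realType) (x : R) : R :=
  if x - (Num.floor x)%:~R < 2^-1 then 1 else -1.

Definition rademacher (R : realType) (n : nat) (x : R) : R :=
  rademacher0 (2 ^+ n * x).

(* odd (k %/ 2 ^ i) tells whether 2^i occurs in the binary expansion of k,
   which forces i < k. *)
Definition walsh (R : realType) (k : nat) (x : R) : R :=
  \prod_(i < k | odd (k %/ 2 ^ i)) rademacher i x.

Definition walsh_coef (R : realType) (f : R * R -> R) (n m : nat) : R :=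
  \int[(lebesgue_measure \x lebesgue_measure)%E]_(p in unitI2)
    (f p * walsh n p.1 * walsh m p.2).

Definition walsh_sum (R : realType) (M N : nat) (x y : R) (f : R * R -> R) : R :=
  \sum_(0 <= m < M) \sum_(0 <= n < N) walsh_coef f m n * walsh m x * walsh n y.

Definition cesaroA (R : realType) (a : R) (n : nat) : R :=
  (\prod_(1 <= k < n.+1) (a + k%:R)) / n`!%:R.

Definition cesaro_mean (R : realType) (a b : R) (n m : nat) (x y : R)
    (f : R * R -> R) : R :=
  (cesaroA a n.-1 * cesaroA b m.-1)^-1 *
  \sum_(1 <= i < n.+1) \sum_(1 <= j < m.+1)
    cesaroA (a - 1) (n - i) * cesaroA (b - 1) (m - j) * walsh_sum i j x y f.

(* For x in [0,1), the digit of index k of x in base 2 is the parity of the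
   integer part of 2^(k+1) x; this selects the expansion with finitely many
   nonzero digits when x is a dyadic rational. *)
Definition dyadic_digit (R : realType) (x : R) (k : nat) : bool :=
  odd `|Num.floor (2 ^+ k.+1 * x)|%N.

Definition dyadic_add (R : realType) (x y : R) : R :=
  limn (series (fun k : nat =>
    `|(dyadic_digit x k)%:R - (dyadic_digit y k)%:R| / 2 ^+ k.+1 : R)).

(* dyadic_add may take the value 1, hence the condition on the translated
   point. *)
Definition dyadic_continuous_at (R : realType) (f : R * R -> R) (x y : R) : Prop :=
  f (dyadic_add x h.1, dyadic_add y h.2)
    @[h --> within [set h : R * R | unitI2 h /\
                      unitI2 (dyadic_add x h.1, dyadic_add y h.2)]
                   (nbhs (0 : R, 0 : R))]
    --> f (x, y).

(* Main.v *)
Require Import Defs.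
From HB Require Import structures.
From mathcomp Require Import all_boot all_order all_algebra.
From mathcomp Require Import all_classical all_reals all_analysis.
From mathcomp Require Import measurable_realfun ring lra zify.

Set Implicit Arguments.
Unset Strict Implicit.
Unset Printing Implicit Defensive.

Import Order.TTheory GRing.Theory Num.Theory.
Import numFieldNormedType.Exports.

Local Open Scope classical_set_scope.
Local Open Scope ring_scope.

(** Positive part.  The deviation of a (C,-al,-be)-mean at (x,y) is the integral
    of f(x (+) s, y (+) t) - f(x, y) against a product of two one-dimensional
    kernels.  [kern_expansion] writes such a kernel as a Dirichlet kernel of
    order a power of 2 plus a combination of Haar-like atoms, one for every
    generation t <= N and every rank i < 2^t; the rank orders the cells of a
    generation by their dyadic distance to the origin.  By summation by parts
    in the Cesaro numbers the coefficients decay geometrically in N - t and like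
    (i+1)^-(1-al) in the rank ([norm_acoef]).  The atoms have mean zero, so each
    pairing of f with a product of two atoms is at most the oscillation of f over
    a cell in either of the two variables ([pairing_le_osc1], [pairing_le_osc2]),
    and it is small when both cells are close to the origin, by continuity at
    (x,y) ([pairing_near]).  Using, for ranks i and j, the oscillation in the
    variable of the larger rank, the sum over the smaller one turns the weight
    (i+1)^-(1-al) (j+1)^-(1-be) into (i+1)^-(1-al-be) ([weighted_double_sum]):
    this is where the weights of the sharp variation come from, and the abscissae
    or ordinates at which the oscillations are taken vary from cell to cell,
    which is why the variation has to be the sharp one.  The cells of rank at
    least K contribute a tail of the sharp variation, uniformly in the
    generations, and such tails tend to 0: for power weights the sharp class
    coincides with its continuous subclass ([wsum_tail], [power_tail]), because
    otherwise two collections deep in the tail could be merged, one of them lying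
    between every second interval of the other, and halving the indices of the
    latter multiplies its weights by 2^(1-al-be) > 1, which gives too large a value.

    Negative part.  A ripple is c sin(2 pi 2^N x) sin(2 pi 2^N y).  Of the Walsh
    functions of index at most 2^N only the last one correlates with either
    factor, so its mean of order 2^N + 1 at the origin is a single
    Walsh coefficient divided by two Cesaro numbers, hence at least a constant
    times c 2^(N (al+be)) ([ripple_mean_ge]).  Its sharp variation is at most a
    constant times the sum of c / lambda_i over i < 2^N ([ripple_var1]), which is
    o(c 2^(N (al+be))) because xi tends to infinity ([weighted_average]).  So c
    can be taken such that the means grow while the variation tends to 0, and
    [hump_sequence] adds up ripples of rapidly increasing frequencies: at the
    resonant order of one of them, the earlier ones have almost converged to
    their value 0 at the origin, by the positive part ([ripple_decay]), and the
    later ones have amplitudes too small to matter. *)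

(** * Tails of sharp variations with power weights *)

Fixpoint wsum (R : realType) (T : Type) (w : nat -> R) (g : T -> R) (n : nat) (l : seq T) : R :=
  if l is x :: l' then w n * g x + wsum w g n.+1 l' else 0.

Section WeightedSums.
Variables (R : realType) (T : eqType).
Implicit Types (w : nat -> R) (g : T -> R) (l : seq T).

Lemma wsum_cat w g n l1 l2 :
  wsum w g n (l1 ++ l2) = wsum w g n l1 + wsum w g (n + size l1) l2.
Proof.
elim: l1 n => [|x l1 IH] n /=; first by rewrite add0r addn0.
by rewrite IH addSnnS addrA.
Qed.

Lemma ler_wsum w g h n l : (forall k, 0 <= w k) ->
  (forall x, x \in l -> g x <= h x) -> wsum w g n l <= wsum w h n l.
Proof.
move=> w0; elim: l n => [|x l IH] n //= gh.
apply: lerD; first by rewrite ler_wpM2l // gh ?mem_head.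
by apply: IH => y yl; rewrite gh // inE yl orbT.
Qed.

Lemma wsumD w g h n l :
  wsum w (fun x => g x + h x) n l = wsum w g n l + wsum w h n l.
Proof. by elim: l n => [|x l IH] n /=; rewrite ?addr0 // IH; ring. Qed.

Lemma wsum_shift w g n m l :
  (forall k, 0 <= g k) -> nonincreasing_seq w -> (n <= m)%N ->
  wsum w g m l <= wsum w g n l.
Proof.
move=> g0 wd; elim: l n m => [|x l IH] n m nm //=.
by apply: lerD; [rewrite ler_wpM2r // wd|apply: IH].
Qed.

(** Deleting terms moves the remaining ones to larger weights. *)
Lemma wsum_filter w g n (p : pred T) l :
  (forall k, 0 <= g k) -> nonincreasing_seq w ->
  wsum w (fun x => if p x then g x else 0) n l <= wsum w g n [seq x <- l | p x].
Proof.
move=> g0 wd; elim: l n => [|x l IH] n //=.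
case: ifP => px /=; first by rewrite lerD2l.
by rewrite mulr0 add0r (le_trans (IH _)) // wsum_shift.
Qed.

Lemma wsum_sumr w (I : Type) (r : seq I) (h : I -> T -> R) n l :
  wsum w (fun x => \sum_(i <- r) h i x) n l = \sum_(i <- r) wsum w (h i) n l.
Proof.
elim: l n => [|x l IH] n /=; first by rewrite big1.
by rewrite IH mulr_sumr big_split.
Qed.

Fixpoint evens (s : seq T) : seq T :=
  if s is x :: s' then x :: odds s' else [::]
with odds (s : seq T) : seq T :=
  if s is _ :: s' then evens s' else [::].

Lemma evens_odds_subseq l : subseq (evens l) l /\ subseq (odds l) l.
Proof.
elim: l => [|x l [IH1 IH2]] //=; rewrite eqxx IH2; split=> //.
exact: subseq_trans IH1 (subseq_cons _ _).
Qed.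

Lemma mem_evens_odds l x : x \in evens l ++ odds l -> x \in l.
Proof.
have [/mem_subseq H1 /mem_subseq H2] := evens_odds_subseq l.
by rewrite mem_cat => /orP[/H1|/H2].
Qed.

(** Keeping every second term of a list halves the indices, hence multiplies
    each weight by the doubling constant [c] of the weight sequence. *)
Lemma wsum_evens_odds w g c n l :
  (forall k, 0 <= g k) ->
  (forall k, c * w (k.*2.+1) <= w k) -> (forall k, c * w (k.*2.+2) <= w k) ->
  c * wsum w g n.*2.+1 l <= wsum w g n (evens l) + wsum w g n (odds l).
Proof.
move=> g0 c1 c2.
suff: c * wsum w g n.*2.+1 l <= wsum w g n (evens l) + wsum w g n (odds l) /\
      c * wsum w g n.*2.+2 l <= wsum w g n (evens l) + wsum w g n.+1 (odds l).
  by case.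
elim: l n => [|x l IH] n /=; first by rewrite !mulr0 addr0.
rewrite !mulrDr; split.
  have [_ H] := IH n.
  have := ler_wpM2r (g0 x) (c1 n); rewrite -mulrA => H'.
  apply: (le_trans (lerD H' H)); rewrite -!addrA lerD2l.
  by rewrite addrC.
have [H _] := IH n.+1.
have := ler_wpM2r (g0 x) (c2 n); rewrite -mulrA => H'.
apply: (le_trans (lerD H' H)); rewrite -!addrA lerD2l.
by rewrite addrC.
Qed.

End WeightedSums.

Section Tail.
Variable R : realType.
(* An entry (a, b, y) is an interval ]a, b[ together with a value of the other
   variable. *)
Notation item := (R * R * R)%type.

Definition apart (u v : item) : bool := (u.1.2 <= v.1.1) || (v.1.2 <= u.1.1).

Definition proper (u : item) : bool :=
  [&& 0 <= u.1.1, u.1.1 < u.1.2, u.1.2 < 1, 0 <= u.2 & u.2 < 1].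

Definition family (l : seq item) : bool := all proper l && pairwise apart l.

Lemma apartC u v : apart u v = apart v u.
Proof. by rewrite /apart orbC. Qed.

Lemma family_subseq l1 l2 : subseq l1 l2 -> family l2 -> family l1.
Proof.
move=> s /andP[a p]; apply/andP; split; last exact: subseq_pairwise s p.
by apply/allP => x /(mem_subseq s); exact/allP.
Qed.

Lemma family_cat l1 l2 : family l1 -> family l2 ->
  allrel apart l1 l2 -> family (l1 ++ l2).
Proof.
move=> /andP[a1 p1] /andP[a2 p2] r.
by rewrite /family all_cat a1 a2 pairwise_cat r p1 p2.
Qed.

Definition straddles (e : R) (u : item) : bool := (u.1.1 < e) && (e < u.1.2).

(** Only one member of a family can straddle a given point. *)
Lemma wsum_straddle (w : nat -> R) (B : R) (e : R) n l :
  0 <= B -> (forall k, 0 <= w k) -> nonincreasing_seq w -> family l ->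
  wsum w (fun u => if straddles e u then B else 0) n l <= w n * B.
Proof.
move=> B0 w0 wd; elim: l n => [|x l IH] n /=; first by rewrite mulr_ge0.
move=> fl; have fl' := family_subseq (subseq_cons l x) fl.
case: ifP => sx; last first.
  by rewrite mulr0 add0r (le_trans (IH _ fl')) // ler_wpM2r // wd.
suff -> : wsum w (fun u => if straddles e u then B else 0) n.+1 l = 0.
  by rewrite addr0.
have : all (fun u => ~~ straddles e u) l.
  apply/allP => y yl; apply/negP => sy.
  case/andP: fl => _ /=; case/andP => /allP /(_ _ yl) + _.
  move: sx sy; rewrite /straddles /apart => /andP[a1 a2] /andP[b1 b2].
  by case/orP => h; lra.
elim: l n.+1 {IH fl fl'} => [|y l IH] k //= /andP[/negbTE -> al].
by rewrite mulr0 add0r IH.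
Qed.

Definition endpoints (l : seq item) : seq R := [seq u.1.1 | u <- l] ++ [seq u.1.2 | u <- l].

Lemma size_endpoints l : size (endpoints l) = (size l).*2.
Proof. by rewrite size_cat !size_map addnn. Qed.

Lemma apart_or_inside l z x : family l -> proper z ->
  ~~ has (fun e => straddles e z) (endpoints l) -> x \in l ->
  apart x z || ((x.1.1 <= z.1.1) && (z.1.2 <= x.1.2)).
Proof.
move=> /andP[/allP pr _] pz /hasPn ns xl.
have: ~~ straddles x.1.1 z by apply: ns; rewrite mem_cat (map_f (fun u : item => u.1.1)).
have: ~~ straddles x.1.2 z.
  by apply: ns; rewrite mem_cat (map_f (fun u : item => u.1.2)) // orbT.
have /and5P[h1 h2 h3 h4 h5] := pr _ xl.
have /and5P[h1' h2' h3' h4' h5'] := pz.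
rewrite /straddles /apart !negb_and -!leNgt => /orP[b|b] /orP[a|a].
- by rewrite b.
- by rewrite b.
- by rewrite a b orbT.
- by rewrite a orbT.
Qed.

Lemma allrel_evens_odds l : pairwise apart l -> allrel apart (evens l) (odds l).
Proof.
elim: l => [|x l IH] //= /andP[xl /IH r].
rewrite allrel_consl; apply/andP; split.
  by apply/allP => y ye; apply: (allP xl); apply: mem_evens_odds; rewrite mem_cat ye.
by rewrite allrelC (eq_allrel (fun u v => apartC v u)).
Qed.

(** A member of [l] that meets z contains it, so that z is apart from all the
    other members. *)
Lemma apart_from_one_half l z : family l -> proper z ->
  ~~ has (fun e => straddles e z) (endpoints l) ->
  all (fun x => apart x z) (evens l) || all (fun x => apart x z) (odds l).
Proof.
move=> fl pz ns.
case: (boolP (all (fun x => apart x z) (evens l))) => //= /allPn[x x1 nx].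
apply/allP => y y2.
have /andP[/allP pr pw] := fl.
have xl : x \in l by apply: mem_evens_odds; rewrite mem_cat x1.
have yl : y \in l by apply: mem_evens_odds; rewrite mem_cat y2 orbT.
have := apart_or_inside fl pz ns xl; rewrite (negbTE nx) /= => /andP[i1 i2].
have /allrelP/(_ x y x1 y2) := allrel_evens_odds pw.
by rewrite /apart => /orP[h|h]; apply/orP; [right|left]; lra.
Qed.

Variables (g : item -> R) (B V : R) (w : nat -> R) (c : R).
Hypotheses (g0 : forall u, 0 <= g u) (gB : forall u, proper u -> g u <= B)
  (B0 : 0 <= B) (w0 : forall k, 0 <= w k) (wd : nonincreasing_seq w)
  (wlim : w k @[k --> \oo] --> 0) (c1 : 1 < c) (c2 : c <= 2)
  (cw1 : forall k, c * w (k.*2.+1) <= w k)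
  (cw2 : forall k, c * w (k.*2.+2) <= w k).
Hypothesis gV : forall l, family l -> wsum w g 0 l <= V.

(** Each endpoint of [l1] is interior to at most one member of [l2]; the members
    that straddle an endpoint account for the last term, and each other one is
    counted in at least one of the two filtered sums. *)
Lemma wsum_halves n l1 l2 : family l1 -> family l2 ->
  wsum w g n l2 <=
    wsum w g n [seq z <- l2 | all (fun x => apart x z) (evens l1)] +
    wsum w g n [seq z <- l2 | all (fun x => apart x z) (odds l1)] +
    (size l1).*2%:R * (w n * B).
Proof.
move=> f1 f2.
set p1 := fun z => all _ (evens l1); set p2 := fun z => all _ (odds l1).
have H : wsum w g n l2 <= wsum w (fun z => ((if p1 z then g z else 0) +
   (if p2 z then g z else 0)) +
   \sum_(e <- endpoints l1) (if straddles e z then B else 0)) n l2.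
  apply: ler_wsum => // z zl; have /andP[/allP /(_ _ zl) pz _] := f2.
  have s0 : 0 <= \sum_(e <- endpoints l1) (if straddles e z then B else 0).
    by apply: sumr_ge0 => e _; case: ifP.
  have [h|h] := boolP (has (fun e => straddles e z) (endpoints l1)).
    have gs : g z <= \sum_(e <- endpoints l1) (if straddles e z then B else 0).
      have /hasP[e el es] := h.
      rewrite (big_rem e) //= es (le_trans (gB pz)) // lerDl.
      by apply: sumr_ge0 => e' _; case: ifP.
    by have := g0 z; case: ifP; case: ifP => _ _; lra.
  have := apart_from_one_half f1 pz h; rewrite -/(p1 z) -/(p2 z).
  by have := g0 z; case: (p1 z); case: (p2 z) => //= ? _; lra.
apply: (le_trans H); rewrite !wsumD wsum_sumr; apply: lerD.
  by apply: lerD; exact: wsum_filter.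
rewrite -size_endpoints; elim: (endpoints l1) => [|e s IH].
  by rewrite big_nil mul0r.
rewrite big_cons /= -natr1 mulrDl mul1r addrC; apply: lerD => //.
exact: wsum_straddle.
Qed.

(** Let v be the infimum of the bounds valid for the tails of the weights, and
    suppose v > 0. Take a family l1 that nearly attains v with weights shifted by
    2 n0 + 1, and a family l2 that nearly attains it with weights shifted so far
    that its few members straddling an endpoint of l1 are negligible. Joining the
    odd half of l1 with the part of l2 apart from it, and likewise the even half,
    yields two families whose sums add up to almost (c + 1) v, while each is at
    most almost v. This is absurd, because c > 1. *)
Lemma wsum_tail eps : 0 < eps -> exists n, forall l, family l -> wsum w g n l <= eps.
Proof.
pose A := [set v : R | 0 <= v /\ exists n, forall l, family l -> wsum w g n l <= v].
have V0 : 0 <= V by have := gV (isT : family [::]).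
have hA : has_inf A.
  split; first by exists V; split => //; exists 0%N.
  by exists 0 => v [].
set v := inf A.
have v0 : 0 <= v by apply: lb_le_inf; [exact: hA.1|move=> x []].
move: v0; rewrite le_eqVlt => /predU1P[v0|v0] e0.
  have [x [x0 [n nx]] xe] := inf_adherent e0 hA.
  exists n => l fl; apply: (le_trans (nx l fl)).
  by move: xe; rewrite -/v -v0 add0r => /ltW.
exfalso.
pose d := (c - 1) / 8 * v.
have d0 : 0 < d by rewrite mulr_gt0 // divr_gt0 // subr_gt0.
have dv : d <= v by rewrite /d ler_piMl ?(ltW v0) //; have := c2; lra.
have [x [x0 [n0 n0x]] xd] := inf_adherent d0 hA.
(* no tail admits a bound smaller than v *)
have big : forall n, exists2 l, family l & v - d < wsum w g n l.
  move=> n; apply: contrapT => no.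
  have : A (v - d).
    split; first by rewrite subr_ge0.
    exists n => l fl; rewrite leNgt; apply/negP => h; apply: no.
    by exists l.
  by move/(ge_inf hA.2); rewrite -/v; lra.
have [l1 f1 h1] := big n0.*2.+1.
have [m [m1 m2]] : exists m, (n0 + size l1 <= m)%N /\ (size l1).*2%:R * (w m * B) <= d.
  have C0 : 0 < (size l1).*2%:R * B + 1 :> R by rewrite ltr_wpDl // mulr_ge0.
  have : \forall k \near \oo, `|w k| < d / ((size l1).*2%:R * B + 1).
    by have /cvgr0Pnorm_lt := wlim; apply; rewrite divr_gt0.
  move=> [M _ HM]; exists (maxn M (n0 + size l1)).
  split; first exact: leq_maxr.
  have /HM /= := leq_maxl M (n0 + size l1).
  rewrite ger0_norm // ltr_pdivlMr // => /ltW h.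
  have := w0 (maxn M (n0 + size l1)) => wk.
  by apply: le_trans h; rewrite mulrDr mulr1 mulrCA lerDl.
have [l2 f2 h2] := big m.
have e1 := wsum_halves m f1 f2.
have e2 := wsum_evens_odds n0 l1 g0 cw1 cw2.
have [s1 s2] := evens_odds_subseq l1.
have join l' : subseq l' l1 ->
    wsum w g n0 l' + wsum w g m [seq z <- l2 | all (fun x => apart x z) l'] <= x.
  move=> s.
  have fa : family (l' ++ [seq z <- l2 | all (fun x => apart x z) l']).
    apply: family_cat; [exact: family_subseq s f1| |].
      exact: family_subseq (filter_subseq _ _) f2.
    rewrite allrelC; apply/allP => z; rewrite mem_filter => /andP[/allP za _].
    by apply/allP => y /za.
  apply: le_trans (n0x _ fa); rewrite wsum_cat lerD2l wsum_shift //.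
  by rewrite (leq_trans _ m1) // leq_add2l size_subseq.
have j1 := join _ s1; have j2 := join _ s2.
move: xd; rewrite -/v => xd.
have : c * (v - d) <= c * wsum w g n0.*2.+1 l1 by rewrite ler_wpM2l // ltW // (lt_trans ltr01).
have : (c - 1) * v = 8 * d by rewrite /d; field.
have : c * d <= 2 * d by rewrite ler_wpM2r // ltW.
lra.
Qed.

End Tail.

Lemma wsum_nth (R : realType) (T : Type) (w : nat -> R) (g : T -> R) (x0 : T) n l :
  wsum w g n l = \sum_(i < size l) w (n + i)%N * g (nth x0 l i).
Proof.
elim: l n => [|x l IH] n /=; first by rewrite big_ord0.
rewrite big_ord_recl addn0 IH; congr (_ + _); apply: eq_bigr => i _.
by rewrite /= addSnnS.
Qed.

Lemma sharpV1_family (R : realType) (lam : nat -> R) (f : R * R -> R)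
    (l : seq (R * R * R)) : (forall k, 0 < lam k) -> family l ->
  ((wsum (fun k => (lam k)^-1)
     (fun u => `|f (u.1.2, u.2) - f (u.1.1, u.2)|) 0 l)%:E <= sharpV1 lam f)%E.
Proof.
move=> l0 /andP[/allP pr /(pairwiseP (0,0,0)) pw].
(* the default entry lies in the unit square, since y is constrained at every
   index *)
pose d : R * R * R := (0, 2^-1, 0).
have pd : proper d.
  by rewrite /proper /d /= lexx ltr01 invr_gt0 ltr0n invf_lt1 // ltr1n.
have prn i : proper (nth d l i).
  by case: (ltnP i (size l)) => h; [apply/pr/mem_nth|rewrite nth_default].
pose c := Collection `I_(size l) (fun i => (nth d l i).1.1) (fun i => (nth d l i).1.2).
pose y i := (nth d l i).2.
have cO : @Omega R c.
  split.
  - by right; exists (size l).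
  - move=> i _ /=; have /and5P[h1 h2 h3 h4 h5] := prn i.
    split => //; rewrite /unitI /= in_itv /=; apply/andP; split => //; lra.
  - apply/trivIsetP => i j /= il jl ij.
    have H a b : (a < b)%N -> (b < size l)%N ->
       `](nth d l a).1.1, (nth d l a).1.2[ `&` `](nth d l b).1.1, (nth d l b).1.2[ = set0.
      move=> ab bl; have al := ltn_trans ab bl.
      apply/seteqP; split => // t []; rewrite /= !in_itv /= => /andP[a1 a2] /andP[b1 b2].
      have := pw a b al bl ab; rewrite !(set_nth_default d) // /apart.
      by case/orP => h; lra.
    case: (ltngtP i j) ij => // h _; first exact: H.
    by rewrite setIC; exact: H.
have yO : range y `<=` unitI.
  move=> _ [i _ <-]; have /and5P[h1 h2 h3 h4 h5] := prn i.
  by rewrite /unitI /= in_itv /= h4.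
rewrite /sharpV1.
apply: le_trans (ereal_sup_ubound _); last by exists y; [exact: yO|reflexivity].
apply: le_trans (ereal_sup_ubound _); last by exists c; [exact: cO|reflexivity].
rewrite (wsum_nth _ _ d) esum_fset; last 2 first.
- exact: finite_II.
- by move=> i _; rewrite lee_fin mulr_ge0 // invr_ge0 ltW.
rewrite -(fsbig_ord _ _ (fun i => (`|f (rgt c i, y i) - f (lft c i, y i)| / lam i)%:E)).
rewrite sumEFin lee_fin; apply: ler_sum => i _.
by rewrite add0n mulrC.
Qed.

(** * Power weights and Cesaro numbers *)

Section PowerWeights.
Variable R : realType.
Implicit Types (a p x : R) (n k : nat).

(** Young's inequality for the product of x^p and 1. *)
Lemma powR_bernoulli p x : 0 < p < 1 -> 0 <= x -> x `^ p <= 1 + p * (x - 1).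
Proof.
move=> /andP[p0 p1] x0.
have q0 : 0 < 1 - p by rewrite subr_gt0.
have := @conjugate_powR R (x `^ p) 1 p^-1 (1 - p)^-1 (powR_ge0 _ _) ler01.
rewrite !invr_gt0 q0 p0 !invrK => /(_ isT isT).
rewrite -powRrM divff ?gt_eqF // powRr1 // powR1 mulr1 mul1r => H.
by apply: le_trans (H _) _; [ring|rewrite le_eqVlt; apply/orP; left; apply/eqP; ring].
Qed.

Definition pw (g : R) (k : nat) : R := k.+1%:R `^ (- g).

Lemma pw_gt0 g k : 0 < pw g k. Proof. by rewrite powR_gt0. Qed.
Lemma pw_ge0 g k : 0 <= pw g k. Proof. exact/ltW/pw_gt0. Qed.
Lemma pw0 g : pw g 0 = 1. Proof. by rewrite /pw powR1. Qed.

Lemma pwN g k : (k.+1%:R `^ g)^-1 = pw g k. Proof. by rewrite /pw powRN. Qed.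

Lemma pw_dec g : 0 <= g -> nonincreasing_seq (pw g).
Proof.
move=> g0 n m nm; rewrite /pw !powRN lef_pV2 ?posrE ?powR_gt0 //.
by apply: ge0_ler_powR; rewrite ?nnegrE // ler_nat.
Qed.

Lemma pw_double1 g k : 2 `^ g * pw g k.*2.+1 = pw g k.
Proof.
rewrite /pw (_ : k.*2.+2%:R = 2 * k.+1%:R :> R); last first.
  by rewrite -doubleS -mul2n natrM.
by rewrite powRM // mulrA -powRD ?subrr ?powRr0 ?mul1r //; apply/implyP.
Qed.

Lemma pw_double2 g k : 0 <= g -> 2 `^ g * pw g k.*2.+2 <= pw g k.
Proof.
move=> g0; rewrite -(pw_double1 g k) ler_wpM2l ?powR_ge0 //.
exact: pw_dec.
Qed.

Lemma pw_cvg0 g : 0 < g -> pw g k @[k --> \oo] --> 0.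
Proof.
move=> g0; apply/cvgr0Pnorm_lt => e e0; near=> k.
rewrite ger0_norm ?pw_ge0 // /pw powRN invf_plt ?posrE ?powR_gt0 //.
have -> : e^-1 = (e^-1 `^ g^-1) `^ g.
  by rewrite -powRrM mulVf ?gt_eqF // powRr1 // invr_ge0 ltW.
apply: gt0_ltr_powR; rewrite ?nnegrE ?powR_ge0 //.
near: k; exists (Num.trunc (e^-1 `^ g^-1)) => // k /= h.
by apply: lt_le_trans (truncnS_gt _) _; rewrite ler_nat ltnS.
Unshelve. all: by end_near. Qed.

(** Bernoulli's inequality at n / (n+1), multiplied by (n+1)^(1-a). *)
Lemma pw_incr a n : 0 < a < 1 ->
  (1 - a) * pw a n <= n.+1%:R `^ (1 - a) - n%:R `^ (1 - a).
Proof.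
move=> /andP[a0 a1]; have q : 0 < 1 - a < 1 by lra.
have n0 : (0:R) < n.+1%:R by [].
have := powR_bernoulli q (_ : 0 <= n%:R / n.+1%:R :> R).
rewrite divr_ge0 // => /(_ isT).
rewrite powRM ?invr_ge0 // -powR_inv1 // -powRrM mulN1r => H.
have e : n.+1%:R `^ (1 - a) * n.+1%:R `^ (- (1 - a)) = 1 :> R.
  by rewrite -powRD ?subrr ?powRr0 //; apply/implyP => _; rewrite gt_eqF.
have e2 : pw a n = n.+1%:R `^ (1 - a) * n.+1%:R `^ (- 1).
  rewrite /pw -powRD; first by congr (_ `^ _); ring.
  by apply/implyP => _; rewrite gt_eqF.
have := ler_wpM2l (powR_ge0 n.+1%:R (1 - a)) H.
rewrite mulrCA e mulr1 => H2.
have e3 : n%:R / n.+1%:R - 1 = - n.+1%:R^-1 :> R.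
  by rewrite -[n.+1%:R]natr1; field; rewrite natr1 pnatr_eq0.
move: H2; rewrite powR_inv1 // e3 => H2.
rewrite e2 powR_inv1 //.
by rewrite lerBrDl addrC -lerBrDl; apply: le_trans H2 _; rewrite le_eqVlt; apply/orP; left; apply/eqP; ring.
Qed.

Lemma sum_pw a n : 0 < a < 1 ->
  \sum_(k < n) pw a k <= n%:R `^ (1 - a) / (1 - a).
Proof.
move=> ha; have a1 : 0 < 1 - a by lra.
elim: n => [|n IH]; first by rewrite big_ord0 divr_ge0 ?powR_ge0 // ltW.
rewrite big_ord_recr /=; have := pw_incr n ha.
move: IH; rewrite !ler_pdivlMr // => H1 H2; rewrite [leLHS]mulrDl [pw a n * _]mulrC; lra.
Qed.

End PowerWeights.

Section CesaroNumbers.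
Variable R : realType.
Implicit Types (a : R) (n k : nat).

Lemma cesaroA0 a : cesaroA a 0 = 1.
Proof. by rewrite /cesaroA big_geq // divr1. Qed.

Lemma cesaroAS a n : cesaroA a n.+1 = cesaroA a n * ((a + n.+1%:R) / n.+1%:R).
Proof.
rewrite /cesaroA big_nat_recr //= factS natrM invfM; ring.
Qed.

Lemma cesaroA_pred a n : cesaroA (a - 1) n.+1 = a / n.+1%:R * cesaroA a n.
Proof.
elim: n => [|n IH]; first by rewrite cesaroAS !cesaroA0; field.
by rewrite cesaroAS IH cesaroAS -!natr1; field; rewrite !natr1 !pnatr_eq0.
Qed.

Lemma cesaroA_diff a n : cesaroA a n.+1 - cesaroA a n = a / n.+1%:R * cesaroA a n.
Proof. by rewrite cesaroAS -natr1; field; rewrite natr1 pnatr_eq0. Qed.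

Lemma sum_cesaroA a n : \sum_(k < n.+1) cesaroA (a - 1) k = cesaroA a n.
Proof.
elim: n => [|n IH]; first by rewrite big_ord1 !cesaroA0.
by rewrite big_ord_recr /= IH cesaroA_pred -cesaroA_diff; ring.
Qed.

Variable a : R.
Hypothesis ha : 0 < a < 1.

Lemma cesaroN_gt0 n : 0 < cesaroA (- a) n.
Proof.
elim: n => [|n IH]; first by rewrite cesaroA0.
rewrite cesaroAS mulr_gt0 // divr_gt0 // -natr1.
have : 0 <= n%:R :> R by []. (have := ha; lra).
Qed.

Lemma cesaroN_drop n :
  cesaroA (- a) n - cesaroA (- a) n.+1 = a / n.+1%:R * cesaroA (- a) n.
Proof. by rewrite -opprB cesaroA_diff; ring. Qed.

Lemma cesaroN_dec : nonincreasing_seq (cesaroA (- a)).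
Proof.
apply/nonincreasing_seqP => n; rewrite -subr_ge0 cesaroN_drop.
by rewrite mulr_ge0 ?(ltW (cesaroN_gt0 n)) // divr_ge0 //; (have := ha; lra).
Qed.

(** By Bernoulli's inequality, the ratio 1 - a/(n+1) of consecutive Cesaro numbers
    is at most that of the powers (n+1)^(-a); the lower bound is obtained from the
    same inequality with the powers shifted by one index. *)
Lemma cesaroN_le_pw n : cesaroA (- a) n <= pw a n.
Proof.
elim: n => [|n IH]; first by rewrite cesaroA0 pw0.
rewrite cesaroAS.
have n2 : (0:R) < n.+2%:R by []. have n1 : (0:R) < n.+1%:R by [].
have := powR_bernoulli ha (_ : 0 <= n.+2%:R / n.+1%:R :> R).
rewrite divr_ge0 // => /(_ isT) H.
(* (1 + 1/(n+1))^(-a) >= 1 - a/(n+1) *)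
have e : pw a n.+1 * (n.+2%:R / n.+1%:R) `^ a = pw a n.
  rewrite powRM ?invr_ge0 // mulrA /pw -powRD ?addNr ?powRr0 ?mul1r; last first.
    by apply/implyP => _; rewrite gt_eqF.
  by rewrite -powR_inv1 // -powRrM mulN1r.
have b : 1 + a * (n.+2%:R / n.+1%:R - 1) = 1 + a / n.+1%:R.
  by rewrite -[n.+2%:R]natr1 -[n.+1%:R]natr1; field; rewrite !natr1 pnatr_eq0.
have c : (- a + n.+1%:R) / n.+1%:R = 1 - a / n.+1%:R by rewrite -natr1; field; rewrite natr1 pnatr_eq0.
have p := pw_gt0 a n.+1.
rewrite b in H; rewrite c.
have d0 : 0 < a / n.+1%:R by rewrite divr_gt0 //; (have := ha; lra).
have d1 : a / n.+1%:R < 1.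
  by rewrite ltr_pdivrMr // mul1r (lt_le_trans (proj2 (andP ha))) // ler1n.
set d := a / n.+1%:R in H d0 d1 *.
apply: le_trans (ler_wpM2r _ IH) _; first (have := ha; lra).
rewrite -e -mulrA ler_piMr ?(ltW p) //.
apply: le_trans (ler_wpM2r _ H) _; first (have := ha; lra).
nra.
Qed.

Lemma cesaroN_ge_pw n : (1 - a) * pw a n <= cesaroA (- a) n.
Proof.
case: n => [|n]; first by rewrite cesaroA0 pw0; (have := ha; lra).
suff H : (1 - a) * pw a n <= cesaroA (- a) n.+1.
  apply: le_trans H; rewrite ler_wpM2l ?pw_dec //; (have := ha; lra).
elim: n => [|n IH].
  rewrite pw0 cesaroAS cesaroA0; (have := ha; lra).
rewrite cesaroAS.
have n2 : (0:R) < n.+2%:R by []. have n1 : (0:R) < n.+1%:R by [].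
have := powR_bernoulli ha (_ : 0 <= n.+1%:R / n.+2%:R :> R).
rewrite divr_ge0 // => /(_ isT) H.
have e : pw a n * (n.+1%:R / n.+2%:R) `^ a = pw a n.+1.
  rewrite powRM ?invr_ge0 // mulrA /pw -powRD ?addNr ?powRr0 ?mul1r; last first.
    by apply/implyP => _; rewrite gt_eqF.
  by rewrite -powR_inv1 // -powRrM mulN1r.
have c : (- a + n.+2%:R) / n.+2%:R = 1 + a * (n.+1%:R / n.+2%:R - 1).
  by rewrite -[n.+2%:R]natr1 -[n.+1%:R]natr1; field; rewrite !natr1 pnatr_eq0.
rewrite c -e mulrA ler_pM ?mulr_ge0 ?pw_ge0 ?powR_ge0 //; (have := ha; lra).
Qed.

Lemma sum_cesaroN n : \sum_(k < n) cesaroA (- a) k <= n%:R `^ (1 - a) / (1 - a).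
Proof.
by apply: le_trans (sum_pw n ha); apply: ler_sum => k _; exact: cesaroN_le_pw.
Qed.

(** Each of the m drops is a/(k+1) times a Cesaro number of index k >= e. *)
Lemma cesaroN_gap e m :
  cesaroA (- a) e - cesaroA (- a) (e + m) <= m%:R * (pw a e / e.+1%:R).
Proof.
elim: m => [|m IH]; first by rewrite addn0 subrr mul0r.
have := cesaroN_drop (e + m); rewrite addnS => D.
have : a / (e + m).+1%:R * cesaroA (- a) (e + m) <= pw a e / e.+1%:R.
  rewrite mulrC; apply: ler_pM => //.
  - exact/ltW/cesaroN_gt0.
  - by rewrite divr_ge0 //; (have := ha; lra).
  - apply: le_trans (cesaroN_le_pw _) _; apply: pw_dec; first (have := ha; lra).
    by rewrite leq_addr.
  apply: le_trans (_ : (e + m).+1%:R^-1 <= _).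
    by rewrite ler_piMl ?invr_ge0 //; (have := ha; lra).
  by rewrite lef_pV2 ?posrE // ler_nat ltnS leq_addr.
move=> H; rewrite -[m.+1%:R]natr1 [leRHS]mulrDl mul1r.
by rewrite -D in H; have := lerD IH H; rewrite addrA subrK.
Qed.

End CesaroNumbers.

(** * Walsh products *)

Section WalshProducts.
Variable R : realType.
Implicit Types (e : nat -> R) (i k l t : nat).

(** Walsh functions with the Rademacher values replaced by arbitrary factors, so
    that w_i(x) w_i(s) is again of this form. *)
Definition wprod e i : R := \prod_(l < i | odd (i %/ 2 ^ l)) e l.

Lemma walshE k (x : R) : walsh k x = wprod (fun l => rademacher l x) k.
Proof. by []. Qed.

Lemma wprod_wide e i T : (i < 2 ^ T)%N ->
  wprod e i = \prod_(0 <= l < T) (if odd (i %/ 2 ^ l) then e l else 1).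
Proof.
move=> iT; rewrite /wprod big_mkcond -(big_mkord xpredT (fun l => if odd (i %/ 2 ^ l) then e l else 1)).
have H m n : (i < 2 ^ m)%N -> (m <= n)%N ->
    \prod_(0 <= l < n) (if odd (i %/ 2 ^ l) then e l else 1) =
    \prod_(0 <= l < m) (if odd (i %/ 2 ^ l) then e l else 1).
  move=> im mn; rewrite (big_cat_nat (leq0n m) mn) /= [X in _ * X]big_nat_cond [X in _ * X]big1 ?mulr1 //.
  move=> l /andP[/andP[ml _] _]; rewrite divn_small //.
  by rewrite (leq_trans im) // leq_pexp2l.
case: (leqP T i) => h; first by rewrite (H T i).
by rewrite (H i T) ?(ltnW h) // ltn_expl.
Qed.

Lemma wprodM e e' i : wprod (fun l => e l * e' l) i = wprod e i * wprod e' i.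
Proof. by rewrite /wprod big_split. Qed.

Lemma eq_wprod e e' T i : (i < 2 ^ T)%N -> (forall l, (l < T)%N -> e l = e' l) ->
  wprod e i = wprod e' i.
Proof.
move=> iT ee; rewrite !(wprod_wide _ iT); apply: eq_big_nat => l /andP[_ lT].
by rewrite ee.
Qed.

Lemma wprod1 e k i : (i < 2 ^ k)%N -> (forall l, (l < k)%N -> e l = 1) -> wprod e i = 1.
Proof.
move=> ik e1; rewrite (wprod_wide _ ik) big_nat_cond big1 // => l /andP[/andP[_ lk] _].
by rewrite e1 // if_same.
Qed.

Lemma wprod0 e : wprod e 0 = 1. Proof. exact: (@wprod1 e 0). Qed.

Lemma wprodD e b k r : (r < 2 ^ k)%N ->
  wprod e (b * 2 ^ k + r) = wprod e (b * 2 ^ k) * wprod e r.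
Proof.
move=> rk; pose T := (b * 2 ^ k + r)%N.
have hT m : (m <= T)%N -> (m < 2 ^ T)%N by move=> h; rewrite (leq_ltn_trans h) // ltn_expl.
rewrite !(@wprod_wide e _ T) ?hT ?leq_addl ?leq_addr // -big_split /=.
apply: eq_bigr => l _; case: (ltnP l k) => lk.
  rewrite -(subnK (ltnW lk)) expnD mulnA divnMDl ?expn_gt0 // mulnK ?expn_gt0 //.
  rewrite oddD oddM oddX [in odd 2]/= orbF.
  by rewrite subn_eq0 leqNgt lk /= andbF /= mul1r.
rewrite (@divn_small r (2 ^ l)); last by rewrite (leq_trans rk) // leq_pexp2l.
rewrite mulr1 -(subnKC lk) expnD !divnMA divnMDl ?expn_gt0 //.
by rewrite (divn_small rk) addn0 mulnK ?expn_gt0.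
Qed.

Lemma wprod_pow e t : wprod e (2 ^ t) = e t.
Proof.
rewrite (@wprod_wide e _ t.+1) ?ltn_exp2l // big_nat_recr //= divnn expn_gt0 /=.
rewrite big_nat_cond big1 ?mul1r // => l /andP[/andP[_ lt] _].
by rewrite -(subnK (ltnW lt)) expnD mulnK ?expn_gt0 // oddX /= orbF subn_eq0 leqNgt lt.
Qed.

Lemma wprod_top e t i : (i < 2 ^ t)%N -> wprod e (2 ^ t + i) = e t * wprod e i.
Proof. by move=> h; rewrite -{1}[(2 ^ t)%N]mul1n wprodD // mul1n wprod_pow. Qed.

Lemma norm_wprod e i : (forall l, `|e l| = 1) -> `|wprod e i| = 1.
Proof. by move=> e1; rewrite normr_prod big1. Qed.

Lemma sum_ord_addn (F : nat -> R) m n :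
  \sum_(i < m + n) F i = \sum_(i < m) F i + \sum_(r < n) F (m + r)%N.
Proof. by rewrite big_split_ord. Qed.

Lemma sum_ord_split (F : nat -> R) m n : (m <= n)%N ->
  \sum_(i < n) F i = \sum_(i < m) F i + \sum_(r < n - m) F (m + r)%N.
Proof. by move=> mn; rewrite -sum_ord_addn subnKC. Qed.

Lemma sum_ord_pow2S (F : nat -> R) k :
  \sum_(i < 2 ^ k.+1) F i = \sum_(i < 2 ^ k) F i + \sum_(r < 2 ^ k) F (2 ^ k + r)%N.
Proof. by rewrite expnS mul2n -addnn sum_ord_addn. Qed.

(** The indices in [2^t, 2^(t+1)) share the leading factor e_t. *)
Lemma sum_wprod_levels e (d : nat -> R) N :
  \sum_(i < 2 ^ N) d i * wprod e i =
  d 0 + \sum_(t < N) e t * \sum_(i < 2 ^ t) d (2 ^ t + i)%N * wprod e i.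
Proof.
elim: N => [|N IH]; first by rewrite big_ord1 big_ord0 addr0 wprod0 mulr1.
rewrite (sum_ord_pow2S (fun i => d i * wprod e i)) IH [in RHS]big_ord_recr /= -addrA.
congr (_ + (_ + _)); rewrite mulr_sumr; apply: eq_bigr => i _.
by rewrite wprod_top //; ring.
Qed.

End WalshProducts.

Section KernelSums.
Variables (R : realType) (e : nat -> R) (k : nat).
Hypotheses (e1 : forall l, `|e l| = 1)
  (elow : forall l, (l < k)%N -> e l = 1) (ek : e k = -1).

Lemma wprod_block (a : nat -> R) b :
  \sum_(r < 2 ^ k.+1) a (b * 2 ^ k.+1 + r)%N * wprod e (b * 2 ^ k.+1 + r) =
  wprod e (b * 2 ^ k.+1) *
    \sum_(r < 2 ^ k) (a (b * 2 ^ k.+1 + r)%N - a (b * 2 ^ k.+1 + 2 ^ k + r)%N).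
Proof.
rewrite (sum_ord_pow2S (fun r => a (b * 2 ^ k.+1 + r)%N * wprod e (b * 2 ^ k.+1 + r))).
rewrite -big_split mulr_sumr /=; apply: eq_bigr => r _.
have r1 : (r < 2 ^ k)%N by [].
have p1 : (2 ^ k.+1 = 2 ^ k + 2 ^ k)%N by rewrite addnn -mul2n expnS.
rewrite !wprodD; [|lia..].
by rewrite wprod_top // (wprod1 r1) // ek addnA; ring.
Qed.

(** Each block of length 2^(k+1) contributes an increment of [c] over half a
    block; for nondecreasing [c] these increments telescope. *)
Lemma wprod_blocks (c : nat -> R) B : nondecreasing_seq c ->
  `| \sum_(i < B.+1 * 2 ^ k.+1) c i * wprod e i | <=
  \sum_(r < 2 ^ k) (c (B * 2 ^ k.+1 + 2 ^ k + r)%N - c r).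
Proof.
move=> cd.
have blk b : `| \sum_(r < 2 ^ k.+1) c (b * 2 ^ k.+1 + r)%N * wprod e (b * 2 ^ k.+1 + r)|
    <= \sum_(r < 2 ^ k) (c (b * 2 ^ k.+1 + 2 ^ k + r)%N - c (b * 2 ^ k.+1 + r)%N).
  rewrite wprod_block normrM norm_wprod // mul1r (le_trans (ler_norm_sum _ _ _)) //.
  apply: ler_sum => r _; rewrite distrC ger0_norm // subr_ge0 cd //.
  by rewrite -addnA leq_add2l leq_addl.
elim: B => [|B IH].
  by rewrite mul1n; have := blk 0%N; rewrite !mul0n.
rewrite mulSnr (sum_ord_addn (fun i => c i * wprod e i)).
apply: le_trans (ler_normD _ _) _; apply: le_trans (lerD IH (blk _)) _.
rewrite -big_split /=; apply: ler_sum => r _.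
suff : c (B * 2 ^ k.+1 + 2 ^ k + r)%N <= c (B.+1 * 2 ^ k.+1 + r)%N by lra.
by apply: cd; rewrite leq_add2r mulSnr leq_add2l leq_exp2l.
Qed.

Variable A : nat -> R.
Hypotheses (A0 : forall j, 0 <= A j) (Ad : nonincreasing_seq A).

Lemma sum_rev_le C p m : (p + m <= C.+1)%N ->
  \sum_(i < m) A (C - (p + i)) <= \sum_(j < m) A j.
Proof.
move=> h; rewrite [leRHS](reindex_inj rev_ord_inj) /=; apply: ler_sum => i _.
apply: Ad; have := ltn_ord i; lia.
Qed.

Lemma sum_widen_le m n : (m <= n)%N -> \sum_(j < m) A j <= \sum_(j < n) A j.
Proof.
move=> mn; rewrite -(subnKC mn) sum_ord_addn lerDl; exact: sumr_ge0.
Qed.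

(** The full blocks telescope to half a block of [A], and the incomplete last block
    is bounded term by term; in both cases the indices of [A] involved are at
    least as large as those of an initial segment. *)
Lemma wprod_sum_bound C L : (L <= C.+1)%N ->
  `| \sum_(i < L) A (C - i) * wprod e i | <= 2 * \sum_(j < 2 ^ k.+1) A j.
Proof.
move=> LC; have cd : nondecreasing_seq (fun i => A (C - i)).
  by move=> m n mn; apply: Ad; lia.
have triv p m : (p + m <= C.+1)%N ->
    `| \sum_(i < m) A (C - (p + i)) * wprod e (p + i) | <= \sum_(j < m) A j.
  move=> h; apply: le_trans (sum_rev_le h); apply: le_trans (ler_norm_sum _ _ _) _.
  by apply: ler_sum => i _; rewrite normrM norm_wprod // mulr1 ger0_norm.
have p1 : (2 ^ k.+1 = 2 ^ k + 2 ^ k)%N by rewrite addnn -mul2n expnS.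
have rl := ltn_pmod L (expn_gt0 2 k.+1 : (0 < _)%N).
have LE := divn_eq L (2 ^ k.+1).
case: (L %/ 2 ^ k.+1)%N LE => [|B] LE.
  have := triv 0%N L; rewrite !add0n => /(_ LC) H.
  apply: le_trans H _; have := @sum_widen_le L (2 ^ k.+1).
  have : 0 <= \sum_(j < 2 ^ k.+1) A j by apply: sumr_ge0.
  by move=> ? /(_ _) H; have := H ltac:(lia); lra.
rewrite LE (sum_ord_addn (fun i => A (C - i) * wprod e i)).
apply: le_trans (ler_normD _ _) _.
have H1 := wprod_blocks B cd.
have H2 : \sum_(r < 2 ^ k) (A (C - (B * 2 ^ k.+1 + 2 ^ k + r)) - A (C - r)) <=
   \sum_(r < 2 ^ k) A (C - (B * 2 ^ k.+1 + 2 ^ k + r)).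
  by apply: ler_sum => r _; rewrite gerBl.
apply: le_trans (lerD (le_trans H1 H2) (triv _ _ _)) _; first by rewrite -LE.
have H4 : \sum_(r < 2 ^ k) A (C - (B * 2 ^ k.+1 + 2 ^ k + r)) <= \sum_(r < 2 ^ k) A r.
  by apply: sum_rev_le; move: LE LC; rewrite mulSn; lia.
rewrite mulr_natl mulr2n; apply: lerD; last by apply: sum_widen_le; lia.
by apply: le_trans H4 _; apply: sum_widen_le; lia.
Qed.

(** When the length is a power of 2 no block is incomplete, and the bound involves
    only an increment of [A]. *)
Lemma wprod_sum_bound_full C t : (k < t)%N -> (2 ^ t <= C.+1)%N ->
  `| \sum_(i < 2 ^ t) A (C - i) * wprod e i | <=
  2 ^+ k * (A (C.+1 - 2 ^ t) - A C).
Proof.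
move=> kt tC; have cd : nondecreasing_seq (fun i => A (C - i)).
  by move=> m n mn; apply: Ad; lia.
have p1 : (2 ^ k.+1 = 2 ^ k + 2 ^ k)%N by rewrite addnn -mul2n expnS.
have E : (2 ^ t = (2 ^ (t - k.+1)).-1.+1 * 2 ^ k.+1)%N.
  by rewrite prednK ?expn_gt0 // -expnD subnK.
have := wprod_blocks (2 ^ (t - k.+1)).-1 cd; rewrite -E => H.
apply: le_trans H _.
rewrite -natrX -[X in X%:R * _](card_ord (2 ^ k)) mulr_natl -sumr_const.
apply: ler_sum => r _; have rk := ltn_ord r.
by apply: lerB; apply: Ad; rewrite ?leq_subr //; move: tC; rewrite E mulSn; lia.
Qed.

End KernelSums.

(** * Dyadic digits and rank *)

Section Digits.
Variable R : realType.
Implicit Types (x s : R) (t l i q : nat).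

Definition dcell t q : set R := `[q%:R / 2 ^+ t, q.+1%:R / 2 ^+ t[%classic.

Lemma dcellP t q s : dcell t q s <-> q%:R <= 2 ^+ t * s < q.+1%:R.
Proof.
rewrite /dcell /= in_itv /= ler_pdivrMr ?exprn_gt0 // ltr_pdivlMr ?exprn_gt0 //.
by rewrite ![s * _]mulrC.
Qed.

Lemma dcell_floor t q s : dcell t q s <-> Num.floor (2 ^+ t * s) = q%:Z.
Proof.
rewrite dcellP; split=> [/andP[h1 h2]|h].
  by apply: floor_def; rewrite intrD h1 /=; move: h2; rewrite -[q.+1%:R]natr1.
have := floor_itv (2 ^+ t * s); rewrite h -[q.+1%:R]natr1.
by rewrite intrD.
Qed.

Lemma dcell0 : dcell 0 0 = unitI :> set R.
Proof. by rewrite /dcell /unitI expr0 !divr1. Qed.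

Lemma dcell_half t q s (b : bool) :
  dcell t.+1 (q.*2 + b) s <-> dcell t q s /\ dyadic_digit s t = b.
Proof.
rewrite !dcellP exprS -mulrA; set z := 2 ^+ t * s.
have E : dyadic_digit s t = odd `|Num.floor (2 * z)|%N.
  by rewrite /dyadic_digit exprS -mulrA.
have half (c : bool) : (q.*2 + c)%:R <= 2 * z < (q.*2 + c).+1%:R ->
    dyadic_digit s t = c.
  move=> /andP[h1 h2]; rewrite E.
  have -> : Num.floor (2 * z) = (q.*2 + c)%:Z.
    by apply: floor_def; rewrite intrD h1 /=; move: h2; rewrite -[(q.*2 + c).+1%:R]natr1.
  by rewrite /= oddD odd_double; case: (c).
have e2 : (q.*2)%:R = 2 * q%:R :> R by rewrite -mul2n natrM.
split=> [h|[h d]].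
  split; last exact: half.
  move: h; rewrite -[(q.*2 + b).+1%:R]natr1 -[q.+1%:R]natr1 natrD e2; case: b => /= /andP[h1 h2]; apply/andP; split; lra.
move: h; rewrite -[q.+1%:R]natr1 => /andP[h1 h2].
have [z1|z1] := ltP (2 * z) (q.*2 + false).+1%:R.
  have H : (q.*2 + false)%:R <= 2 * z < (q.*2 + false).+1%:R.
    by rewrite z1 andbT natrD e2 /=; lra.
  by move: (half _ H); rewrite d => ->.
have H : (q.*2 + true)%:R <= 2 * z < (q.*2 + true).+1%:R.
  move: z1; rewrite -[(q.*2 + false).+1%:R]natr1 -[(q.*2 + true).+1%:R]natr1 !natrD e2 /= => z1; apply/andP; split; lra.
by move: (half _ H); rewrite d => ->.
Qed.

Lemma rademacherE l s : unitI s -> rademacher l s = (-1) ^+ dyadic_digit s l.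
Proof.
move=> s1.
have [q Hq] : exists q, dcell l q s.
  exists `|Num.floor (2 ^+ l * s)|%N; apply/dcell_floor; rewrite gez0_abs //.
  rewrite floor_ge0 mulr_ge0 ?exprn_ge0 //.
  by move: s1; rewrite /unitI /= in_itv /= => /andP[].
rewrite /rademacher /rademacher0.
have /dcell_floor -> := Hq.
set b := dyadic_digit s l.
have : dcell l.+1 (q.*2 + b) s by apply/dcell_half.
rewrite dcellP exprS -mulrA -[(q.*2 + b).+1%:R]natr1 natrD.
rewrite (_ : (q.*2)%:R = 2 * q%:R :> R); last by rewrite -mul2n natrM.
rewrite -[(q%:Z)%:~R]/(q%:R); set z := 2 ^+ l * s.
case: b => /= /andP[h1 h2].
  by rewrite ifF //; apply/negbTE; rewrite -leNgt; lra.
by rewrite ifT //; lra.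
Qed.

(** [rank x s t] is the integer whose binary digits are those of the dyadic sum
    of x and s up to place t: it numbers the cells of generation t by their
    dyadic distance to x. *)
Fixpoint rank x s t : nat :=
  if t is t'.+1 then (rank x s t').*2 + (dyadic_digit s t' (+) dyadic_digit x t')
  else 0%N.

Lemma rank_lt x s t : (rank x s t < 2 ^ t)%N.
Proof.
elim: t => [|t IH] //=; move: IH; rewrite expnS.
by case: (_ (+) _) => /=; lia.
Qed.

Lemma rank_half x s t : (rank x s t.+1)./2 = rank x s t.
Proof. by rewrite /= addnC half_bit_double. Qed.

Lemma rank_div x s t l : (l <= t)%N -> (rank x s t %/ 2 ^ (t - l))%N = rank x s l.
Proof.
elim: t => [|t IH]; first by rewrite leqn0 => /eqP ->.
rewrite leq_eqVlt => /predU1P[->|lt]; first by rewrite subnn divn1.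
by rewrite subSn // expnS divnMA divn2 rank_half IH.
Qed.

Lemma rank_odd x s t : odd (rank x s t.+1) = dyadic_digit s t (+) dyadic_digit x t.
Proof. by rewrite /= oddD odd_double oddb. Qed.

Definition xcell x t i : set R := [set s | unitI s /\ rank x s t = i].

Lemma xcellS x t i : xcell x t.+1 i =
  xcell x t i./2 `&` [set s | dyadic_digit s t = odd i (+) dyadic_digit x t].
Proof.
apply/seteqP; split => s /=.
  move=> [s1 <-]; rewrite -/(rank x s t.+1) rank_half rank_odd; split => //.
  by rewrite -addbA addbb addbF.
move=> [[s1 r] d]; split => //=; rewrite r d -addbA addbb addbF.
by rewrite addnC odd_double_half.
Qed.

Lemma xcell_dcell x t i : (i < 2 ^ t)%N -> exists q, xcell x t i = dcell t q.
Proof.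
elim: t i => [|t IH] i it.
  exists 0%N; rewrite dcell0; apply/seteqP; split => s /=; first by case.
  by move=> h; split => //; move: it; rewrite expn0; case: i.
have [|q Hq] := IH i./2.
  by move: it; rewrite expnS mul2n; have := odd_double_half i; lia.
exists (q.*2 + (odd i (+) dyadic_digit x t))%N.
rewrite xcellS Hq; apply/seteqP; split => s; first by move=> [? ?]; apply/dcell_half.
by move=> /dcell_half [].
Qed.

Lemma rademacherM x s l : unitI x -> unitI s ->
  rademacher l x * rademacher l s = (-1) ^+ odd (rank x s l.+1).
Proof.
move=> x1 s1; rewrite !rademacherE // rank_odd signr_addb mulrC.
by [].
Qed.

(** By [rademacherM], this is r_l(x) r_l(s) for every s of rank i in generation t. *)
Definition rsign t i l : R := (-1) ^+ odd (i %/ 2 ^ (t - l.+1)).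

Lemma norm_rsign t i l : `|rsign t i l| = 1.
Proof. by rewrite normr_sign. Qed.

Lemma wprod_rank x s t j : unitI x -> unitI s -> (j < 2 ^ t)%N ->
  walsh j x * walsh j s = wprod (rsign t (rank x s t)) j.
Proof.
move=> x1 s1 jt; rewrite !walshE -wprodM; apply: eq_wprod jt _ => l lt.
by rewrite rademacherM // /rsign rank_div.
Qed.

(** Place k corresponds to the leading binary digit of i. *)
Lemma first_differing t i : (0 < i < 2 ^ t)%N -> exists k,
  [/\ (k < t)%N, (i < 2 ^ (t - k))%N,
      (forall l, (l < k)%N -> rsign t i l = 1) & rsign t i k = -1].
Proof.
move=> /andP[i0 it]; pose m := trunc_log 2 i.
have m1 : (2 ^ m <= i)%N by apply: trunc_logP.
have m2 : (i < 2 ^ m.+1)%N by apply: trunc_log_ltn.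
have mt : (m < t)%N by rewrite -(ltn_exp2l _ _ (isT : 1 < 2)%N) (leq_ltn_trans m1).
exists (t - m.+1)%N; split.
- by rewrite ltn_subrL /= (leq_ltn_trans _ mt).
- by rewrite subKn.
- move=> l lk; rewrite /rsign divn_small //; apply: leq_trans m2 _.
  by rewrite leq_pexp2l //; lia.
rewrite /rsign subnSK // subKn; last exact: ltnW.
suff -> : (i %/ 2 ^ m)%N = 1%N by [].
apply/eqP; rewrite eqn_leq leq_divRL ?expn_gt0 // mul1n m1 andbT.
by rewrite -ltnS ltn_divLR ?expn_gt0 // -expnS.
Qed.

End Digits.

(** * Expansion of the Cesaro-Walsh kernel *)

Section Kernel.
Variables (R : realType) (a : R).
Hypothesis ha : 0 < a < 1.
Implicit Types (N n t i j k : nat) (x s : R).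

Let A := cesaroA (- a).

(** The factor of the Walsh coefficient of index j in the (C,-a)-mean: the Cesaro
    weights are summed over the partial sums that contain this coefficient. *)
Definition cesaro_mult n j : R :=
  if (j < n)%N then cesaroA (- a) (n.-1 - j) / cesaroA (- a) n.-1 else 0.

Definition kern n x s : R := \sum_(j < n) cesaro_mult n j * (walsh j x * walsh j s).

(** The part of generation t of the difference between the kernel and the Dirichlet
    kernel of order 2^(N+1), without its leading factor: it depends only on the rank
    in generation t. Subtracting the Dirichlet kernel matters for i = 0, where the
    terms do not cancel each other. *)
Definition block n t i : R :=
  \sum_(j < 2 ^ t) (cesaro_mult n (2 ^ t + j) - 1) * wprod (rsign R t i) j.

(** Normalized atoms: a cell indicator, or the difference of the indicators of
    its two halves when [b] holds. *)
Definition atom x (b : bool) t i s : R :=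
  2 ^+ t * (rank x s t == i)%:R * (if b then (-1) ^+ odd (rank x s t.+1) else 1).

(** Generation N + 1 stands for the Dirichlet kernel of order 2^(N+1), that is, for a
    single atom on the cell of x. *)
Definition acoef N n t i : R :=
  if (t <= N)%N then block n t i / 2 ^+ t else (i == 0%N)%:R.

Lemma cesaro_mult0 n : (0 < n)%N -> cesaro_mult n 0 = 1.
Proof. by move=> n0; rewrite /cesaro_mult n0 subn0 divff // gt_eqF // cesaroN_gt0. Qed.

(** The Dirichlet kernel of order 2^t. *)
Lemma sum_wprod_rsign t i : (i < 2 ^ t)%N ->
  \sum_(j < 2 ^ t) wprod (rsign R t i) j = 2 ^+ t * (i == 0%N)%:R.
Proof.
move=> it; have [->|i0] := eqVneq i 0%N.
  rewrite (eq_bigr (fun=> 1)); last first.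
    by move=> j _; apply: (wprod1 (ltn_ord j)) => l lt; rewrite /rsign div0n.
  by rewrite sumr_const card_ord natrX mulr1.
have [|k [kt ik lo ek]] := first_differing R (_ : 0 < i < 2 ^ t)%N.
  by rewrite lt0n i0.
rewrite mulr0; apply/eqP; rewrite -normr_le0.
have := @wprod_sum_bound_full R (rsign R t i) k (norm_rsign R t i) lo ek (fun=> 1) _ (2 ^ t).-1 t kt.
rewrite subrr mulr0 prednK ?expn_gt0 // => /(_ _ (leqnn _)) H.
rewrite (eq_bigr (fun j : 'I_(2 ^ t) => 1 * wprod (rsign R t i) j)); last by move=> j _; rewrite mul1r.
by apply: H => // ? ? _.
Qed.

(** Split off the Dirichlet kernel of order 2^(N+1), and group the remaining terms by
    leading digit: the terms of leading digit t are the Rademacher factor of index t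
    times a function that is constant on the cells of generation t. *)
Lemma kern_expansion N n x s : (2 ^ N <= n < 2 ^ N.+1)%N -> unitI x -> unitI s ->
  kern n x s = \sum_(t < N.+2) \sum_(i < 2 ^ t) acoef N n t i * atom x (t <= N)%N t i s.
Proof.
move=> /andP[n1 n2] x1 s1; have n0 : (0 < n)%N by rewrite (leq_trans _ n1) ?expn_gt0.
set r := rank x s N.+1.
have pick t (F : nat -> R) b :
    \sum_(i < 2 ^ t) F i * atom x b t i s =
    2 ^+ t * F (rank x s t) * (if b then (-1) ^+ odd (rank x s t.+1) else 1).
  rewrite (bigD1 (Ordinal (rank_lt x s t))) //= big1 ?addr0.
    by rewrite /atom eqxx mulr1 mulrCA mulrA.
  move=> i /eqP; rewrite /atom; case: eqP => [e|_ _]; last by rewrite mulr0 mul0r mulr0.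
  by case; apply/val_inj.
have -> : kern n x s = \sum_(j < 2 ^ N.+1) cesaro_mult n j * wprod (rsign R N.+1 r) j.
  rewrite -(subnKC (ltnW n2)) (sum_ord_addn (fun j => cesaro_mult n j * wprod _ j)) [X in _ + X]big1 ?addr0.
    by apply: eq_bigr => j _; rewrite (wprod_rank x1 s1 (ltn_trans (ltn_ord j) n2)).
  by move=> j _; rewrite /cesaro_mult ltnNge leq_addr mul0r.
have -> : \sum_(j < 2 ^ N.+1) cesaro_mult n j * wprod (rsign R N.+1 r) j =
   \sum_(j < 2 ^ N.+1) (cesaro_mult n j - 1) * wprod (rsign R N.+1 r) j +
   \sum_(j < 2 ^ N.+1) wprod (rsign R N.+1 r) j.
  by rewrite -big_split; apply: eq_bigr => j _ /=; ring.
rewrite sum_wprod_rsign ?rank_lt // (sum_wprod_levels _ (fun j => cesaro_mult n j - 1)).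
rewrite cesaro_mult0 // subrr add0r [in RHS]big_ord_recr /=; congr (_ + _); last first.
  rewrite (pick N.+1) /acoef ltnn -/r mulr1; congr (_ * _).
apply: eq_bigr => t _.
have tN : (t <= N)%N by rewrite -ltnS.
rewrite pick tN /acoef tN.
have -> : rsign R N.+1 r t = (-1) ^+ odd (rank x s t.+1).
  by rewrite /rsign /r rank_div.
rewrite mulrCA mulfV ?expf_neq0 // mulr1 mulrC; congr (_ * _).
apply: eq_bigr => j _; congr (_ * _); apply: eq_wprod (ltn_ord j) _ => l lt.
by rewrite /rsign /r !rank_div ?ltnS // (leq_trans (ltnW lt)).
Qed.

Let p2 (z : R) : R := 2 `^ z.

Let p2D u v : p2 (u + v) = p2 u * p2 v.
Proof. by rewrite /p2 powRD //; apply/implyP. Qed.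
Let p2_gt0 u : 0 < p2 u. Proof. by rewrite powR_gt0. Qed.
Let p2_le u v : u <= v -> p2 u <= p2 v.
Proof. by move=> uv; rewrite /p2 ler_powR // ler1n. Qed.
Let p2X m : 2 ^+ m = p2 m%:R. Proof. by rewrite /p2 powR_mulrn. Qed.
Let p2_nat m : (2 ^ m)%:R = p2 m%:R. Proof. by rewrite natrX p2X. Qed.
Let p2M u v : p2 u `^ v = p2 (u * v). Proof. by rewrite /p2 powRrM. Qed.
Let p21 : p2 1 = 2. Proof. by rewrite /p2 powRr1. Qed.
Let p2_le2 u : u <= 1 -> p2 u <= 2.
Proof. by move=> /p2_le; rewrite p21. Qed.

Let invA N n : (0 < n < 2 ^ N.+1)%N ->
  (A n.-1)^-1 <= p2 (N.+1%:R * a) / (1 - a).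
Proof.
move=> /andP[n0 n2]; have a1 : 0 < 1 - a by have := ha; lra.
have H := cesaroN_ge_pw ha n.-1.
have P : 0 < (1 - a) * pw a n.-1 by rewrite mulr_gt0 // pw_gt0.
apply: le_trans (_ : ((1 - a) * pw a n.-1)^-1 <= _).
  by rewrite lef_pV2 // posrE cesaroN_gt0.
rewrite invfM mulrC ler_pM2r ?invr_gt0 // /pw powRN invrK prednK //.
rewrite -p2M -p2_nat; apply: ge0_ler_powR; rewrite ?nnegrE //.
  by have := ha; lra.
by rewrite ler_nat ltnW.
Qed.

Let gapE N e : (0 < N)%N -> (2 ^ N.-1 <= e)%N ->
  pw a e / e.+1%:R <= p2 (- (1 + a) * (N%:R - 1)).
Proof.
case: N => // N _ /= h.
have le : p2 N%:R <= e.+1%:R by rewrite -p2_nat ler_nat leqW.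
have -> : - (1 + a) * (N.+1%:R - 1) = N%:R * (- a) + - N%:R.
  by rewrite -[N.+1%:R]natr1; ring.
rewrite p2D; apply: ler_pM; rewrite ?pw_ge0 ?invr_ge0 //.
  rewrite -p2M /pw !powRN lef_pV2 ?posrE ?powR_gt0 //.
  by apply: ge0_ler_powR; rewrite ?nnegrE ?(ltW (p2_gt0 _)) //; have := ha; lra.
by rewrite /p2 powRN -/(p2 _) lef_pV2 ?posrE.
Qed.

Let sumA m : \sum_(j < 2 ^ m) A j <= p2 (m%:R * (1 - a)) / (1 - a).
Proof. by apply: le_trans (sum_cesaroN ha _) _; rewrite p2_nat p2M. Qed.

Let c0 := 16 / (1 - a) ^+ 2.

(* In the smooth regime t <= N - 2 only increments of Cesaro numbers of indices
   beyond 2^(N-1) occur; in the rough regime t = N - 1 or t = N the indices may be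
   small and the Cesaro numbers themselves are summed. Both give the same rate in
   k, the first place where the digits differ (k = t for the cell of x). *)
Let regime_smooth N n k C : (0 < n < 2 ^ N.+1)%N -> (k <= N)%N -> (0 < N)%N ->
  C <= (A n.-1)^-1 * (2 ^+ k * (2 * p2 (- (1 + a) * (N%:R - 1)))) ->
  C <= c0 * p2 ((k%:R - N%:R) * (1 - a)).
Proof.
move=> hn kN N0 H; apply: le_trans H _.
have a1 : 0 < 1 - a by have := ha; lra.
apply: le_trans (ler_wpM2r _ (invA hn)) _.
  by rewrite !mulr_ge0 ?exprn_ge0 // ltW.
rewrite p2X -{1}p21 mulrAC -!p2D.
have -> : N.+1%:R * a + (k%:R + (1 + - (1 + a) * (N%:R - 1))) = 
    (1 + a + a + 1) + (k%:R - N%:R).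
  by rewrite -[N.+1%:R]natr1; ring.
rewrite p2D.
have h1 : p2 (1 + a + a + 1) <= 16.
  have -> : 16 = p2 4%:R by rewrite -p2_nat.
  by apply: p2_le; have := ha; lra.
have h2 : p2 (k%:R - N%:R) <= p2 ((k%:R - N%:R) * (1 - a)).
  apply: p2_le; have : k%:R <= N%:R :> R by rewrite ler_nat.
  have := ha; move=> ? ?; nra.
have h3 : (1 - a)^-1 <= ((1 - a) ^+ 2)^-1.
  by rewrite lef_pV2 ?posrE ?exprn_gt0 // expr2 ler_piMr ?(ltW a1) //; have := ha; lra.
rewrite -mulrA [_ / (1 - a)]mulrC mulrA /c0.
apply: ler_pM => //; rewrite ?mulr_ge0 ?invr_ge0 ?(ltW a1) ?(ltW (p2_gt0 _)) //.
by apply: ler_pM => //; rewrite ?invr_ge0 ?(ltW a1) ?(ltW (p2_gt0 _)).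
Qed.

Let regime_rough N n t k C : (0 < n < 2 ^ N.+1)%N -> (N <= t.+1)%N ->
  C <= (A n.-1)^-1 * (2 * \sum_(j < 2 ^ k.+1) A j) / 2 ^+ t ->
  C <= c0 * p2 ((k%:R - N%:R) * (1 - a)).
Proof.
move=> hn Nt H; apply: le_trans H _.
have a1 : 0 < 1 - a by have := ha; lra.
have tN : (2 ^+ t)^-1 <= p2 (1 - N%:R).
  rewrite p2X /p2 -powRN; apply: p2_le.
  have : N%:R <= t.+1%:R :> R by rewrite ler_nat.
  by rewrite -natr1; lra.
have S0 : 0 <= \sum_(j < 2 ^ k.+1) A j.
  by apply: sumr_ge0 => j _; apply/ltW/cesaroN_gt0.
have I0 : 0 <= (A n.-1)^-1 by rewrite invr_ge0 ltW // cesaroN_gt0.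
apply: le_trans (ler_pM _ _ (ler_pM I0 _ (invA hn) (ler_wpM2l _ (sumA _))) tN) _.
- by rewrite !mulr_ge0.
- by rewrite invr_ge0 exprn_ge0.
- by rewrite mulr_ge0.
- by [].
have -> : p2 (N.+1%:R * a) / (1 - a) * (2 * (p2 (k.+1%:R * (1 - a)) / (1 - a))) *
    p2 (1 - N%:R) =
    2 * (p2 (N.+1%:R * a) * p2 (k.+1%:R * (1 - a)) * p2 (1 - N%:R)) / (1 - a) ^+ 2.
  by field; rewrite gt_eqF.
rewrite -!p2D.
have -> : N.+1%:R * a + k.+1%:R * (1 - a) + (1 - N%:R) = 1 + 1 + (k%:R - N%:R) * (1 - a).
  by rewrite -[N.+1%:R]natr1 -[k.+1%:R]natr1; ring.
rewrite !p2D p21 /c0 -[leLHS]mulrA [leRHS]mulrAC -[leRHS]mulrA.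
have P : 0 <= p2 ((k%:R - N%:R) * (1 - a)) / (1 - a) ^+ 2.
  by rewrite mulr_ge0 ?invr_ge0 ?exprn_ge0 ?(ltW a1) // ltW.
rewrite -[X in 2 * X]mulrA; lra.
Qed.

Let sum_mult n t (W : nat -> R) :
  \sum_(j < 2 ^ t) cesaro_mult n (2 ^ t + j) * W j =
  (A n.-1)^-1 * \sum_(j < minn (2 ^ t) (n - 2 ^ t)) A (n.-1 - 2 ^ t - j) * W j.
Proof.
set L := minn _ _; have Lt : (L <= 2 ^ t)%N by rewrite geq_minl.
rewrite (sum_ord_split (fun j => cesaro_mult n (2 ^ t + j)%N * W j) Lt) [X in _ + X]big1 ?addr0.
  rewrite mulr_sumr; apply: eq_bigr => j _; have := ltn_ord j; rewrite /cesaro_mult.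
  rewrite {2}/L leq_min => /andP[h1 h2].
  have -> : (2 ^ t + j < n)%N by lia.
  by rewrite subnDA /A; ring.
move=> j _; rewrite /cesaro_mult ifF ?mul0r //; apply/negbTE; rewrite -leqNgt.
have := ltn_ord j; rewrite /L; lia.
Qed.

Lemma acoef_differing N n t i : (2 ^ N <= n < 2 ^ N.+1)%N -> (t <= N)%N ->
  (i < 2 ^ t)%N ->
  exists k, [/\ (k <= t)%N, (i < 2 ^ (t - k))%N &
    `|acoef N n t i| <= c0 * p2 ((k%:R - N%:R) * (1 - a))].
Proof.
move=> /andP[n1 n2] tN it.
have a1 : 0 < 1 - a by have := ha; lra.
have n0 : (0 < n)%N by rewrite (leq_trans _ n1) ?expn_gt0.
have hn : (0 < n < 2 ^ N.+1)%N by rewrite n0.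
have A0 j : 0 <= A j by apply/ltW/cesaroN_gt0.
have Ad : nonincreasing_seq A by exact: cesaroN_dec.
have I0 : 0 <= (A n.-1)^-1 by rewrite invr_ge0.
rewrite /acoef tN normrM normfV (ger0_norm (exprn_ge0 t _)) //.
have p2t : (0:R) < 2 ^+ t by rewrite exprn_gt0.
have tnN : (2 ^ t <= 2 ^ N)%N by rewrite leq_exp2l.
(* for t <= N - 2 the indices of the Cesaro numbers involved exceed 2^(N-1) *)
have smooth : (t.+2 <= N)%N -> [/\ (0 < N)%N, (2 ^ N.-1 <= n - 2 ^ t.+1)%N,
    minn (2 ^ t) (n - 2 ^ t) = (2 ^ t)%N &
    ((n.-1 - 2 ^ t).+1 - 2 ^ t = n - 2 ^ t.+1)%N].
  case: (N) n1 => // M n1; rewrite ltnS => tM /=.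
  have : (2 ^ t.+1 <= 2 ^ M)%N by rewrite leq_exp2l.
  move: n1; rewrite !expnS => n1 h; split => //; lia.
have [i0|i0] := eqVneq i 0%N.
  exists t; split; rewrite // ?subnn ?i0 //.
  have W1 j : (j < 2 ^ t)%N -> wprod (rsign R t 0) j = 1.
    by move=> jt; apply: (wprod1 jt) => l lt; rewrite /rsign div0n.
  have -> : block n t 0 = \sum_(j < 2 ^ t) (cesaro_mult n (2 ^ t + j) - 1).
    by apply: eq_bigr => j _; rewrite W1 // mulr1.
  case: (ltnP t.+1 N) => tN'.
    have [N0 E1 E2 E3] := smooth tN'.
    apply: (regime_smooth hn) => //.
    set e := (n - 2 ^ t.+1)%N in E1 E3.
    have H j : (j < 2 ^ t)%N -> `|cesaro_mult n (2 ^ t + j) - 1| <=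
        (A n.-1)^-1 * (2 ^+ t.+1 * p2 (- (1 + a) * (N%:R - 1))).
      move=> jt.
      have jn : (2 ^ t + j < n)%N by move: E3 E1; rewrite /e !expnS; have := expn_gt0 2 N.-1; lia.
      rewrite /cesaro_mult jn.
      have -> : cesaroA (- a) (n.-1 - (2 ^ t + j)) / cesaroA (- a) n.-1 - 1 =
         (A n.-1)^-1 * (A (n.-1 - (2 ^ t + j))%N - A n.-1).
        by rewrite mulrBr mulVf ?gt_eqF ?cesaroN_gt0 // mulrC.
      rewrite normrM (ger0_norm I0) ler_wpM2l // ger0_norm; last first.
        by rewrite subr_ge0 Ad // leq_subr.
      have En : (n.-1 = e + (2 ^ t.+1).-1)%N.
        by have := expn_gt0 2 N.-1; have := expn_gt0 2 t.+1; move: E1; rewrite /e; lia.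
      apply: le_trans (_ : A e - A (e + (2 ^ t.+1).-1)%N <= _).
        rewrite -En lerB // Ad //; move: E3; rewrite /e expnS; lia.
      apply: le_trans (cesaroN_gap ha _ _) _.
      apply: ler_pM => //; first by rewrite divr_ge0 ?pw_ge0.
        by rewrite -natrX ler_nat leq_pred.
      exact: gapE.
    rewrite ler_pdivrMr //.
    apply: le_trans (ler_norm_sum _ _ _) _.
    apply: le_trans; first by apply: ler_sum => j _; exact: H (ltn_ord j).
    rewrite sumr_const card_ord -[leLHS]mulr_natr natrX exprS.
    rewrite le_eqVlt; apply/orP; left; apply/eqP; ring.
  have H : \sum_(j < 2 ^ t) (cesaro_mult n (2 ^ t + j) - 1) =
      (A n.-1)^-1 * (\sum_(j < minn (2 ^ t) (n - 2 ^ t)) A (n.-1 - 2 ^ t - j)) - 2 ^+ t.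
    rewrite sumrB sumr_const card_ord natrX; congr (_ - _).
    have := sum_mult n t (fun=> 1).
    under eq_bigr do rewrite mulr1.
    by under [in RHS]eq_bigr do rewrite mulr1.
  have H1 : \sum_(j < minn (2 ^ t) (n - 2 ^ t)) A (n.-1 - 2 ^ t - j) <= \sum_(j < 2 ^ t) A j.
    have := @sum_rev_le R A Ad (n.-1 - 2 ^ t) 0 (minn (2 ^ t) (n - 2 ^ t)).
    under eq_bigr do rewrite add0n.
    move=> h; apply: le_trans (h _) _; first by lia.
    by apply: sum_widen_le => //; exact: geq_minl.
  have H2 : 2 ^+ t <= (A n.-1)^-1 * \sum_(j < 2 ^ t) A j.
    have n1t : (0 < n.-1.+1)%N by [].
    rewrite -natrX -[X in X%:R <= _](card_ord (2 ^ t)) -sumr_const mulr_sumr.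
    apply: ler_sum => j _; rewrite ler_pdivlMl ?cesaroN_gt0 // mulr1.
    by apply: Ad; rewrite -ltnS prednK // (leq_trans (ltn_ord j)) // (leq_trans tnN).
  apply: (regime_rough hn tN').
  rewrite ler_pM2r ?invr_gt0 // H.
  have H3 := ler_wpM2l I0 H1.
  have H4 : 0 <= \sum_(j < minn (2 ^ t) (n - 2 ^ t)) A (n.-1 - 2 ^ t - j) by apply: sumr_ge0.
  have H5 := mulr_ge0 I0 H4.
  have H6 : (A n.-1)^-1 * \sum_(j < 2 ^ t) A j <= (A n.-1)^-1 * \sum_(j < 2 ^ t.+1) A j.
    by rewrite ler_wpM2l //; apply: sum_widen_le => //; rewrite leq_exp2l.
  rewrite ler_norml; apply/andP; split; lra.
have [|k [kt ik lo ek]] := first_differing R (_ : 0 < i < 2 ^ t)%N.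
  by rewrite lt0n i0.
exists k; split => //; first exact: ltnW.
have -> : block n t i = (A n.-1)^-1 *
   \sum_(j < minn (2 ^ t) (n - 2 ^ t)) A (n.-1 - 2 ^ t - j) * wprod (rsign R t i) j.
  rewrite -sum_mult /block.
  under eq_bigr do rewrite mulrBl mul1r.
  by rewrite sumrB sum_wprod_rsign // (negbTE i0) mulr0 subr0.
rewrite normrM (ger0_norm I0).
have kN : (k <= N)%N by rewrite (leq_trans (ltnW kt)).
case: (ltnP t.+1 N) => tN'.
  have [N0 E1 E2 E3] := smooth tN'.
  apply: (regime_smooth hn) => //.
  rewrite E2 -mulrA ler_wpM2l // ler_pdivrMr //.
  apply: le_trans (wprod_sum_bound_full (norm_rsign R t i) lo ek Ad kt _) _.
    by have := expn_gt0 2 N.-1; lia.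
  rewrite E3 -mulrA ler_wpM2l ?exprn_ge0 //.
  set e := (n - 2 ^ t.+1)%N in E1 E3 *.
  have En : (n.-1 - 2 ^ t = e + (2 ^ t).-1)%N.
    by have := expn_gt0 2 N.-1; have := expn_gt0 2 t; move: E1 E3; rewrite /e; lia.
  rewrite En; apply: le_trans (cesaroN_gap ha _ _) _.
  rewrite mulrC; apply: ler_pM => //; first by rewrite divr_ge0 ?pw_ge0.
    apply: le_trans (gapE N0 E1) _; rewrite ler_peMl ?ler1n // ltW //.
  by rewrite -natrX ler_nat leq_pred.
apply: (regime_rough hn tN').
rewrite ler_pM2r ?invr_gt0 // ler_wpM2l //.
have [->|L0] := posnP (minn (2 ^ t) (n - 2 ^ t)).
  by rewrite big_ord0 normr0 mulr_ge0 // sumr_ge0.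
apply: (wprod_sum_bound (norm_rsign R t i)) => //; lia.
Qed.

Definition decay_rate : R := 2 `^ (- (1 - a)).

Lemma decay_rate01 : 0 < decay_rate < 1.
Proof.
rewrite /decay_rate powR_gt0 //= powRN invf_lt1 ?powR_gt0 //.
have e1 : 1 `^ (1 - a) = 1 :> R by rewrite powR1.
rewrite -[ltLHS]e1; apply: gt0_ltr_powR; rewrite ?nnegrE ?ltr1n //.
by have := ha; lra.
Qed.

(** Since i < 2^(t-k), the factor 2^((k-N)(1-a)) is at most a geometric factor in
    N - t times (i+1)^(-(1-a)). *)
Lemma norm_acoef : exists2 C, 0 < C & forall N n t i, (2 ^ N <= n < 2 ^ N.+1)%N ->
  (t <= N.+1)%N -> (i < 2 ^ t)%N ->
  `|acoef N n t i| <= C * decay_rate ^+ (N.+1 - t) * pw (1 - a) i.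
Proof.
have a1 : 0 < 1 - a by have := ha; lra.
have C0 : 1 <= c0.
  rewrite /c0 ler_pdivlMr ?exprn_gt0 // mul1r expr2.
  have := ha; move=> ?; nra.
exists (2 * c0); first by lra.
move=> N n t i hn tN it.
move: tN; rewrite leq_eqVlt ltnS => /predU1P[tE|tN].
  rewrite /acoef tE ltnn subnn expr0 mulr1.
  case: eqP => [->|_]; last by rewrite normr0 mulr_ge0 ?pw_ge0 //; lra.
  by rewrite normr1 pw0; lra.
have [k [kt ik H]] := acoef_differing hn tN it; apply: le_trans H _.
have -> : (k%:R - N%:R) * (1 - a) =
    (1 - a) + - (1 - a) * (N.+1 - t)%:R + (t - k)%:R * - (1 - a) :> R.
  rewrite !natrB //; first by rewrite -[N.+1%:R]natr1; ring.
  by rewrite ltnW.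
rewrite p2D (p2D (1 - a)).
have e1 : p2 (- (1 - a) * (N.+1 - t)%:R) = decay_rate ^+ (N.+1 - t).
  by rewrite /decay_rate -powR_mulrn ?powR_ge0 // -powRrM.
rewrite e1.
have e2 : p2 (1 - a) <= 2 by apply: p2_le2; have := ha; lra.
have -> : 2 * c0 * decay_rate ^+ (N.+1 - t) * pw (1 - a) i =
  c0 * (2 * decay_rate ^+ (N.+1 - t) * pw (1 - a) i) by ring.
rewrite ler_wpM2l //; first by lra.
have q0 : 0 <= decay_rate ^+ (N.+1 - t) by rewrite exprn_ge0 ?powR_ge0.
apply: ler_pM; rewrite ?mulr_ge0 ?(ltW (p2_gt0 _)) //.
  by rewrite ler_wpM2r.
rewrite -p2M /pw !powRN lef_pV2 ?posrE ?powR_gt0 //.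
apply: ge0_ler_powR; rewrite ?nnegrE ?(ltW (p2_gt0 _)) ?(ltW a1) //.
by rewrite -p2_nat ler_nat.
Qed.

End Kernel.

(** * Bounded measurable functions on the unit interval and square *)

Section Integrals.
Variable R : realType.
Local Notation mu := (@lebesgue_measure R).
Local Notation mu2 := ((lebesgue_measure \x lebesgue_measure)%E).
Implicit Types (u v : R -> R) (g h : R * R -> R).

Definition bdd1 u := measurable_fun (unitI : set R) u /\
  exists M, forall s, unitI s -> `|u s| <= M.

Definition bdd2 g := measurable_fun (unitI2 : set (R * R)) g /\
  exists M, forall p, unitI2 p -> `|g p| <= M.

Definition int1 u : R := \int[mu]_(s in unitI) u s.
Definition int2 g : R := \int[mu2]_(p in unitI2) g p.

Lemma measurable_unitI : measurable (unitI : set R).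
Proof. exact: measurable_itv. Qed.

Lemma measurable_unitI2 : measurable (unitI2 : set (R * R)).
Proof. exact: measurableX measurable_unitI measurable_unitI. Qed.

Lemma mu_unitI : mu unitI = 1%E.
Proof. by rewrite /unitI lebesgue_measure_itv /= lte01 oppr0 adde0. Qed.

Lemma mu2_unitI2 : mu2 (unitI2 : set (R * R)) = 1%E.
Proof.
have mI := measurable_unitI.
by rewrite /unitI2 product_measure1E // -[LHS]/(mu unitI * mu unitI)%E mu_unitI mule1.
Qed.

Lemma bdd1_integrable u : bdd1 u -> mu.-integrable unitI (EFin \o u).
Proof.
move=> [mu_ [M HM]]; apply: measurable_bounded_integrable => //.
- exact: measurable_unitI.
- by apply: (@le_lt_trans _ _ 1%E); [rewrite -mu_unitI|exact: ltry].
- exists M; split; first exact: num_real.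
  by move=> x Mx s sI /=; rewrite (le_trans (HM _ sI)) // ltW.
Qed.

Lemma bdd2_integrable g : bdd2 g -> mu2.-integrable unitI2 (EFin \o g).
Proof.
move=> [mg [M HM]]; apply: measurable_bounded_integrable => //.
- exact: measurable_unitI2.
- by apply: (@le_lt_trans _ _ 1%E); [rewrite -mu2_unitI2|exact: ltry].
- exists M; split; first exact: num_real.
  by move=> x Mx s sI /=; rewrite (le_trans (HM _ sI)) // ltW.
Qed.

Lemma bdd1_eq u v : (forall s, unitI s -> u s = v s) -> bdd1 u -> bdd1 v.
Proof.
move=> uv [m [M HM]]; split.
  by apply: eq_measurable_fun m => s /set_mem; exact: uv.
by exists M => s sI; rewrite -uv // HM.
Qed.

Lemma bdd2_eq g h : (forall p, unitI2 p -> g p = h p) -> bdd2 g -> bdd2 h.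
Proof.
move=> uv [m [M HM]]; split.
  by apply: eq_measurable_fun m => s /set_mem; exact: uv.
by exists M => s sI; rewrite -uv // HM.
Qed.

Lemma bdd1_cst c : bdd1 (fun=> c).
Proof. by split; [exact: measurable_cst|exists `|c|]. Qed.

Lemma bdd2_cst c : bdd2 (fun=> c).
Proof. by split; [exact: measurable_cst|exists `|c|]. Qed.

Lemma bdd1D u v : bdd1 u -> bdd1 v -> bdd1 (fun s => u s + v s).
Proof.
move=> [mu_ [M HM]] [mv [M' HM']]; split; first exact: measurable_funD.
by exists (M + M') => s sI; rewrite (le_trans (ler_normD _ _)) // lerD ?HM ?HM'.
Qed.

Lemma bdd2D g h : bdd2 g -> bdd2 h -> bdd2 (fun s => g s + h s).
Proof.
move=> [mu_ [M HM]] [mv [M' HM']]; split; first exact: measurable_funD.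
by exists (M + M') => s sI; rewrite (le_trans (ler_normD _ _)) // lerD ?HM ?HM'.
Qed.

Lemma bdd1M u v : bdd1 u -> bdd1 v -> bdd1 (fun s => u s * v s).
Proof.
move=> [mu_ [M HM]] [mv [M' HM']]; split; first exact: measurable_funM.
by exists (M * M') => s sI; rewrite normrM ler_pM ?HM ?HM'.
Qed.

Lemma bdd2M g h : bdd2 g -> bdd2 h -> bdd2 (fun s => g s * h s).
Proof.
move=> [mu_ [M HM]] [mv [M' HM']]; split; first exact: measurable_funM.
by exists (M * M') => s sI; rewrite normrM ler_pM ?HM ?HM'.
Qed.

Lemma bdd1_norm u : bdd1 u -> bdd1 (fun s => `|u s|).
Proof.
move=> [m [M HM]]; split; first exact: measurableT_comp.
by exists M => s sI; rewrite normr_id HM.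
Qed.

Lemma bdd2_norm g : bdd2 g -> bdd2 (fun s => `|g s|).
Proof.
move=> [m [M HM]]; split; first exact: measurableT_comp.
by exists M => s sI; rewrite normr_id HM.
Qed.

Lemma bdd1_sum (I : Type) (r : seq I) (F : I -> R -> R) :
  (forall i, bdd1 (F i)) -> bdd1 (fun s => \sum_(i <- r) F i s).
Proof.
move=> bF; elim: r => [|i r IH].
  by apply: bdd1_eq (bdd1_cst 0) => s _; rewrite big_nil.
by apply: bdd1_eq (bdd1D (bF i) IH) => s _; rewrite big_cons.
Qed.

Lemma bdd2_sum (I : Type) (r : seq I) (F : I -> R * R -> R) :
  (forall i, bdd2 (F i)) -> bdd2 (fun s => \sum_(i <- r) F i s).
Proof.
move=> bF; elim: r => [|i r IH].
  by apply: bdd2_eq (bdd2_cst 0) => s _; rewrite big_nil.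
by apply: bdd2_eq (bdd2D (bF i) IH) => s _; rewrite big_cons.
Qed.

Lemma bdd2_fst u : bdd1 u -> bdd2 (fun p => u p.1).
Proof.
move=> [m [M HM]]; split.
  apply: (measurable_comp measurable_unitI _ m); last exact: measurable_funTS.
  by move=> _ [p [/= h _] <-].
by exists M => -[s t] [/= ? _]; exact: HM.
Qed.

Lemma bdd2_snd u : bdd1 u -> bdd2 (fun p => u p.2).
Proof.
move=> [m [M HM]]; split.
  apply: (measurable_comp measurable_unitI _ m); last exact: measurable_funTS.
  by move=> _ [p [/= _ h] <-].
by exists M => -[s t] [/= _ ?]; exact: HM.
Qed.

Lemma bdd1_sectionl g s0 : unitI s0 -> bdd2 g -> bdd1 (fun t => g (s0, t)).
Proof.
move=> h [m [M HM]]; split.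
  apply: (measurable_comp measurable_unitI2 _ m); last first.
    by apply: measurable_funTS; exact: pair1_measurable.
  by move=> _ [p hp <-].
by exists M => t tI; exact: HM.
Qed.

Lemma bdd1_sectionr g t0 : unitI t0 -> bdd2 g -> bdd1 (fun s => g (s, t0)).
Proof.
move=> h [m [M HM]]; split.
  apply: (measurable_comp measurable_unitI2 _ m); last first.
    by apply: measurable_funTS; exact: pair2_measurable.
  by move=> _ [p hp <-].
by exists M => t tI; exact: HM.
Qed.

Lemma eq_int1 u v : (forall s, unitI s -> u s = v s) -> int1 u = int1 v.
Proof. by move=> uv; apply: eq_Rintegral => s /set_mem; exact: uv. Qed.

Lemma eq_int2 g h : (forall p, unitI2 p -> g p = h p) -> int2 g = int2 h.
Proof. by move=> uv; apply: eq_Rintegral => s /set_mem; exact: uv. Qed.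

Lemma int1D u v : bdd1 u -> bdd1 v -> int1 (fun s => u s + v s) = int1 u + int1 v.
Proof.
move=> bu bv; apply: RintegralD; [exact: measurable_unitI|exact: bdd1_integrable..].
Qed.

Lemma int2D g h : bdd2 g -> bdd2 h -> int2 (fun s => g s + h s) = int2 g + int2 h.
Proof.
move=> bu bv; apply: RintegralD; [exact: measurable_unitI2|exact: bdd2_integrable..].
Qed.

Lemma int1Z c u : bdd1 u -> int1 (fun s => c * u s) = c * int1 u.
Proof.
move=> bu; apply: RintegralZl; [exact: measurable_unitI|exact: bdd1_integrable].
Qed.

Lemma int2Z c g : bdd2 g -> int2 (fun s => c * g s) = c * int2 g.
Proof.
move=> bu; apply: RintegralZl; [exact: measurable_unitI2|exact: bdd2_integrable].
Qed.

Lemma int1_sum (I : Type) (r : seq I) (F : I -> R -> R) :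
  (forall i, bdd1 (F i)) ->
  int1 (fun s => \sum_(i <- r) F i s) = \sum_(i <- r) int1 (F i).
Proof.
move=> bF; elim: r => [|i r IH].
  have e := int1Z 0 (bdd1_cst 0); rewrite [RHS]mul0r in e; rewrite big_nil -[RHS]e.
  by apply: eq_int1 => s _; rewrite big_nil mul0r.
rewrite big_cons -IH -int1D //; last exact: bdd1_sum.
by apply: eq_int1 => s _; rewrite big_cons.
Qed.

Lemma int2_sum (I : Type) (r : seq I) (F : I -> R * R -> R) :
  (forall i, bdd2 (F i)) ->
  int2 (fun s => \sum_(i <- r) F i s) = \sum_(i <- r) int2 (F i).
Proof.
move=> bF; elim: r => [|i r IH].
  have e := int2Z 0 (bdd2_cst 0); rewrite [RHS]mul0r in e; rewrite big_nil -[RHS]e.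
  by apply: eq_int2 => s _; rewrite big_nil mul0r.
rewrite big_cons -IH -int2D //; last exact: bdd2_sum.
by apply: eq_int2 => s _; rewrite big_cons.
Qed.

Lemma int2_prod u v : bdd1 u -> bdd1 v ->
  int2 (fun p => u p.1 * v p.2) = int1 u * int1 v.
Proof.
move=> bu bv.
have iuv : mu2.-integrable unitI2 (EFin \o (fun p => u p.1 * v p.2)).
  by apply: bdd2_integrable; apply: bdd2M; [exact: bdd2_fst|exact: bdd2_snd].
rewrite /int2 /int1 /Rintegral integral_mkcond.
have -> : ((fun p : R * R => (u p.1 * v p.2)%:E) \_ unitI2) =
   (fun p => ((u \_ unitI) p.1 * (v \_ unitI) p.2)%:E).
  apply/funext => -[s t]; rewrite /patch /=.
  have -> : ((s, t) \in (unitI2 : set (R * R))) = (s \in (unitI : set R)) && (t \in (unitI : set R)).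
    by apply/idP/andP => [/set_mem[]|[/set_mem ? /set_mem ?]]; rewrite ?inE //; split; apply/mem_set.
  by case: (s \in _); case: (t \in _); rewrite ?mulr0 ?mul0r.
rewrite -integral12_prod_meas1; last first.
  have := (integrable_mkcond _ (measurable_unitI2 : measurable (unitI2 : set (measurableTypeR R * measurableTypeR R)))).1 iuv.
  apply: eq_integrable => // -[s t] _; rewrite /patch /=.
  have -> : ((s, t) \in (unitI2 : set (R * R))) = (s \in (unitI : set R)) && (t \in (unitI : set R)).
    by apply/idP/andP => [/set_mem[]|[/set_mem ? /set_mem ?]]; rewrite ?inE //; split; apply/mem_set.
  by case: (s \in _); case: (t \in _); rewrite ?mulr0 ?mul0r.
rewrite /fubini_F /=.
have iv : mu.-integrable setT (EFin \o (v \_ unitI)).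
  have := (integrable_mkcond _ (measurable_unitI : measurable (unitI : set (measurableTypeR R)))).1 (bdd1_integrable bv).
  by rewrite restrict_EFin.
have iu : mu.-integrable setT (EFin \o (u \_ unitI)).
  have := (integrable_mkcond _ (measurable_unitI : measurable (unitI : set (measurableTypeR R)))).1 (bdd1_integrable bu).
  by rewrite restrict_EFin.
under eq_integral do under eq_integral do rewrite EFinM.
under eq_integral do rewrite integralZl //.
have fu := integrable_fin_num measurableT iu.
have fv := integrable_fin_num measurableT iv.
rewrite -(fineK fv); rewrite integralZr //.
rewrite -(fineK fu) -EFinM /=; congr (fine _ * fine _).
- by rewrite [RHS]integral_mkcond; apply: eq_integral => s _; rewrite /= /patch; case: ifP.
- by rewrite [RHS]integral_mkcond; apply: eq_integral => s _; rewrite /= /patch; case: ifP.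
Qed.

End Integrals.

(** * Almost everywhere bounds and integrals of functions of the rank *)

Section AlmostEverywhere.
Variable R : realType.
Local Notation mu := (@lebesgue_measure R).
Local Notation mu2 := ((lebesgue_measure \x lebesgue_measure)%E).
Implicit Types (u v : R -> R) (g h : R * R -> R).

Lemma int2_norm g : bdd2 g -> `|int2 g| <= int2 (fun p => `|g p|).
Proof.
move=> bg; apply: le_normr_Rintegral; [exact: measurable_unitI2|exact: bdd2_integrable].
Qed.

Lemma int2_le_ae g h (N N' : set R) : bdd2 g -> bdd2 h ->
  countable N -> countable N' ->
  (forall p, unitI2 p -> 0 <= g p) -> (forall p, unitI2 p -> 0 <= h p) ->
  (forall p, unitI2 p -> ~ N p.1 -> ~ N' p.2 -> g p <= h p) ->
  int2 g <= int2 h.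
Proof.
move=> bg bh cN cN' g0 h0 gh.
have ig := bdd2_integrable bg; have ih := bdd2_integrable bh.
apply: fine_le.
- by apply: (integrable_fin_num _ ig); exact: measurable_unitI2.
- by apply: (integrable_fin_num _ ih); exact: measurable_unitI2.
apply: ae_ge0_le_integral.
- exact: measurable_unitI2.
- by move=> p hp; rewrite lee_fin g0.
- by move/measurable_int : ig.
- by move=> p hp; rewrite lee_fin h0.
- by move/measurable_int : ih.
have cm (A : set R) : countable A -> measurable A.
  move=> cA; by apply: countable_measurable => // z; exact: measurable_set1.
exists ((N `*` setT) `|` (setT `*` N')); split.
- by apply: measurableU; apply: measurableX => //; exact: cm.
- apply/eqP; rewrite -measure_le0; apply: le_trans (measureU2 _ _ _) _.
  + by apply: measurableX => //; exact: cm.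
  + by apply: measurableX => //; exact: cm.
  have z1 := countable_lebesgue_measure0 cN; have z2 := countable_lebesgue_measure0 cN'.
  have e1 : mu2 (N `*` setT) = 0%E.
    by rewrite product_measure1E //; [rewrite -[X in (X * _)%E]/(mu N) z1 mul0e|exact: cm].
  have e2 : mu2 (setT `*` N') = 0%E.
    by rewrite product_measure1E //; [rewrite -[X in (_ * X)%E]/(mu N') z2 mule0|exact: cm].
  by rewrite [X in (X + _ <= _)%E]e1 [X in (_ + X <= _)%E]e2 adde0.
- move=> [s t] /= /not_implyP[hp]; rewrite lee_fin => hn.
  have [hN|hN] := pselect (N s); first by left.
  have [hN'|hN'] := pselect (N' t); first by right.
  by case: hn; exact: gh.
Qed.

(** The exceptional sets are needed because dyadic continuity says nothing about the
    points whose coordinates have digits eventually complementary to those of the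
    given point. *)
Lemma int2_bound_ae g u v M (N N' : set R) : bdd2 g -> bdd1 u -> bdd1 v -> 0 <= M ->
  countable N -> countable N' ->
  (forall p, unitI2 p -> ~ N p.1 -> ~ N' p.2 -> `|g p| <= M * (`|u p.1| * `|v p.2|)) ->
  `|int2 g| <= M * (int1 (fun s => `|u s|) * int1 (fun s => `|v s|)).
Proof.
move=> bg bu bv M0 cN cN' H.
have bn : bdd2 (fun p => `|u p.1| * `|v p.2|).
  by apply: bdd2M; [exact: (bdd2_fst (bdd1_norm bu))|exact: (bdd2_snd (bdd1_norm bv))].
rewrite -int2_prod; [|exact: bdd1_norm..].
rewrite -int2Z //; apply: le_trans (int2_norm bg) _.
apply: (int2_le_ae (N := N) (N' := N')) => //; first exact: bdd2_norm.
- by apply: bdd2M => //; exact: bdd2_cst.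
- by move=> p _; rewrite !mulr_ge0.
Qed.

Lemma int2_bound g u v M : bdd2 g -> bdd1 u -> bdd1 v -> 0 <= M ->
  (forall p, unitI2 p -> `|g p| <= M * (`|u p.1| * `|v p.2|)) ->
  `|int2 g| <= M * (int1 (fun s => `|u s|) * int1 (fun s => `|v s|)).
Proof.
move=> bg bu bv M0 H.
by apply: (int2_bound_ae (N := set0) (N' := set0)) => // p hp _ _; exact: H.
Qed.

End AlmostEverywhere.

Section RankIntegrals.
Variable R : realType.
Local Notation mu := (@lebesgue_measure R).
Implicit Types (x s : R) (t i : nat).

Lemma mu_dcell t q : mu (@dcell R t q) = (2 ^- t)%:E.
Proof.
rewrite /dcell lebesgue_measure_itv /= lte_fin ltr_pM2r ?invr_gt0 ?exprn_gt0 //.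
by rewrite ltr_nat ltnSn -EFinB -mulrBl -natr1 addrAC subrr add0r mul1r.
Qed.

Lemma rank_indicE x t i s : unitI s -> (rank x s t == i)%:R = \1_(xcell x t i) s :> R.
Proof.
move=> sI; rewrite indicE; congr (_%:R); congr nat_of_bool.
by apply/eqP/idP => [<-|/set_mem[]//]; apply/mem_set.
Qed.

Lemma measurable_xcell x t i : (i < 2 ^ t)%N -> measurable (xcell x t i).
Proof. by move=> it; have [q ->] := xcell_dcell x it; exact: measurable_itv. Qed.

Lemma bdd1_rank1 x t i : bdd1 (fun s => (rank x s t == i)%:R : R).
Proof.
have [it|it] := ltnP i (2 ^ t); last first.
  apply: bdd1_eq (bdd1_cst 0) => s _; case: eqP => // e; move: it.
  by rewrite -e leqNgt rank_lt.
apply: (@bdd1_eq _ (\1_(xcell x t i))); first by move=> s sI; rewrite -rank_indicE.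
split; first by apply: measurable_funTS; apply: measurable_indic; exact: measurable_xcell.
by exists 1 => s _; rewrite indicE; case: (_ \in _); rewrite ?normr1 ?normr0.
Qed.

Lemma int1_rank1 x t i : (i < 2 ^ t)%N -> int1 (fun s => (rank x s t == i)%:R : R) = 2 ^- t.
Proof.
move=> it; rewrite (@eq_int1 _ _ (\1_(xcell x t i))); last first.
  by move=> s sI; rewrite -rank_indicE.
have [q E] := xcell_dcell x it.
rewrite /int1 /Rintegral integral_indic; first last.
- exact: measurable_xcell.
- exact: measurable_unitI.
have -> : xcell x t i `&` unitI = @dcell R t q.
  by rewrite E setIidl // -E => s [].
by rewrite [X in fine X]mu_dcell.
Qed.

Lemma rank_sum x t (G : nat -> R) s :
  G (rank x s t) = \sum_(i < 2 ^ t) G i * (rank x s t == i)%:R.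
Proof.
rewrite (bigD1 (Ordinal (rank_lt x s t))) //= eqxx mulr1 big1 ?addr0 // => i /eqP ne.
by case: eqP => [e|]; [case: ne; apply/val_inj|rewrite mulr0].
Qed.

Lemma bdd1_rank x t (G : nat -> R) : bdd1 (fun s => G (rank x s t)).
Proof.
apply: (@bdd1_eq _ (fun s => \sum_(i < 2 ^ t) G i * (rank x s t == i)%:R)).
  by move=> s _; rewrite -rank_sum.
by apply: bdd1_sum => i; apply: bdd1M; [exact: bdd1_cst|exact: bdd1_rank1].
Qed.

(** Each of the 2^t cells of generation t has measure 2^-t. *)
Lemma int1_rank x t (G : nat -> R) :
  int1 (fun s => G (rank x s t)) = 2 ^- t * \sum_(i < 2 ^ t) G i.
Proof.
rewrite (@eq_int1 _ _ (fun s => \sum_(i < 2 ^ t) G i * (rank x s t == i)%:R)); last first.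
  by move=> s _; rewrite -rank_sum.
rewrite int1_sum; last first.
  by move=> i; apply: bdd1M; [exact: bdd1_cst|exact: bdd1_rank1].
rewrite mulr_sumr; apply: eq_bigr => i _.
by rewrite int1Z ?int1_rank1 1?mulrC //; exact: bdd1_rank1.
Qed.

Lemma unitI0 : unitI (0 : R).
Proof. by rewrite /unitI /= in_itv /= lexx ltr01. Qed.

Lemma dyadic_digit0 k : dyadic_digit (0 : R) k = false.
Proof. by rewrite /dyadic_digit mulr0 floor0. Qed.

Lemma walsh_at0 j : walsh j (0 : R) = 1.
Proof.
rewrite walshE; apply: (@wprod1 _ _ j); first exact: ltn_expl.
by move=> l _; rewrite rademacherE ?dyadic_digit0 //; exact: unitI0.
Qed.

Lemma walsh_rank j t s : (j < 2 ^ t)%N -> unitI s ->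
  walsh j s = wprod (rsign R t (rank 0 s t)) j.
Proof.
by move=> jt sI; rewrite -(wprod_rank unitI0 sI jt) walsh_at0 mul1r.
Qed.

Lemma bdd1_walsh j : bdd1 (walsh j : R -> R).
Proof.
apply: bdd1_eq (bdd1_rank 0 j (fun r => wprod (rsign R j r) j)) => s sI.
by rewrite -walsh_rank // ltn_expl.
Qed.

Lemma atom_rank x b t i s :
  atom x b t i s = (fun r => 2 ^+ t * (r./2 == i)%:R * (if b then (-1) ^+ odd r else 1))
    (rank x s t.+1) :> R.
Proof. by rewrite /atom -rank_half. Qed.

Lemma bdd1_atom x b t i : bdd1 (atom x b t i : R -> R).
Proof.
apply: bdd1_eq (bdd1_rank x t.+1 (fun r => 2 ^+ t * (r./2 == i)%:R * (if b then (-1) ^+ odd r else 1))).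
by move=> s _; rewrite atom_rank.
Qed.

Lemma sum_ord_double (F : nat -> R) m :
  \sum_(r < m.*2) F r = \sum_(i < m) (F i.*2 + F i.*2.+1).
Proof.
elim: m => [|m IH]; first by rewrite !big_ord0.
by rewrite doubleS !big_ord_recr /= IH addrA.
Qed.

Lemma int1_atom x t i : int1 (atom x true t i) = 0 :> R.
Proof.
pose G r : R := 2 ^+ t * (r./2 == i)%:R * (-1) ^+ odd r.
rewrite (@eq_int1 _ _ (fun s => G (rank x s t.+1))); last by move=> s _; rewrite atom_rank.
rewrite int1_rank expnS mul2n /G.
rewrite (sum_ord_double (fun r => 2 ^+ t * (r./2 == i)%:R * (-1) ^+ odd r)) big1 ?mulr0 //.
move=> j _; rewrite oddS odd_double /= uphalf_double doubleK expr0 expr1.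
by rewrite mulr1 mulrN1 subrr.
Qed.

Lemma int1_norm_atom x b t i : (i < 2 ^ t)%N -> int1 (fun s => `|atom x b t i s|) = 1 :> R.
Proof.
move=> it; rewrite (@eq_int1 _ _ (fun s => 2 ^+ t * (rank x s t == i)%:R)).
  by rewrite int1Z ?int1_rank1 // ?mulfV ?expf_neq0 //; exact: bdd1_rank1.
move=> s _; rewrite /atom !normrM normr_nat (ger0_norm (exprn_ge0 t _)) //.
by case: b; rewrite ?normr_sign ?normr1 mulr1.
Qed.

Lemma int1_atom_unsigned x t i : (i < 2 ^ t)%N -> int1 (atom x false t i) = 1 :> R.
Proof.
move=> it; rewrite -(int1_norm_atom x false it); apply: eq_int1 => s _.
by rewrite ger0_norm // /atom mulr1 mulr_ge0 // exprn_ge0.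
Qed.

End RankIntegrals.

(** * Dyadic translation *)

Section DyadicTranslation.
Variable R : realType.
Implicit Types (x y s h : R) (k t n q : nat).

Definition xr n x s : R := (rank x s n)%:R / 2 ^+ n.

Lemma series_rank x s :
  series (fun k => `|(dyadic_digit x k)%:R - (dyadic_digit s k)%:R| / 2 ^+ k.+1 : R) =
  fun n => xr n x s.
Proof.
apply/funext => n; elim: n => [|n IH].
  by rewrite /series /= big_geq // /xr mul0r.
rewrite seriesSr IH /xr /= natrD -mul2n natrM exprS.
have p0 : 2 ^+ n != 0 :> R by rewrite expf_neq0.
by case: (dyadic_digit x n); case: (dyadic_digit s n) => /=;
  rewrite ?subrr ?subr0 ?sub0r ?normrN ?normr0 ?normr1; field.
Qed.

Lemma dyadic_addE x s : dyadic_add x s = limn (fun n => xr n x s).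
Proof. by rewrite /dyadic_add series_rank. Qed.

Lemma dcell_rank0 s t : unitI s -> dcell t (rank 0 s t) s.
Proof.
move=> sI; elim: t => [|t IH]; first by rewrite dcell0.
by rewrite [rank 0 s t.+1]/= dyadic_digit0 addbF; apply/dcell_half.
Qed.

Lemma xr0_dist s n : unitI s -> `|s - xr n 0 s| <= 2 ^- n.
Proof.
move=> sI; have := dcell_rank0 n sI; rewrite /dcell /= in_itv /= => /andP[h1 h2].
rewrite ger0_norm ?subr_ge0 // lerBlDl.
by apply: le_trans (ltW h2) _; rewrite /xr -[(rank 0 s n).+1%:R]natr1 mulrDl mul1r.
Qed.

Lemma pow2V_cvg0 : (2 ^- n : R) @[n --> \oo] --> 0.
Proof.
rewrite (_ : (fun n => 2 ^- n) = GRing.exp (2^-1 : R)).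
  by apply: cvg_expr; rewrite ger0_norm ?invr_ge0 // invf_lt1 // ltr1n.
by apply/funext => n; rewrite exprVn.
Qed.

Lemma xr0_cvg s : unitI s -> xr n 0 s @[n --> \oo] --> s.
Proof.
move=> sI; apply/cvgrPdist_le => e e0.
have /cvgr0Pnorm_lt /(_ _ e0) := pow2V_cvg0.
apply: filterS => n; rewrite ger0_norm ?invr_ge0 ?exprn_ge0 // => /ltW h.
exact: le_trans (xr0_dist n sI) h.
Qed.

Lemma dyadic_add0 s : unitI s -> dyadic_add 0 s = s.
Proof. by move=> sI; rewrite dyadic_addE; apply/cvg_lim => //; exact: xr0_cvg. Qed.

(** The points whose digits are eventually complementary to those of x: they are
    not of the form [dyadic_add x h] with h in [0,1). *)
Definition exceptional x : set R :=
  [set s | unitI s /\ exists k0, forall k, (k0 <= k)%N -> dyadic_digit s k != dyadic_digit x k].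

Lemma eq_rank0 s s' n : (forall k, (k < n)%N -> dyadic_digit s k = dyadic_digit s' k) ->
  rank 0 s n = rank 0 s' n.
Proof.
elim: n => [|n IH] // h /=; rewrite IH ?h // => k kn.
by apply: h; rewrite ltnW.
Qed.

Lemma digits_inj s s' : unitI s -> unitI s' ->
  (forall k, dyadic_digit s k = dyadic_digit s' k) -> s = s'.
Proof.
move=> sI sI' h; have := xr0_cvg sI.
rewrite (_ : (fun n => xr n 0 s) = (fun n => xr n 0 s')).
  by move=> c1; apply: cvg_unique c1 (xr0_cvg sI') => //; exact: Rhausdorff.
by apply/funext => n; rewrite /xr (eq_rank0 (s' := s')).
Qed.

(** An exceptional point is determined by a place k0 and its digits before k0. *)
Lemma countable_exceptional x : countable (exceptional x).
Proof.
have -> : exceptional x = \bigcup_(k0 in [set: nat])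
    [set s | unitI s /\ forall k, (k0 <= k)%N -> dyadic_digit s k != dyadic_digit x k].
  apply/seteqP; split => [s [sI [k0 hk]]|s [k0 _ [sI hk]]]; first by exists k0.
  by split => //; exists k0.
apply: bigcup_countable => // k0 _; apply/countable_injP.
exists (fun s => rank 0 s k0) => s s' /set_mem[sI hs] /set_mem[sI' hs'] e.
apply: digits_inj => // k; case: (leqP k0 k) => hk.
  by have := hs _ hk; have := hs' _ hk; do 3 case: dyadic_digit.
have : rank 0 s k.+1 = rank 0 s' k.+1 by rewrite -!(rank_div _ _ hk) e.
by move/(congr1 odd); rewrite !rank_odd dyadic_digit0 !addbF.
Qed.

Lemma xr_nd x s : nondecreasing_seq (fun n => xr n x s).
Proof.
apply/nondecreasing_seqP => n; rewrite /xr /= natrD -mul2n natrM exprS invfM mulrA.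
rewrite ler_pM2r ?invr_gt0 ?exprn_gt0 // mulrDl mulrAC divff // mul1r lerDl.
by rewrite divr_ge0.
Qed.

Let vr n x s : R := (rank x s n).+1%:R / 2 ^+ n.

Let vr_ni x s : nonincreasing_seq (fun n => vr n x s).
Proof.
apply/nonincreasing_seqP => n; rewrite /vr /= exprS invfM mulrA.
rewrite ler_pM2r ?invr_gt0 ?exprn_gt0 // ler_pdivrMr // -natrM ler_nat.
by case: (_ (+) _) => /=; lia.
Qed.

Let xr_lt_vr n x s : xr n x s <= vr n x s.
Proof. by rewrite /xr /vr ler_pM2r ?invr_gt0 ?exprn_gt0 // ler_nat. Qed.

Lemma xr_cvg x s : cvgn (fun n => xr n x s).
Proof.
apply: nondecreasing_is_cvgn; first exact: xr_nd.
exists 1 => _ [n _ <-]; rewrite /xr ler_pdivrMr ?exprn_gt0 // mul1r -natrX ler_nat.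
exact/ltnW/rank_lt.
Qed.

Lemma dyadic_add_bounds x s n : xr n x s <= dyadic_add x s <= vr n x s.
Proof.
rewrite dyadic_addE; apply/andP; split.
  exact: (@nondecreasing_cvgn_le R (fun n => xr n x s) (xr_nd x s) (@xr_cvg x s) n).
apply: limr_le; first exact: xr_cvg.
near=> m; apply: le_trans (xr_lt_vr _ _ _) _; apply: vr_ni.
by near: m; exists n.
Unshelve. all: by end_near. Qed.

Lemma dyadic_add_cell x s n : unitI s -> ~ exceptional x s ->
  dcell n (rank x s n) (dyadic_add x s).
Proof.
move=> sI ns; have /andP[h1 _] := dyadic_add_bounds x s n.
rewrite /dcell /= in_itv /= h1 /=.
have [k nk dk] : exists2 k, (n <= k)%N & dyadic_digit s k = dyadic_digit x k.
  apply: contrapT => no; apply: ns; split => //; exists n => k nk.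
  by apply/eqP => e; apply: no; exists k.
have /andP[_ h2] := dyadic_add_bounds x s k.+1.
apply: le_lt_trans h2 _; apply: lt_le_trans (vr_ni x s nk).
rewrite /vr /= dk addbb addn0 exprS invfM mulrA ltr_pM2r ?invr_gt0 ?exprn_gt0 //.
by rewrite ltr_pdivrMr // -natrM ltr_nat; lia.
Qed.

(** The binary expansion of [dyadic_add x s] is the digitwise sum unless the latter
    ends with digits 1 only, which is what [exceptional] excludes. *)
Lemma dyadic_addK x s : unitI s -> ~ exceptional x s ->
  unitI (dyadic_add x s) /\ dyadic_add x (dyadic_add x s) = s.
Proof.
move=> sI ns; set h := dyadic_add x s.
have hI : unitI h by have := dyadic_add_cell 0 sI ns; rewrite dcell0.
split => //.
have hd k : dyadic_digit h k = dyadic_digit s k (+) dyadic_digit x k.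
  by have /dcell_half[] := dyadic_add_cell k.+1 sI ns.
have e n : rank x h n = rank 0 s n.
  elim: n => [|n IH] //=; rewrite IH hd dyadic_digit0 addbF.
  by rewrite -addbA addbb addbF.
rewrite dyadic_addE; apply/cvg_lim => //.
rewrite (_ : (fun n => xr n x h) = (fun n => xr n 0 s)); first exact: xr0_cvg.
by apply/funext => n; rewrite /xr e.
Qed.

Lemma dyadic_continuous_near (f : R * R -> R) x y : dyadic_continuous_at f x y ->
  forall e : R, 0 < e -> exists T, forall s (t : R), unitI s -> unitI t ->
    ~ exceptional x s -> ~ exceptional y t ->
    rank x s T = 0%N -> rank y t T = 0%N -> `|f (s, t) - f (x, y)| <= e.
Proof.
move=> /cvgrPdist_le H e e0.
have [[A B] /= [/nbhs_ballP[r1 /= r10 H1] /nbhs_ballP[r2 /= r20 H2]] Hr] := (H e e0 : nbhs _ _).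
have r0 : 0 < Num.min r1 r2 by rewrite lt_min r10.
have /cvgr0Pnorm_lt /(_ _ r0) [T _ /(_ T (leqnn _))] := pow2V_cvg0.
rewrite /= ger0_norm ?invr_ge0 ?exprn_ge0 // lt_min => /andP[T1 T2].
exists T => s t sI tI ns nt rs rt.
have [hI hE] := dyadic_addK sI ns; have [kI kE] := dyadic_addK tI nt.
have small (r z w : R) : 2 ^- T < r -> unitI w -> ~ exceptional z w -> rank z w T = 0%N ->
    ball (0 : R) r (dyadic_add z w).
  move=> Tr wI nw rw; have := dyadic_add_cell T wI nw; rewrite rw /dcell /= in_itv /=.
  rewrite mul0r mul1r => /andP[a b].
  by rewrite /ball /= sub0r normrN ger0_norm // (lt_trans b).
have := Hr (dyadic_add x s, dyadic_add y t); rewrite /= hE kE distrC; apply => //.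
by split; [apply: H1; exact: small|apply: H2; exact: small].
Qed.

End DyadicTranslation.

(** * Weighted double sums *)

Section DoubleSums.
Variable R : realType.

Lemma sum_below (q : nat -> R) L n : (forall j, 0 <= q j) ->
  \sum_(j < L) (j < n)%N%:R * q j <= \sum_(j < n) q j.
Proof.
move=> q0; have -> : \sum_(j < L) (j < n)%N%:R * q j = \sum_(j < minn L n) q j.
  elim: L => [|L IH]; first by rewrite min0n !big_ord0.
  rewrite big_ord_recr /= IH; case: (ltnP L n) => h.
    by rewrite (minn_idPl h) big_ord_recr mul1r.
  by rewrite (minn_idPr (leqW h)) mul0r addr0.
by apply: sum_widen_le => //; exact: geq_minr.
Qed.

Lemma sum_pw_below (u : R) i L : 0 < u < 1 ->
  \sum_(j < L) (j <= i)%N%:R * pw (1 - u) j <= i.+1%:R `^ u / u.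
Proof.
move=> hu; have h : 0 < 1 - u < 1 by lra.
apply: le_trans (@sum_below (pw (1 - u)) L i.+1 (pw_ge0 (1 - u))) _.
by have := sum_pw i.+1 h; rewrite (_ : 1 - (1 - u) = u) //; lra.
Qed.

Lemma pw_absorb (u v : R) i : pw (1 - u) i * (i.+1%:R `^ v / v) = pw (1 - (u + v)) i / v :> R.
Proof.
rewrite mulrA /pw -powRD; last by apply/implyP => _; rewrite gt_eqF.
by congr (_ `^ _ / _); ring.
Qed.

(** For j <= i and K <= i the bound [a i] is summed over j first: the weights
    (j+1)^-(1-be) with j <= i add up to at most (i+1)^be / be, which turns
    (i+1)^-(1-al) into (i+1)^-(1-al-be). The case i <= j is symmetric, and for i and j
    below K the K^2 terms are bounded by eta. *)
Lemma weighted_double_sum (al be : R) (J : nat -> nat -> R) (a b : nat -> R)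
    (eta ea eb : R) (K I L : nat) :
  0 < al < 1 -> 0 < be < 1 ->
  (forall i, 0 <= a i) -> (forall j, 0 <= b j) -> 0 <= eta ->
  (forall i j, (i < I)%N -> (j < L)%N -> (K <= i)%N -> (j <= i)%N -> J i j <= a i) ->
  (forall i j, (i < I)%N -> (j < L)%N -> (K <= j)%N -> (i <= j)%N -> J i j <= b j) ->
  (forall i j, (i < I)%N -> (j < L)%N -> (i < K)%N -> (j < K)%N -> J i j <= eta) ->
  \sum_(i < I) (K <= i)%N%:R * (pw (1 - (al + be)) i * a i) <= ea ->
  \sum_(j < L) (K <= j)%N%:R * (pw (1 - (al + be)) j * b j) <= eb ->
  \sum_(i < I) \sum_(j < L) J i j * (pw (1 - al) i * pw (1 - be) j) <=
    eta * K%:R ^+ 2 + ea / be + eb / al.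
Proof.
move=> hal hbe a0 b0 eta0 Ha Hb He Sa Sb.
set p := pw (1 - al); set q := pw (1 - be); set r := pw (1 - (al + be)).
have p0 i : 0 <= p i by exact: pw_ge0.
have q0 i : 0 <= q i by exact: pw_ge0.
have p1 i : p i <= 1 by rewrite -(pw0 (1 - al)) pw_dec //; lra.
have q1 i : q i <= 1 by rewrite -(pw0 (1 - be)) pw_dec //; lra.
have step i j : (i < I)%N -> (j < L)%N -> J i j * (p i * q j) <=
    ((i < K) && (j < K))%N%:R * eta +
    (K <= i)%N%:R * (a i * p i) * ((j <= i)%N%:R * q j) +
    (K <= j)%N%:R * (b j * q j) * ((i <= j)%N%:R * p i).
  move=> iI jL; have pq0 : 0 <= p i * q j by rewrite mulr_ge0.
  have pq1 : p i * q j <= 1 by rewrite -[leRHS]mulr1; apply: ler_pM.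
  have t2 : 0 <= (K <= i)%N%:R * (a i * p i) * ((j <= i)%N%:R * q j).
    by rewrite !mulr_ge0.
  have t3 : 0 <= (K <= j)%N%:R * (b j * q j) * ((i <= j)%N%:R * p i).
    by rewrite !mulr_ge0.
  have [h|h] := boolP ((i < K) && (j < K))%N.
    have /andP[h1 h2] := h; rewrite mul1r -addrA.
    have := He _ _ iI jL h1 h2 => H.
    apply: le_trans (ler_wpM2r pq0 H) _.
    apply: (@le_trans _ _ eta); first by rewrite ler_piMr.
    by rewrite lerDl addr_ge0.
  rewrite mul0r add0r; have [ji|ij] := leqP j i.
    have Ki : (K <= i)%N by move: h; rewrite negb_and -!leqNgt; lia.
    rewrite Ki !mul1r; apply: (@le_trans _ _ (a i * p i * q j)).
      by rewrite -mulrA ler_wpM2r // Ha.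
    by rewrite lerDl !mulr_ge0.
  have Kj : (K <= j)%N by move: h; rewrite negb_and -!leqNgt; lia.
  rewrite Kj (ltnW ij) !mul1r mul0r mulr0 add0r.
  by rewrite -mulrA [q j * _]mulrC ler_wpM2r // Hb // ltnW.
apply: le_trans.
  by apply: ler_sum => i _; apply: ler_sum => j _; apply: step.
under eq_bigr do rewrite !big_split /=.
rewrite !big_split /=; apply: lerD; first apply: lerD.
- have cK n : \sum_(i < n) (i < K)%N%:R <= K%:R :> R.
    have := @sum_below (fun=> 1) n K (fun=> ler01).
    by under eq_bigr do rewrite mulr1; rewrite sumr_const card_ord.
  under eq_bigr do (under eq_bigr do rewrite -mulnb natrM mulrAC; rewrite -mulr_sumr -mulrA).
  rewrite -mulr_suml mulrC expr2 -mulrA ler_wpM2l //.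
  by apply: (ler_pM _ _ (cK _) (cK _)); apply: sumr_ge0.
- under eq_bigr do rewrite -mulr_sumr.
  have be0 : 0 < be by lra.
  apply: le_trans (_ : (\sum_(i < I) (K <= i)%N%:R * (r i * a i)) / be <= _); last first.
    by rewrite ler_pM2r ?invr_gt0.
  rewrite mulr_suml; apply: ler_sum => i _.
  have := ler_wpM2l (p0 i) (@sum_pw_below be i L hbe); rewrite pw_absorb => H.
  have := ler_wpM2l (mulr_ge0 (ler0n R (K <= i)%N) (a0 i)) H.
  by move=> H2; apply: (le_trans _ (le_trans H2 _)); rewrite le_eqVlt; apply/orP; left; apply/eqP; rewrite /r; ring.
- rewrite exchange_big /=; under eq_bigr do rewrite -mulr_sumr.
  have al0 : 0 < al by lra.
  apply: le_trans (_ : (\sum_(i < L) (K <= i)%N%:R * (r i * b i)) / al <= _); last first.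
    by rewrite ler_pM2r ?invr_gt0.
  rewrite mulr_suml; apply: ler_sum => i _.
  have := ler_wpM2l (q0 i) (@sum_pw_below al i I hal); rewrite pw_absorb => H.
  have := ler_wpM2l (mulr_ge0 (ler0n R (K <= i)%N) (b0 i)) H.
  rewrite [be + al]addrC => H2.
  by apply: (le_trans _ (le_trans H2 _)); rewrite le_eqVlt; apply/orP; left; apply/eqP; rewrite /r; ring.
Qed.

Lemma geometric_sum (rho : R) N : 0 < rho < 1 ->
  \sum_(t < N.+2) rho ^+ (N.+1 - t) <= (1 - rho)^-1.
Proof.
move=> /andP[r0 r1]; rewrite (reindex_inj rev_ord_inj) /=.
have H n : \sum_(k < n) rho ^+ k <= (1 - rho)^-1.
  rewrite -[leRHS]mul1r ler_pdivlMr ?subr_gt0 //.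
  have := subrX1 rho n; have : 0 <= rho ^+ n by rewrite exprn_ge0 // ltW.
  move=> h e; have : (\sum_(i < n) rho ^+ i) * (1 - rho) = 1 - rho ^+ n.
    by rewrite -[RHS]opprB e; ring.
  by move=> ->; rewrite gerBl.
apply: le_trans (H N.+2); apply: ler_sum => k _.
by rewrite subSS subKn // -ltnS.
Qed.

Lemma geometric_sum_early (rho e : R) T : 0 < rho < 1 -> 0 < e ->
  exists N0, forall N, (N0 <= N)%N ->
    \sum_(t < N.+2) (t < T)%N%:R * rho ^+ (N.+1 - t) <= e.
Proof.
move=> /andP[r0 r1] e0.
have c : (rho ^+ k) @[k --> \oo] --> 0 by apply: cvg_expr; rewrite gtr0_norm.
have e1 : 0 < e / T.+1%:R by rewrite divr_gt0.
have /cvgr0Pnorm_lt /(_ _ e1) [k0 _ Hk] := c.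
exists (T + k0)%N => N hN.
apply: le_trans (@sum_below (fun t => rho ^+ (N.+1 - t)) N.+2 T _) _.
  by move=> j; rewrite exprn_ge0 // ltW.
apply: (@le_trans _ _ (\sum_(t < T) (e / T.+1%:R))).
  apply: ler_sum => t _; have := Hk (N.+1 - t)%N.
  rewrite /= ger0_norm ?exprn_ge0 ?(ltW r0) // => h; apply/ltW/h.
  by have := ltn_ord t; lia.
rewrite sumr_const card_ord -[leLHS]mulr_natr mulrAC ler_pdivrMr // ler_wpM2l ?(ltW e0) //.
by rewrite ler_nat.
Qed.

(** The geometric weights concentrate on generations close to N and M, where S is
    small; the generations before T carry a negligible weight, and there the bound B
    suffices. *)
Lemma geometric_double_sum (rho rho' B e : R) (T : nat) :
  0 < rho < 1 -> 0 < rho' < 1 -> 0 <= B -> 0 < e ->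
  exists N0, forall N M, (N0 <= N)%N -> (N0 <= M)%N -> forall S : nat -> nat -> R,
  (forall t t', (t <= N.+1)%N -> (t' <= M.+1)%N -> S t t' <= B) ->
  (forall t t', (t <= N.+1)%N -> (t' <= M.+1)%N -> (T <= t)%N -> (T <= t')%N ->
     S t t' <= (1 - rho) * (1 - rho') * e) ->
  \sum_(t < N.+2) \sum_(t' < M.+2) rho ^+ (N.+1 - t) * rho' ^+ (M.+1 - t') * S t t' <= 3 * e.
Proof.
move=> hr hr' B0 e0.
have r1 : 0 < 1 - rho by lra. have r1' : 0 < 1 - rho' by lra.
have B1 : 0 < B + 1 by lra.
have [N1 H1] := geometric_sum_early T hr (divr_gt0 (mulr_gt0 r1' e0) B1).
have [N2 H2] := geometric_sum_early T hr' (divr_gt0 (mulr_gt0 r1 e0) B1).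
exists (maxn N1 N2) => N M; rewrite !geq_max => /andP[hN1 _] /andP[_ hM2] S SB Se.
set eps := (1 - rho) * (1 - rho') * e.
have x0 t : 0 <= rho ^+ (N.+1 - t) by rewrite exprn_ge0 //; lra.
have y0 t : 0 <= rho' ^+ (M.+1 - t) by rewrite exprn_ge0 //; lra.
have eps0 : 0 <= eps by rewrite !mulr_ge0 // ltW.
apply: (@le_trans _ _ (\sum_(t < N.+2) \sum_(t' < M.+2)
   (eps * (rho ^+ (N.+1 - t) * rho' ^+ (M.+1 - t')) +
    B * ((t < T)%N%:R * rho ^+ (N.+1 - t) * rho' ^+ (M.+1 - t')) +
    B * (rho ^+ (N.+1 - t) * ((t' < T)%N%:R * rho' ^+ (M.+1 - t')))))).
  apply: ler_sum => t _; apply: ler_sum => t' _.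
  have tN : (t <= N.+1)%N by rewrite -ltnS.
  have tM : (t' <= M.+1)%N by rewrite -ltnS.
  have xy := mulr_ge0 (x0 t) (y0 t').
  apply: (@le_trans _ _ (rho ^+ (N.+1 - t) * rho' ^+ (M.+1 - t') *
     (eps + B * (t < T)%N%:R + B * (t' < T)%N%:R))).
    rewrite ler_wpM2l //; case: (ltnP t T) => ht; case: (ltnP t' T) => ht' /=;
      rewrite ?mulr1 ?mulr0 ?addr0.
    - by apply: le_trans (SB _ _ tN tM) _; lra.
    - by apply: le_trans (SB _ _ tN tM) _; lra.
    - by apply: le_trans (SB _ _ tN tM) _; lra.
    - exact: Se.
  by rewrite le_eqVlt; apply/orP; left; apply/eqP; ring.
under eq_bigr do rewrite !big_split /= -!mulr_sumr.
rewrite !big_split /= -!mulr_sumr -!mulr_suml.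
set X := \sum_(t < N.+2) rho ^+ _; set Y := \sum_(t < M.+2) rho' ^+ _.
set X1 := \sum_(t < N.+2) _%:R * _; set Y1 := \sum_(t < M.+2) _%:R * _.
have hX : X <= (1 - rho)^-1 by exact: geometric_sum.
have hY : Y <= (1 - rho')^-1 by exact: geometric_sum.
have X0 : 0 <= X by apply: sumr_ge0. have Y0 : 0 <= Y by apply: sumr_ge0.
have X10 : 0 <= X1 by apply: sumr_ge0 => t _; rewrite mulr_ge0.
have Y10 : 0 <= Y1 by apply: sumr_ge0 => t _; rewrite mulr_ge0.
have hX1 : X1 <= (1 - rho') * e / (B + 1) by exact: H1.
have hY1 : Y1 <= (1 - rho) * e / (B + 1) by exact: H2.
have BB : B / (B + 1) <= 1 by rewrite ler_pdivrMr // mul1r; lra.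
have BB0 : 0 <= B / (B + 1) by rewrite divr_ge0 // ltW.
have p1 : eps * (X * Y) <= e.
  apply: le_trans (ler_wpM2l eps0 (ler_pM X0 Y0 hX hY)) _.
  by rewrite /eps le_eqVlt; apply/orP; left; apply/eqP; field; rewrite !gt_eqF.
have p2 : B * (X1 * Y) <= e.
  apply: le_trans (ler_wpM2l B0 (ler_pM X10 Y0 hX1 hY)) _.
  have -> : B * ((1 - rho') * e / (B + 1) / (1 - rho')) = B / (B + 1) * e.
    by field; rewrite !gt_eqF.
  by rewrite ler_piMl // ltW.
have p3 : B * (X * Y1) <= e.
  apply: le_trans (ler_wpM2l B0 (ler_pM X0 Y10 hX hY1)) _.
  have -> : B * ((1 - rho)^-1 * ((1 - rho) * e / (B + 1))) = B / (B + 1) * e.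
    by field; rewrite !gt_eqF.
  by rewrite ler_piMl // ltW.
lra.
Qed.

End DoubleSums.

(** * Integral form of the Cesaro means *)

Section CesaroMeans.
Variable R : realType.
Implicit Types (f : R * R -> R) (x y a b : R) (n m : nat).

(** Exchange the sums, and sum the Cesaro numbers of order a - 1 by [sum_cesaroA]. *)
Lemma cesaro_sum a n (G : nat -> R) : (0 < n)%N ->
  \sum_(1 <= i < n.+1) cesaroA (a - 1) (n - i) * \sum_(0 <= k < i) G k =
  \sum_(k < n) cesaroA a (n.-1 - k) * G k.
Proof.
move=> n0.
have -> : \sum_(1 <= i < n.+1) cesaroA (a - 1) (n - i) * \sum_(0 <= k < i) G k =
   \sum_(i < n) \sum_(k < n) (k <= i)%N%:R * (cesaroA (a - 1) (n.-1 - i) * G k).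
  rewrite big_add1 /= big_mkord; apply: eq_bigr => i _.
  rewrite big_mkord (big_ord_widen n G (ltn_ord i)) big_mkcond mulr_sumr.
  apply: eq_bigr => k _; rewrite ltnS -subn1 -subnDA add1n.
  by case: leqP => _; rewrite ?mul1r // mul0r mulr0.
rewrite exchange_big /=; apply: eq_bigr => k _.
rewrite -sum_cesaroA mulr_suml (reindex_inj rev_ord_inj) /=.
have kn : (n.-1 - k < n)%N by lia.
rewrite (big_ord_widen n (fun j => cesaroA (a - 1) j * G k) kn) [RHS]big_mkcond.
apply: eq_bigr => j _ /=; have := ltn_ord j; have := ltn_ord k => hk hj.
have -> : (n.-1 - (n - j.+1) = j)%N by lia.
have -> : (k <= n - j.+1)%N = (j < (n.-1 - k).+1)%N by lia.
by case: ltnP => _; rewrite ?mul1r ?mul0r.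
Qed.

Lemma cesaro_mean_int a b n m x y f : 0 < a < 1 -> 0 < b < 1 ->
  (0 < n)%N -> (0 < m)%N -> bdd2 f ->
  cesaro_mean (- a) (- b) n m x y f =
  int2 (fun p => f p * (kern a n x p.1 * kern b m y p.2)).
Proof.
move=> ha hb n0 m0 bf.
have bw k l : bdd2 (fun p : R * R => f p * walsh k p.1 * walsh l p.2).
  apply: bdd2M; last exact: (bdd2_snd (bdd1_walsh R l)).
  by apply: bdd2M => //; exact: (bdd2_fst (bdd1_walsh R k)).
transitivity (\sum_(k < n) \sum_(l < m)
   cesaro_mult a n k * cesaro_mult b m l * (walsh k x * walsh l y) * walsh_coef f k l); last first.
  transitivity (\sum_(k < n) int2 (fun p => \sum_(l < m)
     cesaro_mult a n k * cesaro_mult b m l * (walsh k x * walsh l y) * (f p * walsh k p.1 * walsh l p.2))).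
    apply: eq_bigr => k _; rewrite int2_sum; last first.
      by move=> l; apply: bdd2M; [exact: bdd2_cst|exact: bw].
    by apply: eq_bigr => l _; rewrite int2Z.
  rewrite -int2_sum; last first.
    move=> k; apply: bdd2_sum => l.
    by apply: bdd2M; [exact: bdd2_cst|exact: bw].
  apply: eq_int2 => p _; rewrite /kern big_distrlr /= mulr_sumr.
  apply: eq_bigr => k _; rewrite mulr_sumr; apply: eq_bigr => l _; ring.
rewrite /cesaro_mean.
transitivity ((cesaroA (- a) n.-1 * cesaroA (- b) m.-1)^-1 *
  \sum_(k < n) \sum_(l < m) cesaroA (- a) (n.-1 - k) * cesaroA (- b) (m.-1 - l) *
     (walsh_coef f k l * walsh k x * walsh l y)).
  congr (_ * _).
  transitivity (\sum_(1 <= i < n.+1) cesaroA (- a - 1) (n - i) * \sum_(0 <= k < i)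
    \sum_(1 <= j < m.+1) cesaroA (- b - 1) (m - j) * \sum_(0 <= l < j)
      (walsh_coef f k l * walsh k x * walsh l y)).
    apply: eq_bigr => i _.
    under eq_bigr do rewrite -mulrA; rewrite -mulr_sumr; congr (_ * _).
    under eq_bigr do rewrite /walsh_sum mulr_sumr.
    by rewrite exchange_big.
  rewrite cesaro_sum //; apply: eq_bigr => k _; rewrite cesaro_sum // mulr_sumr.
  by apply: eq_bigr => l _; rewrite mulrA.
rewrite mulr_sumr; apply: eq_bigr => k _; rewrite mulr_sumr; apply: eq_bigr => l _.
rewrite /cesaro_mult !ltn_ord invfM; ring.
Qed.

End CesaroMeans.

(** * Oscillation over cells *)

Section Oscillation.
Variable R : realType.
Implicit Types (F : R * R -> R) (x s : R) (t i : nat).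

Definition oscset F x t i : set R :=
  [set r | exists s s' y, [/\ xcell x t i s, xcell x t i s', unitI y & r = `|F (s, y) - F (s', y)|]].

Definition osc F x t i : R := sup (oscset F x t i).

Variables (F : R * R -> R) (B : R).
Hypothesis FB : forall p, unitI2 p -> `|F p| <= B.

Lemma has_ubound_osc x t i : has_ubound (oscset F x t i).
Proof.
exists (B + B) => _ [s [s' [y [[sI _] [sI' _] yI ->]]]].
by rewrite (le_trans (ler_normB _ _)) // lerD // FB.
Qed.

Lemma osc_ub x t i s s' y : xcell x t i s -> xcell x t i s' -> unitI y ->
  `|F (s, y) - F (s', y)| <= osc F x t i.
Proof. by move=> h h' hy; apply: ub_le_sup; [exact: has_ubound_osc|exists s, s', y]. Qed.

Lemma xcell_nonempty x t i : (i < 2 ^ t)%N -> exists s : R, xcell x t i s.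
Proof.
move=> it; have [q E] := xcell_dcell x it; exists (q%:R / 2 ^+ t).
rewrite E /dcell /= in_itv /= lexx /= ltr_pM2r ?invr_gt0 ?exprn_gt0 //.
by rewrite ltr_nat.
Qed.

Lemma osc_ge0 x t i : 0 <= osc F x t i.
Proof.
have [it|it] := ltnP i (2 ^ t).
  have [s hs] := xcell_nonempty x it.
  by have := osc_ub hs hs (unitI0 R); rewrite subrr normr0.
suff -> : osc F x t i = 0 by [].
rewrite /osc (_ : oscset F x t i = set0) ?sup0 //.
apply/seteqP; split => // r [s [s' [y [[_ h] _ _ _]]]].
by move: it; rewrite -h leqNgt rank_lt.
Qed.

Lemma xcell_apart x t i j (a b a' b' y y' : R) : i != j ->
  xcell x t i a -> xcell x t i b -> xcell x t j a' -> xcell x t j b' ->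
  apart (a, b, y) (a', b', y').
Proof.
move=> ij ha hb ha' hb'.
have it : (i < 2 ^ t)%N by case: ha => _ <-; exact: rank_lt.
have jt : (j < 2 ^ t)%N by case: ha' => _ <-; exact: rank_lt.
have [q E] := xcell_dcell x it; have [q' E'] := xcell_dcell x jt.
have qq : q != q'.
  apply/eqP => e; have [_ ri] := ha.
  by move: ha; rewrite E e -E' => -[_ rj]; rewrite -ri rj eqxx in ij.
have lt (q1 q2 : nat) (u v : R) : (q1 < q2)%N -> dcell t q1 u -> dcell t q2 v -> u <= v.
  rewrite /dcell /= !in_itv /= => h /andP[_ h1] /andP[h2 _].
  apply: le_trans (ltW h1) (le_trans _ h2).
  by rewrite ler_pM2r ?invr_gt0 ?exprn_gt0 // ler_nat.
rewrite E in ha hb; rewrite E' in ha' hb'.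
rewrite /apart /=; case: (ltngtP q q') qq => // h _.
- by rewrite (lt _ _ _ _ h hb ha').
- by rewrite (lt _ _ _ _ h hb' ha) orbT.
Qed.

Lemma wsum_map (T : eqType) (w : nat -> R) (g : T -> R) (u : nat -> T) n k :
  wsum w g n (map u (iota n k)) = \sum_(i < k) w (n + i)%N * g (u (n + i)%N).
Proof.
elim: k n => [|k IH] n /=; first by rewrite big_ord0.
rewrite IH big_ord_recl addn0; congr (_ + _).
by apply: eq_bigr => i _; rewrite /= addSnnS.
Qed.

(** Choose in every cell two points and an ordinate that nearly attain the
    oscillation. The intervals they span form a family, after deletion of the
    degenerate ones. *)
Lemma osc_wsum (w : nat -> R) x t n e :
  (forall k, 0 <= w k) -> nonincreasing_seq w ->
  (forall l, family l -> wsum w (fun u => `|F (u.1.2, u.2) - F (u.1.1, u.2)|) n l <= e) ->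
  \sum_(i < 2 ^ t) (n <= i)%N%:R * (w i * osc F x t i) <= e.
Proof.
move=> w0 wd H; set g := fun u : R * R * R => _ in H.
have e0 : 0 <= e by exact: (H [::]).
have [tn|nt] := leqP (2 ^ t) n.
  by rewrite big1 // => i _; rewrite leqNgt (leq_trans (ltn_ord i) tn) mul0r.
rewrite (sum_ord_split (fun i => (n <= i)%N%:R * (w i * osc F x t i)) (ltnW nt)).
rewrite big1 ?add0r; last by move=> i _; rewrite leqNgt ltn_ord mul0r.
apply/ler_addgt0Pr => d d0.
pose W := \sum_(i < 2 ^ t - n) w (n + i)%N.
have W0 : 0 <= W by apply: sumr_ge0.
pose th := d / (W + 1).
have th0 : 0 < th by rewrite divr_gt0 //; lra.
have ex i : exists u : R * R * R, (i < 2 ^ t)%N ->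
   [/\ xcell x t i u.1.1, xcell x t i u.1.2, u.1.1 <= u.1.2, unitI u.2 &
       osc F x t i - th <= g u].
  have [it|] := ltnP i (2 ^ t); last by exists (0, 0, 0).
  have ne : oscset F x t i !=set0.
    have [s hs] := xcell_nonempty x it.
    by exists `|F (s, 0) - F (s, 0)|, s, s, 0; split => //; exact: unitI0.
  have [_ [s [s' [y [hs hs' yI ->]]]] h] :=
    sup_adherent th0 (conj ne (has_ubound_osc x t i)).
  have [ss|ss] := leP s s'.
    by exists (s, s', y) => _; split => //=; rewrite /g /= distrC ltW.
  by exists (s', s, y) => _; split => //=; rewrite ?(ltW ss) // ltW.
have [u Hu] := choice ex.
pose l := [seq z <- map u (iota n (2 ^ t - n)) | z.1.1 < z.1.2].
have fl : family l.
  apply/andP; split.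
    apply/allP => z; rewrite mem_filter => /andP[zz /mapP[i]].
    rewrite mem_iota => /andP[_ i2] ez; rewrite subnKC ?(ltnW nt) // in i2.
    have [[a1 _] [a2 _] _ a3 _] := Hu i i2; rewrite -ez in a1 a2 a3.
    move: a1 a2 a3; rewrite /unitI /proper /= !in_itv /= zz.
    by move=> /andP[-> _] /andP[_ ->] /andP[-> ->].
  apply: pairwise_filter; rewrite pairwise_map.
  apply/(pairwiseP 0%N) => i j; rewrite !inE size_iota => hi hj ij.
  rewrite !nth_iota //=.
  have h1 : (n + i < 2 ^ t)%N by lia.
  have h2 : (n + j < 2 ^ t)%N by lia.
  have [a1 a2 _ _ _] := Hu _ h1; have [b1 b2 _ _ _] := Hu _ h2.
  case: (u (n + i)%N) a1 a2 => -[a b] y /= a1 a2.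
  case: (u (n + j)%N) b1 b2 => -[a' b'] y' /= b1 b2.
  apply: (xcell_apart y y' _ a1 a2 b1 b2).
  by apply/eqP => /addnI ee; rewrite ee ltnn in ij.
have := H l fl => H1.
have H2 := @wsum_filter _ _ w g n (fun z => z.1.1 < z.1.2) (map u (iota n (2 ^ t - n)))
  (fun z => normr_ge0 _) wd.
have := le_trans H2 H1; rewrite wsum_map => H3.
apply: (@le_trans _ _ (\sum_(i < 2 ^ t - n) w (n + i)%N *
   ((if (u (n + i)%N).1.1 < (u (n + i)%N).1.2 then g (u (n + i)%N) else 0) + th))).
  apply: ler_sum => i _; rewrite leq_addr mul1r ler_wpM2l //.
  have hi : (n + i < 2 ^ t)%N by have := ltn_ord i; lia.
  have [_ _ c _ h] := Hu _ hi; rewrite -lerBlDr; apply: le_trans h _.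
  case: ltP => // c'; rewrite /g.
  have -> : (u (n + i)%N).1.1 = (u (n + i)%N).1.2 by apply/eqP; rewrite eq_le c c'.
  by rewrite subrr normr0.
under eq_bigr do rewrite mulrDr.
rewrite big_split /= -mulr_suml; apply: lerD => //.
rewrite /th -/W mulrCA ler_piMr ?(ltW d0) // ler_pdivrMr; lra.
Qed.

End Oscillation.

(** * The deviation of the means as a sum of pairings *)

Arguments atom : simpl never.

Section Convergence.
Variables (R : realType) (al be : R) (f : R * R -> R) (x y : R).
Hypotheses (hal : 0 < al < 1) (hbe : 0 < be < 1) (hab : al + be < 1).
Hypotheses (xI : unitI x) (yI : unitI y) (bf : bdd2 f).
Implicit Types (t i j n m N M : nat) (b : bool).

Let c := f (x, y).
Let gam := 1 - (al + be).
Let fsw (p : R * R) := f (p.2, p.1).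

Let bfc : bdd2 (fun p => f p - c).
Proof. by apply: bdd2D => //; exact: bdd2_cst. Qed.

Definition atom_pairing b t i b' t' j : R :=
  int2 (fun p => (f p - f (x, y)) * (atom x b t i p.1 * atom y b' t' j p.2)).

Let batoms b t i b' t' j : bdd2 (fun p : R * R => atom x b t i p.1 * atom y b' t' j p.2).
Proof. by apply: bdd2M; [apply: bdd2_fst|apply: bdd2_snd]; exact: bdd1_atom. Qed.

Let atom_out z b t i s : rank z s t != i -> atom z b t i s = 0 :> R.
Proof. by rewrite /atom => /negbTE ->; rewrite mulr0 mul0r. Qed.

Section Bounded.
Variable B : R.
Hypothesis fB : forall p, unitI2 p -> `|f p| <= B.

(** A signed atom has mean zero, so that f may be replaced by its difference with
    the value at a fixed point of the cell, the other coordinate being kept. *)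
Lemma pairing_le_osc1 t i b' t' j : (i < 2 ^ t)%N -> (j < 2 ^ t')%N ->
  `|atom_pairing true t i b' t' j| <= osc f x t i.
Proof.
move=> it jt; have [s0 hs0] := xcell_nonempty x it; have [s0I _] := hs0.
have b0 : bdd1 (fun u => (f (s0, u) - c) * atom y b' t' j u).
  apply: bdd1M; last exact: bdd1_atom.
  by apply: bdd1D; [exact: bdd1_sectionl|exact: bdd1_cst].
have b1 : bdd2 (fun p : R * R => (f p - f (s0, p.2)) * (atom x true t i p.1 * atom y b' t' j p.2)).
  apply: bdd2M => //; apply: bdd2D => //.
  apply: bdd2_eq (bdd2M (bdd2_cst (-1)) (bdd2_snd (bdd1_sectionl s0I bf))) => p _.
  by rewrite mulN1r.
(* a function of the second variable is orthogonal to a signed atom in the first *)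
have -> : atom_pairing true t i b' t' j =
    int2 (fun p => (f p - f (s0, p.2)) * (atom x true t i p.1 * atom y b' t' j p.2)).
  rewrite /atom_pairing (@eq_int2 _ _ (fun p =>
    (f p - f (s0, p.2)) * (atom x true t i p.1 * atom y b' t' j p.2) +
    atom x true t i p.1 * ((f (s0, p.2) - c) * atom y b' t' j p.2))); last first.
    by move=> p _; rewrite /c; ring.
  rewrite int2D //; last first.
    by apply: bdd2M; [apply: bdd2_fst; exact: bdd1_atom|exact: (bdd2_snd b0)].
  by rewrite (int2_prod (bdd1_atom x true t i) b0) int1_atom mul0r addr0.
have := @int2_bound R _ _ _ (osc f x t i) b1 (bdd1_atom x true t i) (bdd1_atom y b' t' j)
  (osc_ge0 fB x t i).
rewrite !int1_norm_atom // !mulr1; apply => -[s u] [/= sI uI].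
rewrite normrM (normrM (atom x _ _ _ _)) /=; have [rs|rs] := eqVneq (rank x s t) i; last first.
  by rewrite atom_out // normr0 !(mul0r, mulr0).
by rewrite ler_wpM2r ?mulr_ge0 // (osc_ub fB).
Qed.

Lemma pairing_le_osc2 b t i t' j : (i < 2 ^ t)%N -> (j < 2 ^ t')%N ->
  `|atom_pairing b t i true t' j| <= osc fsw y t' j.
Proof.
have fswB p : unitI2 p -> `|fsw p| <= B by case: p => s u [/= ? ?]; apply: fB.
move=> it jt; have [s0 hs0] := xcell_nonempty y jt; have [s0I _] := hs0.
have b0 : bdd1 (fun u => (f (u, s0) - c) * atom x b t i u).
  apply: bdd1M; last exact: bdd1_atom.
  by apply: bdd1D; [exact: bdd1_sectionr|exact: bdd1_cst].
have b1 : bdd2 (fun p : R * R => (f p - f (p.1, s0)) * (atom x b t i p.1 * atom y true t' j p.2)).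
  apply: bdd2M => //; apply: bdd2D => //.
  apply: bdd2_eq (bdd2M (bdd2_cst (-1)) (bdd2_fst (bdd1_sectionr s0I bf))) => p _.
  by rewrite mulN1r.
have -> : atom_pairing b t i true t' j =
    int2 (fun p => (f p - f (p.1, s0)) * (atom x b t i p.1 * atom y true t' j p.2)).
  rewrite /atom_pairing (@eq_int2 _ _ (fun p =>
    (f p - f (p.1, s0)) * (atom x b t i p.1 * atom y true t' j p.2) +
    ((f (p.1, s0) - c) * atom x b t i p.1) * atom y true t' j p.2)); last first.
    by move=> p _; rewrite /c; ring.
  rewrite int2D //; last first.
    by apply: bdd2M; [exact: (bdd2_fst b0)|apply: bdd2_snd; exact: bdd1_atom].
  by rewrite (int2_prod b0 (bdd1_atom y true t' j)) int1_atom mulr0 addr0.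
have := @int2_bound R _ _ _ (osc fsw y t' j) b1 (bdd1_atom x b t i) (bdd1_atom y true t' j)
  (osc_ge0 fswB y t' j).
rewrite !int1_norm_atom // !mulr1; apply => -[s u] [/= sI uI].
rewrite normrM (normrM (atom x _ _ _ _)) /=; have [rs|rs] := eqVneq (rank y u t') j; last first.
  by rewrite [atom y _ _ _ _]atom_out // normr0 !(mul0r, mulr0).
by rewrite ler_wpM2r ?mulr_ge0 // (osc_ub fswB (x := y) (t := t') (i := j) (s := u) (s' := s0) (y := s)).
Qed.

Lemma pairing_bounded b t i b' t' j : (i < 2 ^ t)%N -> (j < 2 ^ t')%N ->
  `|atom_pairing b t i b' t' j| <= 2 * B.
Proof.
move=> it jt; have B0 : 0 <= B by apply: le_trans (fB (p := (x, y)) _).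
have := @int2_bound R _ _ _ (2 * B) (bdd2M bfc (batoms b t i b' t' j))
  (bdd1_atom x b t i) (bdd1_atom y b' t' j).
rewrite !int1_norm_atom // !mulr1; apply; first by rewrite mulr_ge0.
move=> p pI; rewrite normrM (normrM (atom x _ _ _ _)) ler_wpM2r ?mulr_ge0 //.
have := fB pI; have := fB (conj xI yI : unitI2 (x, y)); rewrite -/c.
by have := ler_normB (f p) c; lra.
Qed.

End Bounded.

(** Except for a null set, the product of the two cells consists of points close to
    (x, y) in the dyadic sense. *)
Lemma pairing_near e T b t i b' t' j : 0 <= e ->
  (forall s u, unitI s -> unitI u -> ~ exceptional x s -> ~ exceptional y u ->
     rank x s T = 0%N -> rank y u T = 0%N -> `|f (s, u) - f (x, y)| <= e) ->
  (T <= t)%N -> (T <= t')%N -> (i < 2 ^ (t - T))%N -> (j < 2 ^ (t' - T))%N ->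
  `|atom_pairing b t i b' t' j| <= e.
Proof.
move=> e0 H Tt Tt' it jt.
have it' : (i < 2 ^ t)%N by rewrite (leq_trans it) // leq_pexp2l // leq_subr.
have jt' : (j < 2 ^ t')%N by rewrite (leq_trans jt) // leq_pexp2l // leq_subr.
have := @int2_bound_ae R _ _ _ e _ _ (bdd2M bfc (batoms b t i b' t' j))
  (bdd1_atom x b t i) (bdd1_atom y b' t' j) e0
  (countable_exceptional x) (countable_exceptional y).
rewrite !int1_norm_atom // !mulr1; apply => -[s u] [/= sI uI] ns nu.
rewrite normrM (normrM (atom x _ _ _ _)) /=.
have [rs|rs] := eqVneq (rank x s t) i; last first.
  by rewrite atom_out // normr0 !(mul0r, mulr0).
have [ru|ru] := eqVneq (rank y u t') j; last first.
  by rewrite [atom y _ _ _ _]atom_out // normr0 !(mul0r, mulr0).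
rewrite ler_wpM2r ?mulr_ge0 //; apply: H => //.
- by rewrite -(rank_div _ _ Tt) rs divn_small.
- by rewrite -(rank_div _ _ Tt') ru divn_small.
Qed.

Lemma bdd1_kern (a : R) n (z : R) : unitI z -> bdd1 (kern a n z).
Proof.
move=> zI; apply: bdd1_sum => j; apply: bdd1M; first exact: bdd1_cst.
by apply: bdd1M; [exact: bdd1_cst|exact: bdd1_walsh].
Qed.

Lemma int1_kern (a : R) N n (z : R) : 0 < a < 1 -> (2 ^ N <= n < 2 ^ N.+1)%N -> unitI z ->
  int1 (kern a n z) = 1.
Proof.
move=> ha hn zI.
have bt b t i r : bdd1 (fun s => r * atom z b t i s).
  by apply: bdd1M; [exact: bdd1_cst|exact: bdd1_atom].
rewrite (eq_int1 (fun s sI => kern_expansion ha hn zI sI)) int1_sum; last first.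
  by move=> t; apply: bdd1_sum => i.
rewrite big_ord_recr big1 /=.
  rewrite add0r ltnn int1_sum // (eq_bigr (fun i : 'I_(2 ^ N.+1) => (i == 0 :> nat)%:R)).
    rewrite (bigD1 (Ordinal (expn_gt0 2 N.+1 : 0 < 2 ^ N.+1)%N)) //= big1 ?addr0 //.
    by move=> i /eqP i0; case: eqP => // e; case: i0; apply/val_inj.
  move=> i _; rewrite int1Z; last exact: bdd1_atom.
  by rewrite int1_atom_unsigned // mulr1 /acoef ltnn.
move=> t _; rewrite int1_sum // big1 // => i _.
rewrite int1Z; last exact: bdd1_atom.
by have -> : (t <= N)%N; [rewrite -ltnS|rewrite int1_atom mulr0].
Qed.

(** The kernels have integral 1, so that the deviation is the integral of
    f - f(x, y) against the product of the expansions of the two kernels. *)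
Lemma cesaro_deviation N M n m :
  (2 ^ N <= n < 2 ^ N.+1)%N -> (2 ^ M <= m < 2 ^ M.+1)%N ->
  cesaro_mean (- al) (- be) n m x y f - f (x, y) =
  \sum_(t < N.+2) \sum_(t' < M.+2) \sum_(i < 2 ^ t) \sum_(j < 2 ^ t')
     acoef al N n t i * acoef be M m t' j * atom_pairing (t <= N)%N t i (t' <= M)%N t' j.
Proof.
move=> hn hm.
have n0 : (0 < n)%N by case/andP: hn => h _; rewrite (leq_trans _ h) ?expn_gt0.
have m0 : (0 < m)%N by case/andP: hm => h _; rewrite (leq_trans _ h) ?expn_gt0.
have bk : bdd2 (fun p : R * R => kern al n x p.1 * kern be m y p.2).
  by apply: bdd2M; [apply: bdd2_fst|apply: bdd2_snd]; exact: bdd1_kern.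
have -> : f (x, y) = int2 (fun p => c * (kern al n x p.1 * kern be m y p.2)).
  rewrite int2Z // int2_prod; try exact: bdd1_kern.
  by rewrite (int1_kern hal hn) // (int1_kern hbe hm) // !mulr1.
rewrite cesaro_mean_int // -[X in _ - X]mul1r -mulNr -int2Z; last first.
  by apply: bdd2M => //; exact: bdd2_cst.
rewrite -int2D; last 2 first.
- exact: bdd2M.
- by apply: bdd2M; [exact: bdd2_cst|apply: bdd2M => //; exact: bdd2_cst].
have bterm t t' i j : bdd2 (fun p => acoef al N n t i * acoef be M m t' j *
    ((f p - c) * (atom x (t <= N)%N t i p.1 * atom y (t' <= M)%N t' j p.2))).
  by apply: bdd2M; [exact: bdd2_cst|exact: bdd2M].
transitivity (int2 (fun p => \sum_(t < N.+2) \sum_(t' < M.+2) \sum_(i < 2 ^ t) \sum_(j < 2 ^ t')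
  acoef al N n t i * acoef be M m t' j *
    ((f p - c) * (atom x (t <= N)%N t i p.1 * atom y (t' <= M)%N t' j p.2)))).
  apply: eq_int2 => -[s u] [/= sI uI].
  have -> : f (s, u) * (kern al n x s * kern be m y u) + -1 * (c * (kern al n x s * kern be m y u))
     = (f (s, u) - c) * (kern al n x s * kern be m y u) by ring.
  rewrite (kern_expansion hal hn xI sI) (kern_expansion hbe hm yI uI).
  rewrite big_distrlr /= mulr_sumr; apply: eq_bigr => t _.
  rewrite mulr_sumr; apply: eq_bigr => t' _.
  rewrite big_distrlr /= mulr_sumr; apply: eq_bigr => i _.
  by rewrite mulr_sumr; apply: eq_bigr => j _; ring.
rewrite int2_sum; last by move=> t; do 3 apply: bdd2_sum => ?; exact: bterm.
apply: eq_bigr => t _; rewrite int2_sum; last by move=> t'; do 2 apply: bdd2_sum => ?; exact: bterm.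
apply: eq_bigr => t' _; rewrite int2_sum; last by move=> i; apply: bdd2_sum => ?; exact: bterm.
apply: eq_bigr => i _; rewrite int2_sum; last by move=> j; exact: bterm.
by apply: eq_bigr => j _; rewrite int2Z //; exact: bdd2M.
Qed.

End Convergence.

(** * Convergence at points of dyadic continuity *)

Section SharpBV.
Variables (R : realType) (lam : nat -> R) (f : R * R -> R).
Hypotheses (lam0 : forall k, 0 < lam k) (bvf : sharpBV lam f).
Let fsw (p : R * R) := f (p.2, p.1).
Let incr (F : R * R -> R) (u : R * R * R) := `|F (u.1.2, u.2) - F (u.1.1, u.2)|.

Lemma sharpBV_family : exists2 V, 0 <= V & forall l, family l ->
  wsum (fun k => (lam k)^-1) (incr f) 0 l <= V /\
  wsum (fun k => (lam k)^-1) (incr fsw) 0 l <= V.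
Proof.
have [_ fin] := bvf.
have p1 : (0 <= sharpV1 lam f)%E by apply: (sharpV1_family f lam0 (isT : family [::])).
have p2 : (0 <= sharpV2 lam f)%E by apply: (sharpV1_family fsw lam0 (isT : family [::])).
have f1 : sharpV1 lam f \is a fin_num.
  by rewrite ge0_fin_numE //; apply: le_lt_trans fin; rewrite /sharpV leeDl.
have f2 : sharpV2 lam f \is a fin_num.
  by rewrite ge0_fin_numE //; apply: le_lt_trans fin; rewrite /sharpV leeDr.
exists (fine (sharpV1 lam f) + fine (sharpV2 lam f)).
  by rewrite addr_ge0 // fine_ge0.
move=> l fl; split.
  have := sharpV1_family f lam0 fl; rewrite -(fineK f1) lee_fin => h.
  by apply: le_trans h _; rewrite lerDl fine_ge0.
have := (sharpV1_family fsw lam0 fl : (_ <= sharpV2 lam f)%E); rewrite -(fineK f2) lee_fin => h.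
by apply: le_trans h _; rewrite lerDr fine_ge0.
Qed.

Lemma sharpBV_bdd2 : bdd2 f.
Proof.
have [mf _] := bvf; split => //.
have [V V0 HV] := sharpBV_family.
have one (F : R * R -> R) : (forall l, family l -> wsum (fun k => (lam k)^-1) (incr F) 0 l <= V) ->
    forall s u, unitI s -> unitI u -> `|F (s, u) - F (0, u)| <= lam 0%N * V.
  move=> H s u sI uI; have [->|s0] := eqVneq s 0.
    by rewrite subrr normr0 mulr_ge0 // ltW.
  have := H [:: (0, s, u)]; rewrite /family /= /proper /= !andbT lexx /=.
  move: sI uI; rewrite /unitI /= !in_itv /= => /andP[s1 ->] /andP[-> ->].
  rewrite lt_neqAle eq_sym s0 s1 /= => /(_ isT).
  by rewrite addr0 mulrC ler_pdivrMr // mulrC.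
have h1 := one f (fun l fl => (HV l fl).1).
have h2 := one fsw (fun l fl => (HV l fl).2).
exists (lam 0%N * V + lam 0%N * V + `|f (0, 0)|) => -[s u] [/= sI uI].
have -> : f (s, u) = (f (s, u) - f (0, u)) + (f (0, u) - f (0, 0)) + f (0, 0) by ring.
apply: le_trans (ler_normD _ _) _; apply: lerD => //.
apply: le_trans (ler_normD _ _) _; apply: lerD; first exact: h1.
exact: (h2 _ _ uI (unitI0 R)).
Qed.

End SharpBV.

Section PowerTail.
Variables (R : realType) (gam : R) (F : R * R -> R) (B V : R).
Hypotheses (hg : 0 < gam < 1) (FB : forall p, unitI2 p -> `|F p| <= B).
Let incr (u : R * R * R) := `|F (u.1.2, u.2) - F (u.1.1, u.2)|.
Hypothesis FV : forall l, family l -> wsum (pw gam) incr 0 l <= V.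

(** The doubling constant of the weights is 2^gam > 1. *)
Lemma power_tail (e : R) : 0 < e -> exists n, forall l, family l -> wsum (pw gam) incr n l <= e.
Proof.
have hg' := hg.
have B0 : 0 <= B by apply: le_trans (FB (p := (0, 0)) _) => //; split; exact: unitI0.
apply: (@wsum_tail R incr (B + B) V (pw gam) (2 `^ gam)).
- by move=> u; exact: normr_ge0.
- move=> [[a b] y] /and5P[/= h1 h2 h3 h4 h5].
  have I z : 0 <= z -> z < 1 -> unitI z by rewrite /unitI /= in_itv /= => -> ->.
  rewrite /incr /=; apply: le_trans (ler_normB _ _) _.
  by apply: lerD; apply: FB; split; apply: I => //=; lra.
- by rewrite addr_ge0.
- exact: pw_ge0.
- by apply: pw_dec; lra.
- by apply: pw_cvg0; lra.
- have e1 : 1 `^ gam = 1 :> R by rewrite powR1.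
  rewrite -[ltLHS]e1; apply: gt0_ltr_powR; rewrite ?nnegrE ?ltr1n //; lra.
- by rewrite -[leRHS]powRr1 // ler_powR ?ler1n //; lra.
- by move=> k; rewrite pw_double1.
- by move=> k; apply: pw_double2; lra.
- exact: FV.
Qed.
End PowerTail.

Section PartA.
Variables (R : realType) (al be : R) (f : R * R -> R) (x y : R).
Hypotheses (hal : 0 < al < 1) (hbe : 0 < be < 1) (hab : al + be < 1).
Hypotheses (xI : unitI x) (yI : unitI y).
Hypothesis bvf : sharpBV (fun k => k.+1%:R `^ (1 - (al + be))) f.
Hypothesis cf : dyadic_continuous_at f x y.

Let fsw (p : R * R) := f (p.2, p.1).
Let gam := 1 - (al + be).

(** Inserting the coefficient bounds into [cesaro_deviation] leaves, for every pair
    of generations, the weighted double sum S of the pairings. It is bounded by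
    the sharp variations; once both generations are large it is small, by
    [power_tail] for ranks beyond K and by continuity for smaller ranks. The
    geometric weights of the generations finish the proof. *)
Lemma cesaro_near (e : R) : 0 < e -> exists N0, forall N M n m,
  (N0 <= N)%N -> (N0 <= M)%N ->
  (2 ^ N <= n < 2 ^ N.+1)%N -> (2 ^ M <= m < 2 ^ M.+1)%N ->
  `|cesaro_mean (- al) (- be) n m x y f - f (x, y)| <= e.
Proof.
have hal' := hal; have hbe' := hbe; have hab' := hab.
move=> e0; have h3 : 0 < 3 :> R by rewrite ltr0n.
have hg : 0 < gam < 1 by rewrite /gam; lra.
have lam0 k : 0 < k.+1%:R `^ gam :> R by rewrite powR_gt0.
have bf := sharpBV_bdd2 lam0 bvf.
have [mf [B fB]] := bf.
have B0 : 0 <= B by apply: le_trans (fB (x, y) _).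
have fswB p : unitI2 p -> `|fsw p| <= B by case: p => s u [/= ? ?]; apply: fB.
have [V V0 HV] := sharpBV_family lam0 bvf.
have lamE : (fun k => (k.+1%:R `^ gam)^-1) = pw gam by apply/funext => k; rewrite pwN.
have HV1 l : family l -> _ := fun h => (HV l h).1.
have HV2 l : family l -> _ := fun h => (HV l h).2.
rewrite lamE in HV1 HV2.
have [C C0 HC] := norm_acoef hal; have [C' C0' HC'] := norm_acoef hbe.
set rho := decay_rate al in HC; set rho' := decay_rate be in HC'.
have hr : 0 < rho < 1 by exact: decay_rate01.
have hr' : 0 < rho' < 1 by exact: decay_rate01.
have r1 : 0 < 1 - rho by lra. have r1' : 0 < 1 - rho' by lra.
have al0 : 0 < al by lra. have be0 : 0 < be by lra.
pose e1 := e / (3 * (C * C')).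
have CC : 0 < C * C' by rewrite mulr_gt0.
have e10 : 0 < e1 by rewrite /e1 divr_gt0 // mulr_gt0.
pose s := (1 - rho) * (1 - rho') * e1.
have s0 : 0 < s := mulr_gt0 (mulr_gt0 r1 r1') e10.
have [K1 HK1] := power_tail hg fB HV1 (mulr_gt0 s0 (divr_gt0 be0 h3)).
have [K2 HK2] := power_tail hg fswB HV2 (mulr_gt0 s0 (divr_gt0 al0 h3)).
pose K := (maxn K1 K2).+1.
have wd : nonincreasing_seq (pw gam) by apply: pw_dec; lra.
have KR : 0 < K%:R ^+ 2 :> R by rewrite exprn_gt0 ?ltr0n.
pose eta := s / 3 / K%:R ^+ 2.
have eta0 : 0 < eta := divr_gt0 (divr_gt0 s0 h3) KR.
have [T0 HT0] := dyadic_continuous_near cf eta0.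
pose Bd := 2 * B * 1%:R ^+ 2 + V / be + V / al.
have Bd0 : 0 <= Bd by rewrite !addr_ge0 ?mulr_ge0 ?invr_ge0 // ltW.
have [N0 HN0] := @geometric_double_sum R rho rho' Bd e1 (T0 + K)%N hr hr' Bd0 e10.
exists N0 => N M n m hN hM hn hm.
rewrite (cesaro_deviation hal hbe xI yI bf hn hm).
(* in the last generation only the atom on the cell of the point occurs, and this
   atom does not have mean zero; the guard removes the others *)
pose guard t i N := (t <= N)%N || (i == 0%N).
pose J t t' i j := (guard t i N && guard t' j M)%:R *
   `|atom_pairing f x y (t <= N)%N t i (t' <= M)%N t' j|.
pose S t t' := \sum_(i < 2 ^ t) \sum_(j < 2 ^ t') J t t' i j * (pw (1 - al) i * pw (1 - be) j).
have Josc1 t t' i j : (i < 2 ^ t)%N -> (j < 2 ^ t')%N -> (0 < i)%N ->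
    J t t' i j <= osc f x t i.
  move=> it jt i0; rewrite /J /guard; case: (leqP t N) => tN /=; last first.
    by rewrite eqn0Ngt i0 /= mul0r (osc_ge0 fB).
  case: (_ || _); rewrite ?mul1r ?mul0r ?(osc_ge0 fB) //.
  exact: (pairing_le_osc1 _ _ bf fB).
have Josc2 t t' i j : (i < 2 ^ t)%N -> (j < 2 ^ t')%N -> (0 < j)%N ->
    J t t' i j <= osc fsw y t' j.
  move=> it jt j0; rewrite /J /guard; case: (leqP t' M) => tM /=; last first.
    by rewrite (eqn0Ngt j) j0 /= andbF mul0r (osc_ge0 fswB).
  rewrite andbT; case: (_ || _); rewrite ?mul1r ?mul0r ?(osc_ge0 fswB) //.
  exact: (pairing_le_osc2 _ _ bf fB).
have Jle t t' i j q : 0 <= q ->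
    `|atom_pairing f x y (t <= N)%N t i (t' <= M)%N t' j| <= q -> J t t' i j <= q.
  by move=> q0 h; rewrite /J; case: (_ && _); rewrite ?mul1r ?mul0r.
have SB t t' : (t <= N.+1)%N -> (t' <= M.+1)%N -> S t t' <= Bd.
  move=> _ _; apply: (@weighted_double_sum R al be (J t t') (osc f x t) (osc fsw y t')
    (2 * B) V V 1) => //.
  + by move=> i; exact: (osc_ge0 fB).
  + by move=> i; exact: (osc_ge0 fswB).
  + by rewrite mulr_ge0.
  + by move=> i j it jt i0 _; exact: Josc1.
  + by move=> i j it jt j0 _; exact: Josc2.
  + by move=> i j it jt _ _; apply: Jle; [rewrite mulr_ge0|exact: pairing_bounded].
  + apply: (osc_wsum fB) => //; first exact: pw_ge0.
    by move=> l fl; apply: le_trans (HV1 l fl); apply: wsum_shift.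
  + apply: (osc_wsum fswB) => //; first exact: pw_ge0.
    by move=> l fl; apply: le_trans (HV2 l fl); apply: wsum_shift.
have Ss t t' : (t <= N.+1)%N -> (t' <= M.+1)%N -> (T0 + K <= t)%N -> (T0 + K <= t')%N ->
    S t t' <= (1 - rho) * (1 - rho') * e1.
  move=> _ _ Tt Tt'.
  have -> : (1 - rho) * (1 - rho') * e1 =
      eta * K%:R ^+ 2 + (s * (be / 3)) / be + (s * (al / 3)) / al.
    by rewrite /eta -/s; field; rewrite !gt_eqF //= ltr0n.
  have near k t0 : (k < K)%N -> (T0 + K <= t0)%N -> (T0 <= t0)%N /\ (k < 2 ^ (t0 - T0))%N.
    move=> kK h; split; first by rewrite (leq_trans _ h) // leq_addr.
    rewrite (leq_trans kK) // (leq_trans (ltnW (ltn_expl K (isT : 1 < 2)%N))) //.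
    by rewrite leq_pexp2l // leq_subRL // (leq_trans (leq_addr K T0)).
  apply: (@weighted_double_sum R al be (J t t') (osc f x t) (osc fsw y t') eta _ _ K) => //.
  + by move=> i; exact: (osc_ge0 fB).
  + by move=> i; exact: (osc_ge0 fswB).
  + exact: ltW.
  + by move=> i j it jt i0 _; apply: Josc1 => //; apply: leq_trans i0.
  + by move=> i j it jt j0 _; apply: Josc2 => //; apply: leq_trans j0.
  + move=> i j it jt iK jK; apply: Jle; first exact: ltW.
    have [n1 n2] := near _ _ iK Tt; have [n3 n4] := near _ _ jK Tt'.
    exact: (pairing_near bf _ _ (ltW eta0) HT0 n1 n3 n2 n4).
  + apply: (osc_wsum fB) => //; first exact: pw_ge0.
    move=> l fl; apply: le_trans (HK1 l fl); apply: wsum_shift => //.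
    by rewrite leqW // leq_maxl.
  + apply: (osc_wsum fswB) => //; first exact: pw_ge0.
    move=> l fl; apply: le_trans (HK2 l fl); apply: wsum_shift => //.
    by rewrite leqW // leq_maxr.
have HS := HN0 N M hN hM S SB Ss.
apply: (@le_trans _ _ (C * C' * (\sum_(t < N.+2) \sum_(t' < M.+2)
   rho ^+ (N.+1 - t) * rho' ^+ (M.+1 - t') * S t t'))); last first.
  apply: le_trans (ler_wpM2l (ltW CC) HS) _.
  rewrite /e1 le_eqVlt; apply/orP; left; apply/eqP; field.
  by rewrite !gt_eqF.
apply: le_trans (ler_norm_sum _ _ _) _; rewrite mulr_sumr; apply: ler_sum => t _.
apply: le_trans (ler_norm_sum _ _ _) _; rewrite mulr_sumr; apply: ler_sum => t' _.
apply: le_trans (ler_norm_sum _ _ _) _; rewrite /S mulr_sumr mulr_sumr; apply: ler_sum => i _.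
apply: le_trans (ler_norm_sum _ _ _) _; rewrite mulr_sumr mulr_sumr; apply: ler_sum => j _.
have tN : (t <= N.+1)%N by rewrite -ltnS.
have tM : (t' <= M.+1)%N by rewrite -ltnS.
have A1 := HC _ _ _ _ hn tN (ltn_ord i); have A2 := HC' _ _ _ _ hm tM (ltn_ord j).
rewrite !normrM.
have -> : C * C' * (rho ^+ (N.+1 - t) * rho' ^+ (M.+1 - t') *
    (J t t' i j * (pw (1 - al) i * pw (1 - be) j))) =
  (C * rho ^+ (N.+1 - t) * pw (1 - al) i) * (C' * rho' ^+ (M.+1 - t') * pw (1 - be) j) * J t t' i j.
  by ring.
rewrite /J; have [g|g] := boolP (guard t i N && guard t' j M).
  by rewrite mul1r ler_wpM2r //; apply: ler_pM.
rewrite mul0r mulr0.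
have z a N' t0 i0 : ~~ guard t0 i0 N' -> acoef a N' n t0 i0 = 0 :> R /\ acoef a N' m t0 i0 = 0 :> R.
  by rewrite /guard negb_or => /andP[/negbTE h1 /negbTE h2]; rewrite /acoef h1 h2.
move: g; rewrite negb_and => /orP[g|g].
  by rewrite (z _ _ _ _ g).1 normr0 !mul0r.
by rewrite (z _ _ _ _ g).2 normr0 mulr0 mul0r.
Qed.

Lemma cesaro_cvg :
  cesaro_mean (- al) (- be) nm.1 nm.2 x y f @[nm --> filter_prod \oo \oo] --> f (x, y).
Proof.
apply/cvgrPdist_le => e e0; have [N0 H] := cesaro_near e0.
exists ([set n | (2 ^ N0 <= n)%N], [set m | (2 ^ N0 <= m)%N]).
  by split; exists (2 ^ N0)%N.
move=> [n m] [/= hn hm]; rewrite distrC.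
have lg k : (2 ^ N0 <= k)%N -> (N0 <= trunc_log 2 k)%N /\
    (2 ^ trunc_log 2 k <= k < 2 ^ (trunc_log 2 k).+1)%N.
  move=> hk; split; first exact: trunc_log_max.
  by rewrite trunc_log_ltn // andbT trunc_logP // (leq_trans _ hk) // expn_gt0.
have [a1 a2] := lg _ hn; have [b1 b2] := lg _ hm.
exact: H a1 b1 a2 b2.
Qed.

End PartA.

(** * Sine waves *)

Section Waves.
Variable R : realType.
Implicit Types (N t q i : nat) (u v : R).

Definition freq N : R := 2 * pi * 2 ^+ N.
Definition wave N u : R := sin (freq N * u).

Lemma freq_gt0 N : 0 < freq N.
Proof. by rewrite /freq mulr_gt0 ?exprn_gt0 // mulr_gt0 // pi_gt0. Qed.

Lemma norm_wave N u : `|wave N u| <= 1.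
Proof. exact: sin_max. Qed.

Lemma sin_lip u v : `|sin u - sin v| <= `|u - v|.
Proof.
wlog uv : u v / u <= v.
  move=> H; have [h|/ltW h] := leP u v; first exact: H.
  by rewrite distrC [leRHS]distrC; exact: H.
have d (z : R) : z \in `]u, v[%R -> is_derive z 1 (@sin R) (cos z).
  by move=> _; exact: is_derive_sin.
have [|c _ E] := MVT_segment uv d.
  by apply: continuous_subspaceT => z; exact: continuous_sin.
by rewrite distrC E normrM [leRHS]distrC ler_piMl // cos_max.
Qed.

Lemma wave_lip N u v : `|wave N u - wave N v| <= freq N * `|u - v|.
Proof.
apply: le_trans (sin_lip _ _) _.
by rewrite -mulrBr normrM (gtr0_norm (freq_gt0 N)).
Qed.

Lemma wave0 N : wave N 0 = 0.
Proof. by rewrite /wave mulr0 sin0. Qed.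

Lemma continuous_wave N : continuous (wave N).
Proof.
move=> u; apply: (@continuous_comp _ _ _ (fun u => freq N * u) (@sin R)).
  by apply: continuousM; [exact: cst_continuous|exact: id].
exact: continuous_sin.
Qed.

Lemma bdd1_wave N : bdd1 (wave N).
Proof.
split; last by exists 1 => s _; exact: norm_wave.
apply: measurable_funTS; apply: continuous_measurable_fun; exact: continuous_wave.
Qed.

Lemma cos_natpi q : cos (pi * q%:R) = (-1) ^+ q :> R.
Proof.
elim: q => [|q IH]; first by rewrite mulr0 cos0 expr0.
by rewrite -natr1 mulrDr mulr1 cosDpi IH exprS mulN1r.
Qed.

(** A cell of generation N + 1 is half a period. *)
Lemma int_wave_cell N q :
  \int[@lebesgue_measure R]_(u in dcell N.+1 q) wave N u = (-1) ^+ q / (pi * 2 ^+ N).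
Proof.
pose F u : R := - cos (freq N * u) / freq N.
set a : R := q%:R / 2 ^+ N.+1; set b : R := q.+1%:R / 2 ^+ N.+1.
have ab : a < b by rewrite ltr_pM2r ?invr_gt0 ?exprn_gt0 // ltr_nat.
have f0 : freq N != 0 by rewrite gt_eqF // freq_gt0.
have dF u : is_derive u 1 F (wave N u).
  rewrite /F /wave.
  apply: is_derive_eq.
  rewrite /GRing.scale /= !(mulr0, add0r, addr0, mulr1).
  by field.
have cF : continuous F.
  move=> u; apply: differentiable_continuous; apply/derivable1_diffP.
  by apply: ex_derive.
have E := @continuous_FTC2 R (wave N) F a b ab.
have {}E : (\int[@lebesgue_measure R]_(x in `[a, b]) (wave N x)%:E = (F b)%:E - (F a)%:E)%E.
  apply: E.
  - by apply: continuous_subspaceT; exact: continuous_wave.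
  - split; first by move=> u _; apply: ex_derive.
    + by apply: cvg_at_right_filter; exact: cF.
    + by apply: cvg_at_left_filter; exact: cF.
  - by move=> u _; rewrite derive1E; apply: derive_val.
have fin : (@lebesgue_measure R `[a, b[%classic < +oo)%E.
  by rewrite lebesgue_measure_itv /= lte_fin ab -EFinB ltry.
rewrite /dcell -/a -/b Rintegral_itv_bndo_bndc; last first.
  apply: measurable_bounded_integrable.
  - exact: measurable_itv.
  - exact: fin.
  - by apply: measurable_funTS; apply: continuous_measurable_fun; exact: continuous_wave.
  - exists 1; split; first exact: num_real.
    by move=> z z1 s _ /=; rewrite (le_trans (norm_wave _ _)) // ltW.
rewrite /Rintegral E /=.
have arg (k : nat) : freq N * (k%:R / 2 ^+ N.+1) = pi * k%:R.
  by rewrite /freq exprS; field; rewrite expf_neq0.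
rewrite /F /a /b !arg !cos_natpi exprS /freq.
have pi0 : pi != 0 :> R by rewrite gt_eqF // pi_gt0.
have p0 : 2 ^+ N != 0 :> R by rewrite expf_neq0.
by move: (pi) pi0 => P P0; field; rewrite p0 P0.
Qed.

Lemma xcell0 t i : (i < 2 ^ t)%N -> xcell 0 t i = @dcell R t i.
Proof.
move=> it; have [q E] := xcell_dcell (0 : R) it.
have [s hs] : exists s : R, xcell 0 t i s.
  exists (q%:R / 2 ^+ t); rewrite E /dcell /= in_itv /= lexx /=.
  by rewrite ltr_pM2r ?invr_gt0 ?exprn_gt0 // ltr_nat.
have [sI rs] := hs; have := dcell_rank0 t sI; rewrite rs => h1.
rewrite E; congr dcell; move: hs; rewrite E => h2.
by move: h1 h2; rewrite !dcell_floor => -> [].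
Qed.

Lemma int1_wave_rank N (G : nat -> R) :
  int1 (fun s => wave N s * G (rank 0 s N.+1)) =
  \sum_(q < 2 ^ N) (G q.*2 - G q.*2.+1) / (pi * 2 ^+ N).
Proof.
have bG i : bdd1 (fun s : R => wave N s * (rank 0 s N.+1 == i)%:R).
  by apply: bdd1M; [exact: bdd1_wave|exact: bdd1_rank1].
rewrite (@eq_int1 _ _ (fun s => \sum_(i < 2 ^ N.+1) G i * (wave N s * (rank 0 s N.+1 == i)%:R))).
  rewrite int1_sum; last by move=> i; apply: bdd1M => //; exact: bdd1_cst.
  rewrite (eq_bigr (fun i : 'I_(2 ^ N.+1) => G i * ((-1) ^+ i / (pi * 2 ^+ N)))).
    rewrite (_ : (2 ^ N.+1 = (2 ^ N).*2)%N); last by rewrite expnS mul2n.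
    rewrite (sum_ord_double (fun i => G i * ((-1) ^+ i / (pi * 2 ^+ N)))).
    apply: eq_bigr => q _; rewrite exprS -mul2n exprM sqrrN expr1n expr1n; ring.
  move=> i _; rewrite int1Z //; congr (_ * _).
  rewrite -int_wave_cell -xcell0 //.
  have -> : xcell 0 N.+1 i = (unitI : set R) `&` xcell 0 N.+1 i.
    by rewrite setIidr // => s [].
  rewrite Rintegral_mkcondr; apply: eq_Rintegral => s /set_mem sI.
  by rewrite rank_indicE // indicE /patch; case: (_ \in _); rewrite ?mulr1 ?mulr0.
by move=> s _; rewrite {1}(rank_sum 0 N.+1 G) mulr_sumr; apply: eq_bigr => i _; ring.
Qed.

(** For i < 2^N the Walsh function is constant on the cells of generation N, each of
    which is a period of the wave. *)
Lemma wave_walsh_low N i : (i < 2 ^ N)%N -> int1 (fun s => wave N s * walsh i s) = 0.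
Proof.
move=> iN; pose G r : R := wprod (rsign R N r./2) i.
rewrite (@eq_int1 _ _ (fun s => wave N s * G (rank 0 s N.+1))).
  by rewrite int1_wave_rank big1 // => q _; rewrite /G doubleK /= uphalf_double subrr mul0r.
by move=> s sI; rewrite /G rank_half -walsh_rank.
Qed.

(** The wave has the sign of the Rademacher function of index N. *)
Lemma wave_walsh_top N : int1 (fun s => wave N s * walsh (2 ^ N) s) = 2 / pi.
Proof.
pose G r : R := (-1) ^+ odd r.
rewrite (@eq_int1 _ _ (fun s => wave N s * G (rank 0 s N.+1))).
  rewrite int1_wave_rank (eq_bigr (fun=> 2 / (pi * 2 ^+ N))).
    rewrite sumr_const card_ord -[LHS]mulr_natr natrX.
    have pi0 : pi != 0 :> R by rewrite gt_eqF // pi_gt0.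
    have p0 : 2 ^+ N != 0 :> R by rewrite expf_neq0.
    by move: (pi) pi0 => P P0; field; rewrite p0 P0.
  by move=> q _; rewrite /G oddS odd_double /= expr0 expr1 opprK.
by move=> s sI; rewrite walshE wprod_pow rademacherE // /G rank_odd dyadic_digit0 addbF.
Qed.

End Waves.

(** * Upper bounds for sharp variations *)

Section VariationBounds.
Variable R : realType.
Implicit Types (lam : nat -> R) (F G : R * R -> R) (B : R) (c : collection R).

(** Bounding the finite partial sums bounds [sharpV1], and this form passes to limits
    of functions. *)
Definition var1_le lam F B :=
  forall c (y : nat -> R) (r : seq nat), @Omega R c -> range y `<=` unitI ->
    uniq r -> (forall i, i \in r -> idx c i) ->
    \sum_(i <- r) `|F (rgt c i, y i) - F (lft c i, y i)| / lam i <= B.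

Lemma sharpV1_le lam F B : var1_le lam F B -> (sharpV1 lam F <= B%:E)%E.
Proof.
move=> H; apply: ge_ereal_sup => _ [y yI <-]; apply: ge_ereal_sup => _ [c cO <-].
apply: ge_ereal_sup => _ [A [fA Ac] <-].
rewrite (fsbig_finite _ _ fA) /= sumEFin lee_fin; apply: H => //.
  exact: finmap.fset_uniq.
by move=> i; rewrite in_fset_set // => /set_mem/Ac.
Qed.

Lemma sharpV1_ge0 lam F : (0 <= sharpV1 lam F)%E.
Proof.
pose c := @Collection R set0 (fun=> 0) (fun=> 0).
have cO : @Omega R c.
  split => //.
  by right; exists 0%N; apply/seteqP; split.
apply: le_trans (ereal_sup_ubound _); last first.
  by exists (fun=> 0); [move=> _ [_ _ <-]; exact: unitI0|reflexivity].
apply: le_trans (ereal_sup_ubound _); last by exists c; [exact: cO|reflexivity].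
by rewrite esum_set0.
Qed.

Lemma total_length c (r : seq nat) : @Omega R c -> uniq r -> (forall i, i \in r -> idx c i) ->
  \sum_(i <- r) (rgt c i - lft c i) <= 1.
Proof.
move=> [_ cI ct] ur rc; rewrite -lee_fin -sumEFin.
pose J i : set R := `]lft c i, rgt c i[%classic.
have E i : i \in r -> (rgt c i - lft c i)%:E = @lebesgue_measure R (J i).
  move=> ir; have [_ _ h] := cI _ (rc _ ir).
  by rewrite /J lebesgue_measure_itv /= lte_fin h EFinB.
rewrite (eq_big_seq _ E) fsbig_seq //.
rewrite -(@measure_fin_bigcup _ _ _ (@lebesgue_measure R) _ [set` r] J).
- rewrite -(mu_unitI R); apply: le_measure.
  + rewrite inE; apply: fin_bigcup_measurable; [exact: finite_seq|by move=> i _; exact: measurable_itv].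
  + by rewrite inE; exact: measurable_unitI.
  + move=> s [i /= ir]; have [a b _] := cI _ (rc _ ir); move: a b.
    rewrite /J /unitI /= !in_itv /= => /andP[a _] /andP[_ b] /andP[h1 h2].
    by apply/andP; split; [exact: ltW (le_lt_trans a h1)|exact: lt_trans h2 b].
- exact: finite_seq.
- by apply: sub_trivIset ct => i /= ir; exact: rc.
- by move=> i _; exact: measurable_itv.
Qed.

Lemma var1_le_add lam F G B B' : (forall k, 0 < lam k) -> var1_le lam F B -> var1_le lam G B' ->
  var1_le lam (fun p => F p + G p) (B + B').
Proof.
move=> l0 HF HG c y r cO yI ur rc.
apply: le_trans (lerD (HF c y r cO yI ur rc) (HG c y r cO yI ur rc)).
rewrite -big_split /=; apply: ler_sum => i _; rewrite -mulrDl.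
rewrite ler_pM2r ?invr_gt0 // opprD addrACA; exact: ler_normD.
Qed.

Lemma var1_le_sum lam (I : Type) (s : seq I) (F : I -> R * R -> R) (B : I -> R) :
  (forall k, 0 < lam k) -> (forall i, var1_le lam (F i) (B i)) ->
  var1_le lam (fun p => \sum_(i <- s) F i p) (\sum_(i <- s) B i).
Proof.
move=> l0 H; elim: s => [|i s IH].
  rewrite big_nil => c y r _ _ _ _; rewrite big1 // => j _.
  by rewrite !big_nil subrr normr0 mul0r.
rewrite big_cons; have := var1_le_add l0 (H i) IH.
by congr var1_le; apply/funext => p; rewrite big_cons.
Qed.

Lemma var1_le_widen lam F B B' : B <= B' -> var1_le lam F B -> var1_le lam F B'.
Proof. by move=> h H c y r a b d e; apply: le_trans (H c y r a b d e) h. Qed.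

Lemma var1_le_approx lam F B (G : nat -> R * R -> R) (d : nat -> R) :
  (forall k, 0 < lam k) -> d n @[n --> \oo] --> 0 ->
  (forall n p, unitI2 p -> `|F p - G n p| <= d n) ->
  (forall n, var1_le lam (G n) B) -> var1_le lam F B.
Proof.
move=> l0 d0 H HG c y r cO yI ur rc; apply/ler_addgt0Pr => e e0.
pose W := \sum_(i <- r) 2 / lam i.
have W0 : 0 <= W by apply: sumr_ge0 => i _; rewrite divr_ge0 // ltW.
have e1 : 0 < e / (W + 1) by rewrite divr_gt0 //; lra.
have /cvgr0Pnorm_lt /(_ _ e1) [n _ /(_ n (leqnn _)) hn] := d0.
apply: le_trans (_ : \sum_(i <- r) (`|G n (rgt c i, y i) - G n (lft c i, y i)| / lam i +
   d n * (2 / lam i)) <= _).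
  rewrite big_seq [leRHS]big_seq; apply: ler_sum => i ir.
  have [_ cI _] := cO; have [aI bI _] := cI _ (rc _ ir).
  have yiI : unitI (y i) by apply: yI; exists i.
  rewrite mulrA -mulrDl ler_pM2r ?invr_gt0 //.
  have h1 := H n (rgt c i, y i) (conj bI yiI).
  have h2 := H n (lft c i, y i) (conj aI yiI).
  rewrite distrC in h2.
  have -> : F (rgt c i, y i) - F (lft c i, y i) =
    (F (rgt c i, y i) - G n (rgt c i, y i)) +
    (G n (rgt c i, y i) - G n (lft c i, y i)) +
    (G n (lft c i, y i) - F (lft c i, y i)) by ring.
  apply: le_trans (ler_normD _ _) _; apply: le_trans (lerD (ler_normD _ _) (lexx _)) _.
  lra.
rewrite big_split /= -mulr_sumr -/W; apply: lerD; first exact: HG.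
have : d n * W <= `|d n| * W by rewrite ler_wpM2r // ler_norm.
move/le_trans; apply; apply: le_trans (ler_wpM2r W0 (ltW hn)) _.
rewrite mulrAC ler_pdivrMr; last by lra.
by rewrite ler_wpM2l ?(ltW e0) //; lra.
Qed.

Definition lip1 F L := forall s s' u, unitI s -> unitI s' -> unitI u ->
  `|F (s, u) - F (s', u)| <= L * `|s - s'|.

Lemma var1_le_lip lam F L l0 : 0 <= L -> 0 < l0 -> (forall k, l0 <= lam k) -> lip1 F L ->
  var1_le lam F (L / l0).
Proof.
move=> L0 hl H HF c y r cO yI ur rc.
have := total_length cO ur rc => tl.
apply: le_trans (_ : \sum_(i <- r) (L / l0) * (rgt c i - lft c i) <= _); last first.
  by rewrite -mulr_sumr -[leRHS]mulr1 ler_wpM2l // divr_ge0 // ltW.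
rewrite big_seq [leRHS]big_seq; apply: ler_sum => i ir.
have [_ cI _] := cO; have [aI bI ab] := cI _ (rc _ ir).
have yiI : unitI (y i) by apply: yI; exists i.
have h0 : 0 <= rgt c i - lft c i by rewrite subr_ge0 ltW.
have := HF _ _ _ bI aI yiI; rewrite (ger0_norm h0) => h.
rewrite mulrAC; apply: ler_pM => //; first by rewrite invr_ge0 (le_trans (ltW hl)).
by rewrite lef_pV2 ?posrE // (lt_le_trans hl).
Qed.

(** The first m intervals contribute at most 2 a each. For the others the weights are
    at most that of index m, and the increments add up to at most L. *)
Lemma var1_le_osc lam F L a m : 0 <= L -> 0 <= a -> (forall k, 0 < lam k) ->
  nondecreasing_seq lam -> lip1 F L ->
  (forall p, unitI2 p -> `|F p| <= a) -> L <= 8 * a * m%:R ->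
  var1_le lam F (10 * a * \sum_(i < m) (lam i)^-1).
Proof.
move=> L0 a0 l0 ld HL Ha Lm c y r cO yI ur rc.
have [_ cI _] := cO.
set W := \sum_(i < m) _.
have W0 : 0 <= W by apply: sumr_ge0 => i _; rewrite invr_ge0 ltW.
have mW : m%:R / lam m <= W.
  rewrite -[X in X%:R / _](card_ord m) mulr_natl -sumr_const; apply: ler_sum => i _.
  by rewrite lef_pV2 ?posrE // ld // ltnW.
rewrite (bigID (fun i => (i < m)%N)) /=.
have part1 : \sum_(i <- r | (i < m)%N) `|F (rgt c i, y i) - F (lft c i, y i)| / lam i <= 2 * a * W.
  apply: le_trans (_ : \sum_(i <- [seq i <- r | (i < m)%N]) 2 * a * (lam i)^-1 <= _).
    rewrite big_filter big_seq_cond [leRHS]big_seq_cond; apply: ler_sum => i /andP[ir _].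
    have [aI bI ab] := cI _ (rc _ ir).
    have yiI : unitI (y i) by apply: yI; exists i.
    rewrite ler_pM2r ?invr_gt0 //; apply: le_trans (ler_normB _ _) _.
    have := Ha (rgt c i, y i) (conj bI yiI); have := Ha (lft c i, y i) (conj aI yiI); lra.
  rewrite -mulr_sumr ler_wpM2l ?mulr_ge0 // /W -(big_mkord xpredT (fun i => (lam i)^-1)).
  rewrite (@bigID _ _ _ _ (index_iota 0 m) (fun i => i \in r)) /=.
  rewrite -[X in X + _](big_filter (index_iota 0 m) (fun i => i \in r)).
  apply: le_trans (_ : \sum_(i <- [seq i <- index_iota 0 m | i \in r]) (lam i)^-1 <= _).
    rewrite (perm_big [seq i <- index_iota 0 m | i \in r]) //.
    apply: uniq_perm; rewrite ?filter_uniq ?iota_uniq //.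
    by move=> i; rewrite !mem_filter mem_index_iota /= andbC.
  by rewrite lerDl sumr_ge0 // => i _; rewrite invr_ge0 ltW.
have part2 : \sum_(i <- r | ~~ (i < m)%N) `|F (rgt c i, y i) - F (lft c i, y i)| / lam i <= 8 * a * W.
  apply: le_trans (_ : \sum_(i <- r) (L / lam m) * (rgt c i - lft c i) <= _).
    rewrite big_mkcond big_seq [leRHS]big_seq; apply: ler_sum => i ir.
    have [aI bI ab] := cI _ (rc _ ir).
    have yiI : unitI (y i) by apply: yI; exists i.
    have h0 : 0 <= rgt c i - lft c i by rewrite subr_ge0 ltW.
    case: ltnP => im /=; first by rewrite mulr_ge0 // divr_ge0 // ltW.
    have := HL _ _ _ bI aI yiI; rewrite (ger0_norm h0) => h.
    rewrite mulrAC; apply: ler_pM => //; first by rewrite invr_ge0 ltW.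
    by rewrite lef_pV2 ?posrE // ld.
  rewrite -mulr_sumr; apply: le_trans (_ : L / lam m <= _).
    rewrite -[leRHS]mulr1 ler_wpM2l //; first by rewrite divr_ge0 // ltW.
    exact: total_length.
  apply: le_trans (_ : 8 * a * m%:R / lam m <= _).
    by rewrite ler_pM2r // invr_gt0.
  by rewrite -mulrA ler_wpM2l // mulr_ge0.
apply: le_trans (lerD part1 part2) _; lra.
Qed.

End VariationBounds.

(** * Single oscillations *)

Section Ripples.
Variables (R : realType) (al be : R).
Hypotheses (hal : 0 < al < 1) (hbe : 0 < be < 1) (hab : al + be < 1).
Implicit Types (N n k : nat) (c : R) (g h : R * R -> R).

Definition ripple c N (p : R * R) : R := c * (wave N p.1 * wave N p.2).

Lemma bdd2_ripple c N : bdd2 (ripple c N).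
Proof.
apply: bdd2M; first exact: bdd2_cst.
by apply: bdd2M; [apply: bdd2_fst|apply: bdd2_snd]; exact: bdd1_wave.
Qed.

Lemma norm_ripple c N p : 0 <= c -> `|ripple c N p| <= c.
Proof.
move=> c0; rewrite /ripple normrM (ger0_norm c0) ler_piMr // normrM.
by rewrite -[leRHS]mulr1; apply: ler_pM => //; exact: norm_wave.
Qed.

Lemma ripple_swap c N p : ripple c N (p.2, p.1) = ripple c N p.
Proof. by rewrite /ripple /= [wave N p.2 * _]mulrC. Qed.

Lemma ripple_lip c N : 0 <= c -> lip1 (ripple c N) (c * freq R N).
Proof.
move=> c0 s s' u _ _ _; rewrite /ripple /= -mulrBr -mulrBl normrM (ger0_norm c0) -mulrA.
rewrite ler_wpM2l // normrM -[leRHS]mulr1; apply: ler_pM => //; first exact: wave_lip.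
exact: norm_wave.
Qed.

Lemma continuous_ripple c N : continuous (ripple c N).
Proof.
move=> p; apply: cvgM; first exact: cvg_cst.
apply: cvgM.
- apply: (@cvg_comp _ _ _ fst (wave N) (nbhs p) (nbhs p.1)); last exact: continuous_wave.
  by case: p => u v; exact: cvg_fst.
- apply: (@cvg_comp _ _ _ snd (wave N) (nbhs p) (nbhs p.2)); last exact: continuous_wave.
  by case: p => u v; exact: cvg_snd.
Qed.

Lemma ripple_origin c N : ripple c N (0, 0) = 0.
Proof. by rewrite /ripple /= wave0 !mulr0. Qed.

Lemma freq_le N : freq R N <= 8 * (2 ^ N)%:R.
Proof.
rewrite natrX /freq ler_pM2r ?exprn_gt0 //.
have /andP[_ h] := (@pihalf_02_cos_pihalf R).1; lra.
Qed.

Lemma ripple_var1 (lam : nat -> R) c N : 0 <= c -> (forall k, 0 < lam k) ->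
  nondecreasing_seq lam ->
  var1_le lam (ripple c N) (10 * c * \sum_(i < 2 ^ N) (lam i)^-1).
Proof.
move=> c0 l0 ld; apply: (@var1_le_osc _ lam (ripple c N) (c * freq R N)) => //.
- by rewrite mulr_ge0 // ltW // freq_gt0.
- exact: ripple_lip.
- by move=> p _; exact: norm_ripple.
- by rewrite mulrAC [leRHS]mulrC; apply: ler_wpM2l => //; exact: freq_le.
Qed.

Let s := al + be.

(** Among the Walsh functions of index at most 2^N only the last one correlates with
    the wave, and its multiplier is the reciprocal of the Cesaro number. *)
Lemma int1_wave_kern a N : 0 < a < 1 ->
  int1 (fun u => wave N u * kern a (2 ^ N).+1 0 u) = 2 / pi / cesaroA (- a) (2 ^ N) :> R.
Proof.
move=> ha.
have bw j : bdd1 (fun u : R => wave N u * walsh j u).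
  by apply: bdd1M; [exact: bdd1_wave|exact: bdd1_walsh].
rewrite (@eq_int1 _ _ (fun u => \sum_(j < (2 ^ N).+1) cesaro_mult a (2 ^ N).+1 j * (wave N u * walsh j u))).
  rewrite int1_sum; last by move=> j; apply: bdd1M => //; exact: bdd1_cst.
  rewrite big_ord_recr /= big1 ?add0r.
    rewrite int1Z // wave_walsh_top /cesaro_mult ltnSn subnn cesaroA0 mul1r mulrC.
    by [].
  by move=> j _; rewrite int1Z // wave_walsh_low ?mulr0.
move=> u _; rewrite /kern mulr_sumr; apply: eq_bigr => j _.
by rewrite walsh_at0 mul1r mulrCA.
Qed.

Lemma ripple_mean c N :
  cesaro_mean (- al) (- be) (2 ^ N).+1 (2 ^ N).+1 0 0 (ripple c N) =
  c * ((2 / pi) ^+ 2 / (cesaroA (- al) (2 ^ N) * cesaroA (- be) (2 ^ N))).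
Proof.
have bwk (a : R) : bdd1 (fun u => wave N u * kern a (2 ^ N).+1 0 u).
  by apply: bdd1M; [exact: bdd1_wave|apply: bdd1_kern; exact: unitI0].
rewrite cesaro_mean_int //; last exact: bdd2_ripple.
rewrite (@eq_int2 _ _ (fun p => c * ((wave N p.1 * kern al (2 ^ N).+1 0 p.1) *
   (wave N p.2 * kern be (2 ^ N).+1 0 p.2)))); last by move=> p _; rewrite /ripple; ring.
rewrite int2Z; last by apply: bdd2M; [exact: (bdd2_fst (bwk al))|exact: (bdd2_snd (bwk be))].
rewrite (int2_prod (bwk al) (bwk be)) !int1_wave_kern // (invfM (cesaroA (- al) _)); congr (_ * _).
by move: (2 / pi) => q; rewrite expr2 mulrACA.
Qed.

Lemma pow2_pw N : (2 ^ N)%:R `^ s * pw s (2 ^ N).-1 = 1 :> R.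
Proof.
rewrite /pw prednK ?expn_gt0 // -powRD ?subrr ?powRr0 //.
by apply/implyP => _; rewrite gt_eqF // ltr0n expn_gt0.
Qed.

(** The Cesaro numbers of index 2^N are at most 2^(-N al) and 2^(-N be), which
    compensates the amplitude 2^(-N (al + be)). *)
Lemma ripple_mean_ge N b : 0 <= b ->
  b * (2 / pi) ^+ 2 <= cesaro_mean (- al) (- be) (2 ^ N).+1 (2 ^ N).+1 0 0
    (ripple (b * pw s (2 ^ N).-1) N).
Proof.
move=> b0; rewrite ripple_mean.
have P0 : 0 <= (2 / pi) ^+ 2 :> R by rewrite sqr_ge0.
have M0 : (0:R) < (2 ^ N)%:R by rewrite ltr0n expn_gt0.
have inv a : 0 < a < 1 -> (2 ^ N)%:R `^ a <= (cesaroA (- a) (2 ^ N))^-1.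
  move=> ha; apply: le_trans (_ : (pw a (2 ^ N))^-1 <= _).
    rewrite /pw powRN invrK; apply: ge0_ler_powR; rewrite ?nnegrE //; first lra.
    by rewrite ler_nat.
  by rewrite lef_pV2 ?posrE ?pw_gt0 ?cesaroN_gt0 // cesaroN_le_pw.
have H : (2 ^ N)%:R `^ s <= (cesaroA (- al) (2 ^ N) * cesaroA (- be) (2 ^ N))^-1.
  rewrite /s powRD; last by apply/implyP => _; rewrite gt_eqF.
  by rewrite (invfM (cesaroA (- al) _)); apply: ler_pM; rewrite ?powR_ge0 // inv.
move: ((2 / pi) ^+ 2) P0 => q q0.
have -> : b * pw s (2 ^ N).-1 * (q / (cesaroA (- al) (2 ^ N) * cesaroA (- be) (2 ^ N))) =
    b * q * (pw s (2 ^ N).-1 / (cesaroA (- al) (2 ^ N) * cesaroA (- be) (2 ^ N))).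
  by rewrite mulrACA [RHS]mulrA -[RHS]mulrA.
rewrite ler_peMr ?mulr_ge0 //.
by apply: le_trans (ler_wpM2l (pw_ge0 s (2 ^ N).-1) H); rewrite mulrC pow2_pw.
Qed.

(** A product of one-dimensional Lebesgue constants at the origin. *)
Definition lebesgue_const n : R :=
  int1 (fun u => `|kern al n 0 u|) * int1 (fun u => `|kern be n 0 u|).

Lemma lebesgue_const_ge0 n : 0 <= lebesgue_const n.
Proof. by rewrite mulr_ge0 //; apply: Rintegral_ge0 => u _. Qed.

Lemma cesaro_crude g M n : (0 < n)%N -> bdd2 g -> 0 <= M ->
  (forall p, unitI2 p -> `|g p| <= M) ->
  `|cesaro_mean (- al) (- be) n n 0 0 g| <= M * lebesgue_const n.
Proof.
move=> n0 bg M0 gM; rewrite cesaro_mean_int //.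
have b1 : bdd1 (kern al n 0) by apply: bdd1_kern; exact: unitI0.
have b2 : bdd1 (kern be n 0) by apply: bdd1_kern; exact: unitI0.
apply: int2_bound => //.
  apply: bdd2M => //; apply: bdd2M; [exact: (bdd2_fst b1)|exact: (bdd2_snd b2)].
by move=> p pI; rewrite normrM normrM ler_wpM2r ?mulr_ge0 // gM.
Qed.

Lemma cesaro_meanD g h n : (0 < n)%N -> bdd2 g -> bdd2 h ->
  cesaro_mean (- al) (- be) n n 0 0 (fun p => g p + h p) =
  cesaro_mean (- al) (- be) n n 0 0 g + cesaro_mean (- al) (- be) n n 0 0 h.
Proof.
move=> n0 bg bh; rewrite !cesaro_mean_int //; last exact: bdd2D.
have bk : bdd2 (fun p : R * R => kern al n 0 p.1 * kern be n 0 p.2).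
  by apply: bdd2M; [apply: bdd2_fst|apply: bdd2_snd]; apply: bdd1_kern; exact: unitI0.
rewrite -int2D; [|exact: bdd2M..].
by apply: eq_int2 => p _; rewrite mulrDl.
Qed.

Lemma cesaro_mean_sum n K (g : nat -> R * R -> R) : (0 < n)%N -> (forall k, bdd2 (g k)) ->
  cesaro_mean (- al) (- be) n n 0 0 (fun p => \sum_(k < K) g k p) =
  \sum_(k < K) cesaro_mean (- al) (- be) n n 0 0 (g k).
Proof.
move=> n0 bg; elim: K => [|K IH].
  rewrite big_ord0; apply/eqP; rewrite -normr_le0.
  have := @cesaro_crude (fun p => \sum_(k < 0) g k p) 0 n n0.
  rewrite mul0r; apply => //; first by apply: bdd2_sum.
  by move=> p _; rewrite big_ord0 normr0.
rewrite big_ord_recr /= -IH -cesaro_meanD //; last exact: bdd2_sum.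
by congr cesaro_mean; apply/funext => p; rewrite big_ord_recr.
Qed.

(** A ripple is Lipschitz, hence of bounded sharp variation, and vanishes at the
    origin: the convergence theorem applies. *)
Lemma ripple_decay c N (e : R) : 0 <= c -> 0 < e -> exists N0, forall n, (2 ^ N0 <= n)%N ->
  `|cesaro_mean (- al) (- be) n n 0 0 (ripple c N)| <= e.
Proof.
move=> c0 e0.
pose lam : nat -> R := fun k => k.+1%:R `^ (1 - (al + be)).
have bv : sharpBV lam (ripple c N).
  have [mc _] := bdd2_ripple c N; split => //.
  have V : (sharpV1 lam (ripple c N) <= (c * freq R N / 1)%:E)%E.
    apply: sharpV1_le; apply: var1_le_lip => //.
    - by rewrite mulr_ge0 // ltW // freq_gt0.
    - move=> k; have e1 : 1 `^ (1 - (al + be)) = 1 :> R by rewrite powR1.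
      rewrite -[leLHS]e1; apply: ge0_ler_powR; rewrite ?nnegrE ?ler1n //.
      by have := hab; lra.
    - exact: ripple_lip.
  have V2 : (sharpV2 lam (ripple c N) <= (c * freq R N / 1)%:E)%E.
    rewrite (_ : sharpV2 _ _ = sharpV1 lam
       (fun p => ripple c N (p.2, p.1))) //.
    by rewrite (_ : (fun p => ripple c N (p.2, p.1)) = ripple c N) //; apply/funext => p; rewrite ripple_swap.
  by apply: le_lt_trans (leeD V V2) _; rewrite -EFinD ltry.
have cont : dyadic_continuous_at (ripple c N) 0 0.
  apply/cvgrPdist_le => e' e'0.
  have /cvgrPdist_le /(_ e' e'0) H := @continuous_ripple c N (0, 0).
  apply: filterS H => -[h k] /= H [[/= hI kI] _].
  by rewrite !dyadic_add0.
have [N0 H] := cesaro_near hal hbe hab (unitI0 R) (unitI0 R) bv cont e0.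
exists N0 => n hn.
have lg : (N0 <= trunc_log 2 n)%N by exact: trunc_log_max.
have lg2 : (2 ^ trunc_log 2 n <= n < 2 ^ (trunc_log 2 n).+1)%N.
  by rewrite trunc_log_ltn // andbT trunc_logP // (leq_trans _ hn) // expn_gt0.
by have := H _ _ _ _ lg lg lg2 lg2; rewrite ripple_origin subr0.
Qed.

(** The average of the reciprocals of xi with weights (i+1)^-(1-s) tends to 0. *)
Lemma weighted_average (xi : nat -> R) (e : R) : (forall k, 0 < xi k) ->
  nondecreasing_seq xi -> xi k @[k --> \oo] --> +oo -> 0 < e ->
  exists k0, forall k, (k0 <= k)%N ->
    pw s k * \sum_(i < k.+1) (i.+1%:R `^ (1 - s) * xi i)^-1 <= e.
Proof.
move=> x0 xd /cvgryPge xoo e0.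
have s0 : 0 < s < 1 by rewrite /s; have := hab; have := hal; have := hbe; lra.
have s1 : 0 < 1 - s < 1 by lra.
pose e1 := e * s / 2.
have e10 : 0 < e1 by rewrite divr_gt0 // mulr_gt0 //; lra.
have [i0 _ Hi0] := xoo e1^-1.
pose C := \sum_(i < i0) (i.+1%:R `^ (1 - s) * xi i)^-1.
have t0 i : 0 < i.+1%:R `^ (1 - s) * xi i by rewrite mulr_gt0 // powR_gt0.
have C0 : 0 <= C by apply: sumr_ge0 => i _; rewrite invr_ge0 ltW.
have e2 : 0 < e / 2 / (C + 1) by rewrite !divr_gt0 //; lra.
have /cvgr0Pnorm_lt /(_ _ e2) [k0 _ Hk0] := @pw_cvg0 R s (proj1 (andP s0)).
exists k0 => k hk.
have B : \sum_(i < k.+1) (i.+1%:R `^ (1 - s) * xi i)^-1 <= C + e1 * (k.+1%:R `^ s / s).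
  apply: (@le_trans _ _ (\sum_(i < k.+1) ((i < i0)%N%:R * (i.+1%:R `^ (1 - s) * xi i)^-1 +
     e1 * pw (1 - s) i))).
    apply: ler_sum => i _; have p0 := pw_ge0 (1 - s) i.
    case: ltnP => hi.
      by rewrite mul1r lerDl mulr_ge0 // ltW.
    rewrite mul0r add0r invfM pwN mulrC ler_wpM2r //.
    by rewrite -[leRHS]invrK lef_pV2 ?posrE ?invr_gt0 //; exact: Hi0.
  rewrite big_split /=; apply: lerD.
    by apply: (@sum_below R (fun i => (i.+1%:R `^ (1 - s) * xi i)^-1)) => j; rewrite invr_ge0 ltW.
  rewrite -mulr_sumr ler_wpM2l ?(ltW e10) //.
  by have := sum_pw k.+1 s1; rewrite (_ : 1 - (1 - s) = s) //; ring.
apply: le_trans (ler_wpM2l (pw_ge0 s k) B) _; rewrite mulrDr.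
have h1 : pw s k * C <= e / 2.
  have := Hk0 k hk; rewrite /= ger0_norm ?pw_ge0 // => /ltW h.
  apply: le_trans (ler_wpM2r C0 h) _; rewrite mulrAC ler_pdivrMr; last by lra.
  by rewrite ler_wpM2l //; [rewrite divr_ge0 // ltW|lra].
have h2 : pw s k * (e1 * (k.+1%:R `^ s / s)) = e / 2.
  have -> : pw s k * (e1 * (k.+1%:R `^ s / s)) = e1 * s^-1.
    rewrite mulrCA /pw [X in e1 * X = _]mulrA -powRD ?addNr ?powRr0 ?mul1r //.
    by apply/implyP => _; rewrite gt_eqF.
  by rewrite /e1; field; rewrite gt_eqF //; lra.
by rewrite h2; lra.
Qed.

End Ripples.

(** * The gliding hump *)

Section GlidingHump.
Variables (R : realType) (al be : R).
Hypotheses (hal : 0 < al < 1) (hbe : 0 < be < 1) (hab : al + be < 1).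
Variable xi : nat -> R.
Hypotheses (xi0 : forall k, 0 < xi k) (xid : nondecreasing_seq xi)
  (xioo : xi k @[k --> \oo] --> +oo).

Let lam k : R := k.+1%:R `^ (1 - (al + be)) * xi k.
Let s := al + be.
Let mean n f := cesaro_mean (- al) (- be) n n 0 0 f.

Let lam0 k : 0 < lam k. Proof. by rewrite mulr_gt0 // powR_gt0. Qed.

Let lam_nd : nondecreasing_seq lam.
Proof.
move=> m n mn; apply: ler_pM; rewrite ?powR_ge0 ?(ltW (xi0 _)) ?xid //.
by apply: ge0_ler_powR; rewrite ?nnegrE ?ler_nat //; have := hab; lra.
Qed.

Let lam_ge_xi k : xi k <= lam k.
Proof.
rewrite ler_peMl ?(ltW (xi0 _)) //.
have e1 : 1 `^ (1 - (al + be)) = 1 :> R by rewrite powR1.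
rewrite -[leLHS]e1; apply: ge0_ler_powR; rewrite ?nnegrE ?ler1n //; have := hab; lra.
Qed.

Let amp k N : R := 2 ^+ k * pw s (2 ^ N).-1.
Let amp_ge0 k N : 0 <= amp k N. Proof. by rewrite mulr_ge0 ?exprn_ge0 ?pw_ge0. Qed.

(* a nondecreasing majorant of the Lebesgue constants *)
Let D n : R := 1 + \sum_(i < n.+1) lebesgue_const al be i.

Let D_ge1 n : 1 <= D n.
Proof. by rewrite /D lerDl; apply: sumr_ge0 => i _; exact: lebesgue_const_ge0. Qed.

Let D_nd m n : (m <= n)%N -> D m <= D n.
Proof.
move=> mn; rewrite /D lerD2l; apply: (@sum_widen_le R (lebesgue_const al be)) => //.
exact: lebesgue_const_ge0.
Qed.

Let D_const n : lebesgue_const al be n <= D n.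
Proof.
rewrite /D big_ord_recr /= addrA lerDr addr_ge0 //.
by apply: sumr_ge0 => i _; exact: lebesgue_const_ge0.
Qed.

(** The next frequency N' has to be large enough for four purposes: growth,
    negligible amplitude in the means that have already been fixed, small variation,
    and smallness of the means of the present ripple at all later stages. *)
Lemma hump_step k N : exists N',
  [/\ (N < N')%N, amp k.+1 N' * D (2 ^ N).+1 <= 2 ^- k.+1,
      amp k.+1 N' * (\sum_(i < 2 ^ N') (lam i)^-1) <= 2 ^- k.+1 &
      forall n, (2 ^ N' <= n)%N -> `|mean n (ripple (amp k N) N)| <= 2 ^- k].
Proof.
have s0 : 0 < s by rewrite /s; have := hal; have := hbe; lra.
have q0 j : 0 < 2 ^- j :> R by rewrite invr_gt0 exprn_gt0.
have p0 : (0:R) < 2 ^+ k.+1 by rewrite exprn_gt0.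
have D0 : 0 < D (2 ^ N).+1 by apply: lt_le_trans (D_ge1 _).
have e1 : 0 < 2 ^- k.+1 / (2 ^+ k.+1 * D (2 ^ N).+1) by rewrite divr_gt0 // mulr_gt0.
have /cvgr0Pnorm_lt /(_ _ e1) [k1 _ H1] := pw_cvg0 s0.
have [k2 H2] := weighted_average hal hbe hab xi0 xid xioo (divr_gt0 (q0 k.+1) p0).
have [N3 H3] := ripple_decay hal hbe hab N (amp_ge0 k N) (q0 k).
pose N' := (maxn N (maxn k1 (maxn k2 N3))).+1.
have hN' : (N' <= (2 ^ N').-1)%N by rewrite -ltnS prednK ?expn_gt0 // ltn_expl.
have a1 : (N < N')%N by rewrite ltnS leq_max leqnn.
have a2 : (k1 <= (2 ^ N').-1)%N.
  by apply: leq_trans hN'; rewrite leqW // !leq_max leqnn ?orbT.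
have a3 : (k2 <= (2 ^ N').-1)%N.
  by apply: leq_trans hN'; rewrite leqW // !leq_max leqnn ?orbT.
have a4 : (N3 <= N')%N by rewrite leqW // !leq_max leqnn ?orbT.
exists N'; split => //.
- have := H1 _ a2; rewrite /= ger0_norm ?pw_ge0 // => /ltW h.
  rewrite ler_pdivlMr in h; last by rewrite mulr_gt0.
  by rewrite /amp mulrAC [_ * pw _ _]mulrC.
- have := H2 _ a3; rewrite prednK ?expn_gt0 // ler_pdivlMr // => h.
  apply: le_trans h; rewrite le_eqVlt; apply/orP; left; apply/eqP.
  by rewrite /amp -mulrA mulrC.
- by move=> n hn; apply: H3; rewrite (leq_trans _ hn) // leq_exp2l.
Qed.

Lemma hump_sequence : exists Ns : nat -> nat, Ns 0%N = 0%N /\ forall k,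
  [/\ (Ns k < Ns k.+1)%N,
      amp k.+1 (Ns k.+1) * D (2 ^ Ns k).+1 <= 2 ^- k.+1,
      amp k.+1 (Ns k.+1) * (\sum_(i < 2 ^ Ns k.+1) (lam i)^-1) <= 2 ^- k.+1 &
      forall n, (2 ^ Ns k.+1 <= n)%N -> `|mean n (ripple (amp k (Ns k)) (Ns k))| <= 2 ^- k].
Proof.
have [st Hst] := choice (fun p : nat * nat => hump_step p.1 p.2).
pose Ns := fix Ns k := if k is k'.+1 then st (k', Ns k') else 0%N.
by exists Ns; split => // k; exact: (Hst (k, Ns k)).
Qed.

Variable Ns : nat -> nat.
Hypothesis Ns0 : Ns 0%N = 0%N.
Hypothesis HNs : forall k,
  [/\ (Ns k < Ns k.+1)%N,
      amp k.+1 (Ns k.+1) * D (2 ^ Ns k).+1 <= 2 ^- k.+1,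
      amp k.+1 (Ns k.+1) * (\sum_(i < 2 ^ Ns k.+1) (lam i)^-1) <= 2 ^- k.+1 &
      forall n, (2 ^ Ns k.+1 <= n)%N -> `|mean n (ripple (amp k (Ns k)) (Ns k))| <= 2 ^- k].

Let a k := amp k (Ns k).
Let h k := ripple (a k) (Ns k).
Let S J (p : R * R) := \sum_(k < J) h k p.
Definition hump (p : R * R) : R := limn (fun J => \sum_(k < J) ripple (amp k (Ns k)) (Ns k) p).

Let a_ge0 k : 0 <= a k. Proof. exact: amp_ge0. Qed.

Let Ns_mono m n : (m <= n)%N -> (Ns m <= Ns n)%N.
Proof.
elim: n => [|n IH]; first by rewrite leqn0 => /eqP ->.
rewrite leq_eqVlt => /predU1P[->//|mn].
by apply: leq_trans (IH mn) _; have [/ltnW] := HNs n.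
Qed.

Let Ns_ge k : (k <= Ns k)%N.
Proof. by elim: k => // k IH; apply: leq_ltn_trans IH _; have [] := HNs k. Qed.

Let a_later k j : (k < j)%N -> a j * D (2 ^ Ns k).+1 <= 2 ^- j.
Proof.
case: j => // j kj; have [_ H _ _] := HNs j; apply: le_trans H.
by rewrite ler_wpM2l // D_nd // ltnS leq_exp2l // Ns_mono.
Qed.

Let a_le k : a k <= 2 ^- k.
Proof.
case: k => [|k]; first by rewrite /a /amp Ns0 expn0 expr0 mul1r pw0 invr1.
have [_ H _ _] := HNs k; apply: le_trans H.
by rewrite ler_peMr.
Qed.

Let geo J n : \sum_(k < n) 2 ^- (J + k) <= 2 * 2 ^- J :> R.
Proof.
suff -> : \sum_(k < n) 2 ^- (J + k) = 2 * 2 ^- J * (1 - 2 ^- n) :> R.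
  by rewrite ler_piMr ?mulr_ge0 ?invr_ge0 ?exprn_ge0 // gerBl invr_ge0 exprn_ge0.
elim: n => [|n IH]; first by rewrite big_ord0 expr0 invr1 subrr mulr0.
rewrite big_ord_recr /= IH exprD exprS; field.
by rewrite !expf_neq0.
Qed.

Let tail_le J n p : `|S (J + n) p - S J p| <= \sum_(k < n) a (J + k)%N.
Proof.
rewrite /S (sum_ord_addn (fun k => h k p)) addrAC subrr add0r.
apply: le_trans (ler_norm_sum _ _ _) _; apply: ler_sum => k _; exact: norm_ripple.
Qed.

Let tail_le2 J n p : `|S (J + n) p - S J p| <= 2 * 2 ^- J.
Proof.
apply: le_trans (tail_le J n p) _; apply: le_trans (geo J n).
by apply: ler_sum => k _; exact: a_le.
Qed.

Let pow2V_small e : 0 < e -> exists J, 2 * 2 ^- J < e :> R.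
Proof.
move=> e0; have e1 : 0 < e / 2 by rewrite divr_gt0.
have /cvgr0Pnorm_lt /(_ _ e1) [J _ /(_ J (leqnn _))] := @pow2V_cvg0 R.
rewrite /= ger0_norm ?invr_ge0 ?exprn_ge0 // => H; exists J; lra.
Qed.

Let S_cvg p : S J p @[J --> \oo] --> hump p.
Proof.
apply/cauchy_cvgP; apply/cauchy_exP => e e0.
have [J HJ] := pow2V_small e0.
exists (S J p); exists J => // n /= Jn.
by rewrite /ball /= distrC -(subnKC Jn) (le_lt_trans (tail_le2 _ _ _)).
Qed.

Let hump_tail J b p : (forall n, `|S (J + n) p - S J p| <= b) -> `|hump p - S J p| <= b.
Proof.
move=> H; apply/ler_addgt0Pr => e e0.
have /cvgrPdist_lt /(_ e e0) [n _ Hn] := @S_cvg p.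
have := Hn (J + n)%N (leq_addl _ _) => /ltW h1.
have -> : hump p - S J p = (hump p - S (J + n) p) + (S (J + n) p - S J p) by ring.
by apply: le_trans (ler_normD _ _) _; rewrite addrC lerD.
Qed.

Let hump_near J p : `|hump p - S J p| <= 2 * 2 ^- J.
Proof. by apply: hump_tail => n; exact: tail_le2. Qed.

Let bdd2_S J : bdd2 (S J).
Proof. by apply: bdd2_sum => k; exact: bdd2_ripple. Qed.

Let continuous_S J : continuous (S J).
Proof.
move=> p; elim: J => [|J IH].
  rewrite (_ : S 0 = fun=> 0); first exact: cvg_cst.
  by apply/funext => q; rewrite /S big_ord0.
rewrite (_ : S J.+1 = fun q => S J q + h J q).
  by apply: cvgD => //; exact: continuous_ripple.
by apply/funext => q; rewrite /S big_ord_recr.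
Qed.

Lemma continuous_hump : continuous hump.
Proof.
move=> p; apply/cvgrPdist_le => e e0.
have e3 : 0 < e / 3 by rewrite divr_gt0.
have [J HJ] := pow2V_small e3.
have /cvgrPdist_le /(_ _ e3) H := @continuous_S J p.
apply: filterS H => q /= H.
have h1 := hump_near J p; have h2 := hump_near J q; rewrite distrC in h2.
have -> : hump p - hump q = (hump p - S J p) + (S J p - S J q) + (S J q - hump q) by ring.
apply: le_trans (ler_normD _ _) _; apply: le_trans (lerD (ler_normD _ _) (lexx _)) _.
lra.
Qed.

Let measurable_hump : measurable_fun unitI2 hump.
Proof.
have [_ [M HM]] := bdd2_S 0.
apply: (measurable_fun_cvg (h := S)).
- by move=> J; have [] := bdd2_S J.
- by move=> p _; exact: S_cvg.
Qed.

Let bdd2_hump : bdd2 hump.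
Proof.
split; first exact: measurable_hump.
exists 2 => p _; have := hump_near 0 p; rewrite /S big_ord0 subr0 expr0 invr1 mulr1.
exact.
Qed.

Lemma hump_swap p : hump (p.2, p.1) = hump p.
Proof.
rewrite /hump; congr (limn _); apply/funext => J; apply: eq_bigr => k _.
exact: ripple_swap.
Qed.

(* The first J ripples are Lipschitz, and the variation of the others is summably
   small. *)
Let hump_var1_tail e : 0 < e -> exists n0, forall n, (n0 <= n)%N ->
  var1_le (tail n lam) hump e.
Proof.
move=> e0; have e1 : 0 < e / 20 by rewrite divr_gt0.
have [J' HJ'] := pow2V_small e1.
pose J := J'.+1.
have HJ : 2 * 2 ^- J < e / 20 :> R.
  apply: le_lt_trans HJ'; rewrite ler_pM2l // lef_pV2 ?posrE ?exprn_gt0 //.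
  by rewrite ler_eXn2l ?ltr1n.
pose L := \sum_(k < J) a k * freq R (Ns k).
have L0 : 0 <= L by apply: sumr_ge0 => k _; rewrite mulr_ge0 // ltW // freq_gt0.
have [n0 _ Hn0] := (cvgryPge _).1 xioo (2 * (L + 1) / e).
exists n0 => n hn.
have tl0 k : 0 < tail n lam k by exact: lam0.
have xin : 2 * (L + 1) / e <= lam n by apply: le_trans (Hn0 n hn) (lam_ge_xi n).
apply: (@var1_le_approx _ _ _ _ (fun m => S (J + m)) (fun m => 2 * 2 ^- m)) => //.
- rewrite -[X in _ --> X](mulr0 (2 : R)).
  by apply: cvgM; [exact: cvg_cst|exact: pow2V_cvg0].
- move=> m p _; apply: le_trans (hump_near _ _) _; rewrite ler_pM2l //.
  by rewrite lef_pV2 ?posrE ?exprn_gt0 // ler_eXn2l ?ltr1n // leq_addl.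
move=> m.
have B1 : var1_le (tail n lam) (S J) (\sum_(k < J) (a k * freq R (Ns k) / lam n)).
  apply: var1_le_sum => // k; apply: var1_le_lip => //.
  - by rewrite mulr_ge0 // ltW // freq_gt0.
  - by move=> i; rewrite /tail lam_nd // leq_addr.
  - exact: ripple_lip.
have B2 : var1_le (tail n lam) (fun p => \sum_(k < m) h (J + k)%N p)
    (\sum_(k < m) 10 * 2 ^- (J + k)).
  apply: var1_le_sum => // k.
  have td : nondecreasing_seq (tail n lam).
    by move=> i j ij; rewrite /tail lam_nd // leq_add2l.
  apply: var1_le_widen (ripple_var1 _ (a_ge0 _) tl0 td).
  rewrite -mulrA ler_wpM2l //.
  have [_ _ H _] := HNs (J' + k); rewrite /J addSn; apply: le_trans H.
  rewrite ler_wpM2l //; apply: ler_sum => i _.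
  by rewrite lef_pV2 ?posrE // /tail lam_nd // leq_addl.
have -> : S (J + m) = (fun p => S J p + \sum_(k < m) h (J + k)%N p).
  by apply/funext => p; rewrite /S (sum_ord_addn (fun k => h k p)).
apply: var1_le_widen (var1_le_add tl0 B1 B2).
rewrite -mulr_suml -/L -mulr_sumr.
have h1 : L / lam n <= e / 2.
  rewrite ler_pdivrMr //; have e2 : 0 < e / 2 by rewrite divr_gt0.
  apply: le_trans (ler_wpM2l (ltW e2) xin).
  have -> : e / 2 * (2 * (L + 1) / e) = L + 1 by field; rewrite gt_eqF.
  lra.
have := geo J m; lra.
Qed.

Lemma CsharpV_hump : CsharpV lam hump.
Proof.
split; first exact: measurable_hump.
have sw n : sharpV2 (tail n lam) hump = sharpV1 (tail n lam) hump.
  rewrite (_ : sharpV2 _ _ = sharpV1 (tail n lam) (fun p => hump (p.2, p.1))) //.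
  by congr sharpV1; apply/funext => p; exact: hump_swap.
apply/fine_cvgP; split.
  have [n0 H] := hump_var1_tail ltr01; exists n0 => // n /= hn.
  rewrite ge0_fin_numE; last by rewrite adde_ge0 // ?sw sharpV1_ge0.
  have := sharpV1_le (H n hn) => h1; rewrite /sharpV sw.
  by apply: le_lt_trans (leeD h1 h1) _; rewrite -EFinD ltry.
apply/cvgr0Pnorm_le => e e0.
have e2 : 0 < e / 2 by rewrite divr_gt0.
have [n0 H] := hump_var1_tail e2; exists n0 => // n /= hn.
have h1 := sharpV1_le (H n hn); have h2 := sharpV1_ge0 (tail n lam) hump.
rewrite /sharpV sw; case: (sharpV1 _ _) h1 h2 => //= r; rewrite !lee_fin => h1 h2.
by rewrite ger0_norm ?addr_ge0 //; lra.
Qed.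

Let n_ k := (2 ^ Ns k).+1.

(* At stage k the earlier ripples have small means, by the choice of the later
   frequencies; the ripple of index k resonates; the later ones have amplitudes too
   small to matter. *)
Let mean_hump_ge k : 2 ^+ k * (2 / pi) ^+ 2 - 3 <= `|mean (n_ k) hump|.
Proof.
have main := ripple_mean_ge hal hbe (Ns k) (exprn_ge0 k (ler0n R 2)).
rewrite -/(mean (n_ k) _) in main.
pose r (p : R * R) := hump p - S k.+1 p.
have br : bdd2 r.
  apply: bdd2D; first exact: bdd2_hump.
  by apply: bdd2_eq (bdd2M (bdd2_cst (-1)) (bdd2_S k.+1)) => p _; rewrite mulN1r.
have E : mean (n_ k) hump = \sum_(j < k) mean (n_ k) (h j) + mean (n_ k) (h k) + mean (n_ k) r.
  have -> : hump = (fun p => S k.+1 p + r p) by apply/funext => p; rewrite /r addrC subrK.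
  rewrite /mean cesaro_meanD //; congr (_ + _).
  rewrite cesaro_mean_sum //; last by move=> j; exact: bdd2_ripple.
  by rewrite big_ord_recr.
have early : `|\sum_(j < k) mean (n_ k) (h j)| <= 2.
  apply: le_trans (ler_norm_sum _ _ _) _.
  have := geo 0 k; rewrite expr0 invr1 mulr1; apply: le_trans.
  apply: ler_sum => j _; have [_ _ _ H] := HNs j; apply: H.
  by rewrite /n_ leqW // leq_exp2l // Ns_mono.
have late : `|mean (n_ k) r| <= 1.
  have D0 : 0 < D (n_ k) by apply: lt_le_trans (D_ge1 _).
  apply: le_trans (_ : (D (n_ k))^-1 * lebesgue_const al be (n_ k) <= _); last first.
    by rewrite ler_pdivrMl // mulr1 D_const.
  apply: cesaro_crude => //; first by rewrite invr_ge0 ltW.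
  move=> p _; apply: hump_tail => n; apply: le_trans (tail_le _ _ _) _.
  rewrite -[leRHS]mul1r ler_pdivlMr // mulr_suml.
  apply: (@le_trans _ _ (\sum_(j < n) 2 ^- (k.+1 + j))).
    by apply: ler_sum => j _; apply: a_later; rewrite addSn ltnS leq_addr.
  apply: le_trans (geo _ _) _; rewrite exprS invfM mulrA mulfV // mul1r.
  by rewrite invf_le1 ?exprn_gt0 // exprn_ege1 // ler1n.
have := ler_norm (mean (n_ k) hump).
rewrite E; move: early late main; rewrite !ler_norml => /andP[h1 _] /andP[h2 _].
rewrite -/(h k) => h3; apply: le_trans; rewrite -/s -/(amp k (Ns k)) -/(a k) -/(h k) in h3.
lra.
Qed.

Lemma limf_esup_hump :
  limf_esup (fun nm : nat * nat =>
    `|cesaro_mean (- al) (- be) nm.1 nm.2 0 0 hump|%:E) (filter_prod \oo \oo) = +oo%E.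
Proof.
rewrite /limf_esup; apply/ereal_inf_pinfty => _ [A [[U V] /= [[N1 _ H1] [N2 _ H2]] HA] <-].
apply/eqyP => M _.
have q0 : 0 < (2 / pi) ^+ 2 :> R by rewrite exprn_gt0 // divr_gt0 // pi_gt0.
have [k0 Hk0] : exists k0, forall k, (k0 <= k)%N -> M <= 2 ^+ k * (2 / pi) ^+ 2 - 3.
  pose z := (M + 3) / (2 / pi) ^+ 2.
  exists (Num.trunc z).+1 => k hk.
  have h1 : z <= 2 ^+ k.
    apply: ltW; apply: lt_le_trans (truncnS_gt z) _.
    by rewrite -natrX ler_nat (leq_trans hk) // ltnW // ltn_expl.
  by move: h1; rewrite /z ler_pdivrMr //; lra.
pose k := maxn k0 (maxn N1 N2).
have big : (k <= n_ k)%N.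
  by rewrite leqW // (leq_trans (Ns_ge k)) // ltnW // ltn_expl.
apply: le_trans (ereal_sup_ubound _); last first.
  exists (n_ k, n_ k); last reflexivity.
  apply: HA; split; [apply: H1|apply: H2] => /=; apply: leq_trans big;
    by rewrite /k !leq_max leqnn !orbT.
rewrite lee_fin; apply: le_trans (mean_hump_ge k); apply: Hk0.
by rewrite leq_maxl.
Qed.

End GlidingHump.

Theorem theorem4p5 (R : realType) (alpha beta : R)
    (halpha : 0 < alpha < 1) (hbeta : 0 < beta < 1) (hab : alpha + beta < 1) :
  (forall f : R * R -> R,
     sharpBV (fun k => k.+1%:R `^ (1 - (alpha + beta))) f ->
     forall x y : R, unitI2 (x, y) -> dyadic_continuous_at f x y ->
       cesaro_mean (- alpha) (- beta) nm.1 nm.2 x y f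
         @[nm --> filter_prod \oo \oo] --> f (x, y))
  /\
  (forall xi : nat -> R,
     (forall k, 0 < xi k) -> nondecreasing_seq xi -> xi k @[k --> \oo] --> +oo ->
     exists f : R * R -> R,
       [/\ {within unitI2, continuous f},
           CsharpV (fun k => k.+1%:R `^ (1 - (alpha + beta)) * xi k) f
         & limf_esup (fun nm : nat * nat =>
             `|cesaro_mean (- alpha) (- beta) nm.1 nm.2 0 0 f|%:E)
             (filter_prod \oo \oo) = +oo%E]).
Proof.
split=> [f bvf x y [xI yI] cf|xi xi0 xid xioo].
  exact: cesaro_cvg halpha hbeta hab xI yI bvf cf.
have [Ns [Ns0 HNs]] := hump_sequence halpha hbeta hab xi0 xid xioo.
exists (hump alpha beta Ns); split.
- by apply: continuous_subspaceT; exact: continuous_hump HNs.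
- exact: CsharpV_hump HNs.
- exact: limf_esup_hump HNs.
Qed.
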